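(* Let $r\geqslant 2$ and $n\geqslant r+1$ be integers, let $k=n-r-1$, and let $\mathcal{I}=(I_1,\ldots,I_k)$ be a tuple of subsets of $[n]$ each of size $r+2$. Append an additional marking to each subset: $$\mathcal{I}' = (I_1\sqcup\{n+1\},\ldots,I_k\sqcup\{n+1\}),$$ a $k$-tuple of subsets of $[n+1]$ each of size $(r+1)+2$ (note $k=(n+1)-(r+1)-1$). Then $$ d_{r+1,n+1}(\mathcal{I}')=d_{r,n}(\mathcal{I}). $$
   Context: Work over an algebraically closed field $\Bbbk$ of characteristic zero; $[n]=\{1,\ldots,n\}$. For an integer $r\geqslant2$ and a finite set $I$ with $|I|\geqslant r+1$, $X(r,I)=U(r,I)/\mathrm{PGL}_r$ is the moduli space of linearly general configurations of points in $\mathbb{P}^{r-1}$ labelled by $I$: here $U(r,I)\subseteq(\mathbb{P}^{r-1})^I$ is the open subset of configurations such that for every $l\in\{0,\ldots,r-2\}$ no linear subspace of dimension $l$ contains $l+2$ of the points, and $\mathrm{PGL}_r$ acts diagonally (and freely). It is an irreducible smooth variety of dimension $(r-1)(|I|-r-1)$. For $I\subseteq[n]$ with $|I|\geqslant r+1$, $\mathrm{fgt}_I\colon X(r,[n])\to X(r,I)$ forgets the points with labels outside $I$. Given $k=n-r-1$ and $\mathcal{I}=(I_1,\ldots,I_k)$ with $I_j\subseteq[n]$, $|I_j|=r+2$, let $\mathrm{fgt}_{\mathcal{I}}=\prod_j \mathrm{fgt}_{I_j}\colon X(r,[n])\to\prod_{j=1}^k X(r,I_j)$, a morphism of irreducible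 varieties of the same dimension. The projective configuration count is $d_{r,n}(\mathcal{I})=\deg(\mathrm{fgt}_{\mathcal{I}})\in\mathbb{N}$ (equal to $0$ if the map is not dominant, otherwise the degree of the function field extension, i.e. the number of points in a general fibre). *)

(* Defs.v *)
From HB Require Import structures.
From mathcomp Require Import all_boot all_order all_algebra.
From mathcomp Require Import mpoly.
From mathcomp Require Import boolp classical_sets functions cardinality.

Set Implicit Arguments.
Unset Strict Implicit.
Unset Printing Implicit Defensive.

Import GRing.Theory.

Local Open Scope classical_set_scope.
Local Open Scope card_scope.
Local Open Scope ring_scope.

(* A point of P^(r-1) is a line in K^r, and a projective subspace of          *)
(* dimension l is a vector subspace of dimension l + 1.                       *)
Definition config (K : fieldType) (r : nat) (T : finType) : Type :=
  T -> {vspace 'rV[K]_r}.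

Section Moduli.
Variables (K : fieldType) (r : nat) (T : finType).
Implicit Types p : config K r T.

Definition lin_general : set (config K r T) :=
  [set p | (forall i, \dim (p i) = 1%N) /\
           forall l, (l <= r - 2)%N -> forall W : {vspace 'rV[K]_r},
             \dim W = l.+1 -> (#|[pred i | (p i <= W)%VS]| < l + 2)%N].

(* GL_r and PGL_r have the same orbits on configurations. *)
Definition pgl_orbit p : set (config K r T) :=
  [set (fun i => (g @: p i)%VS) | g in [set g : 'End('rV[K]_r) | lker g == 0%VS]].

Definition moduli : set (set (config K r T)) := pgl_orbit @` lin_general.

Definition hcoord (v : T -> 'rV[K]_r) (m : 'I_#|{: T * 'I_r}|) : K :=
  v (enum_val m).1 0 (enum_val m).2.

(* The Zariski topology of (P^(r-1))^T is the quotient of that of             *)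
(* (K^r \ {0})^T, so polynomials in the homogeneous coordinates of the points *)
(* need not be multihomogeneous here.                                         *)
Definition zariski_open (O : set (config K r T)) : Prop :=
  forall v : T -> 'rV[K]_r, (forall i, v i != 0) ->
    O (fun i => <[v i]>%VS) ->
    exists2 f : {mpoly K[#|{: T * 'I_r}|]}, f.@[hcoord v] != 0 &
      forall w : T -> 'rV[K]_r, (forall i, w i != 0) ->
        f.@[hcoord w] != 0 -> O (fun i => <[w i]>%VS).

End Moduli.

Arguments lin_general : clear implicits.
Arguments moduli : clear implicits.

Section Product.
Variables (K : fieldType) (r k : nat) (T : 'I_k -> finType).

Definition moduli_prod : set (forall j, set (config K r (T j))) :=
  [set y | forall j, moduli K r (T j) (y j)].

(* A family of configurations labelled by the T j is one configuration        *)
(* labelled by their disjoint union.                                          *)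
Definition component (q : config K r {j : 'I_k & T j}) (j : 'I_k) :
    config K r (T j) :=
  fun t => q (Tagged (fun j => T j) t).
Arguments component : clear implicits.

(* The product of the moduli spaces is a geometric quotient of the product of *)
(* the open sets lin_general by a power of PGL_r, so that it has the quotient *)
(* topology.                                                                  *)
Definition moduli_prod_open (V : set (forall j, set (config K r (T j)))) : Prop :=
  V `<=` moduli_prod /\
  zariski_open [set q | (forall j, lin_general K r (T j) (component q j)) /\
                        V (fun j => pgl_orbit (component q j))].

End Product.

Arguments moduli_prod : clear implicits.
Arguments component {K r k T} q j.

Definition labels (n : nat) (J : {set 'I_n}) : finType := {i : 'I_n | i \in J}.

Section Count.
Variables (K : fieldType) (r n : nat).

(* Orbits are sets of configurations, and restricting all the members of an   *)
(* orbit to J yields a full orbit of configurations labelled by J.            *)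
Definition fgt (J : {set 'I_n}) (x : set (config K r 'I_n)) :
    set (config K r (labels J)) :=
  [set (fun i : labels J => p (val i)) | p in x].
Arguments fgt : clear implicits.

Variables (k : nat) (I : 'I_k -> {set 'I_n}).

Definition fgts (x : set (config K r 'I_n)) :
    forall j, set (config K r (labels (I j))) :=
  fun j => fgt (I j) x.

Definition fgts_dominant : Prop :=
  forall V, moduli_prod_open V -> V !=set0 ->
    (V `&` fgts @` moduli K r 'I_n) !=set0.

Definition general_fibre_card (d : nat) : Prop :=
  exists V, [/\ moduli_prod_open V, V !=set0 &
    forall y, V y -> (moduli K r 'I_n `&` fgts @^-1` [set y]) #= `I_d].

(* Over an algebraically closed field of characteristic zero, when the two    *)
(* sides have the same dimension, i.e. k = n - r - 1 and #|I j| = r + 2, there *)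
(* is exactly one d with general_fibre_card d; when fgts is dominant it is    *)
(* the degree of the extension of function fields.                            *)
Definition config_count : nat :=
  if `[< fgts_dominant >] then xget 0%N [set d | general_fibre_card d] else 0%N.

End Count.

Arguments fgt {K r n} J x.
Arguments fgts {K r n k} I x j.
Arguments config_count : clear implicits.

(* The element n + 1 of [n + 1] is ord_max. *)
Definition append_marking (n k : nat) (I : 'I_k -> {set 'I_n}) :
    'I_k -> {set 'I_n.+1} :=
  fun j => (ord_max |: (widen_ord (leqnSn n) @: I j))%SET.

(* Main.v *)
(* Projecting from the last point maps X(r+1, n+1) to X(r, n), and over a point v   *)
(* of X(r, n) a lift is a vector t of last coordinates, up to scaling and modulo   *)
(* the coordinates of v.  A lift of fgt_I(v) to the product of the X(r+1, I_j + 1) *)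
(* is the choice, for each j, of a line d_j in the plane E_j of linear relations   *)
(* between the points of v labelled by I_j, and the lifts t of v mapping to it are *)
(* the general solutions of the k linear equations t . d_j = 0 on a space of       *)
(* dimension k + 1.  So the fibres over the two sides are in bijection as soon as, *)
(* for every v in the fibre, the d_j are independent and the solution is general.  *)
(* If fgt_I is dominant then in characteristic zero its differential is generically *)
(* bijective; a dimension count in the cotangent spaces then shows that any S      *)
(* nonempty satisfies dim sum_(j in S) E_j > |S|, and by Rado's theorem general    *)
(* d_j in E_j are independent, even together with any given relation.  The pairs   *)
(* (v, d) for which this fails form a proper closed subset of a space of the same  *)
(* dimension as the target, and by counting polynomials of bounded degree the      *)
(* image of such a subset is not dense.                                            *)
(* The equality of the counts follows without knowing that general fibres have a   *)
(* constant cardinality: the two sets of possible cardinalities coincide.          *)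

Require Import Defs.
From mathcomp Require Import all_boot all_order all_algebra.
From HB Require Import structures.
From mathcomp Require Import mpoly zify ring.
From mathcomp Require Import boolp classical_sets functions cardinality.

Set Implicit Arguments.
Unset Strict Implicit.
Unset Printing Implicit Defensive.

Import GRing.Theory.

(** * Polynomial functions *)

Section PolynomialFunctions.
Local Open Scope ring_scope.
Variable K : fieldType.

(** Put the appended point at the first basis vector. A configuration in X(r+1, n+1) is then a
    [cone] over its projection [v] in X(r, n) from that point: each other point has one extra
    coordinate [t i], and [t] counts up to scaling and up to adding the values of a linear form
    ([cone_equiv]). The same holds for every local configuration, so a target point upstairs is a
    target point [q] downstairs together with extra coordinates [tau]. For fixed [v] over [q], lying
    over [tau] is one linear equation in [t] for each j, the vanishing of [local_det]. With r
    normalizations this makes n - 1 equations in n unknowns. The solution is unique up to scaling,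
    and is a general configuration, as soon as the square matrices [system] are invertible; this
    gives the bijection of fibres [fibre_lift].

    The main work is that a general pair (q, tau) has this property for all [v] over [q] at once.
    First, one invertible system is found. If the map downstairs is dominant, its differential is
    invertible at a general point ([jacobian_dual]), hence the cotangent spaces of the X(r, I_j) are
    independent ([dominant_cotangent_independent]). A dimension count turns this into a strict Hall
    condition on the spaces of local relations ([hall]), and [rado] yields independent
    representatives ([local_relations_span]), from which [system_nonzero] builds a suitable [tau].
    Second, the bad pairs form a proper hypersurface in a parameter space of the dimension of the
    target, and [hypersurface_image] puts its image in a proper hypersurface ([good_locus]).

    Dominance and general fibres are expressed by nonvanishing of polynomials in representing
    vectors ([fgts_dominantP], [general_fibre_cardP]). Such conditions are carried between pairs (q,
    tau) and families upstairs by [pullback] and [pushforward]. Each map is then dominant if and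
    only if the other is, and in that case the same numbers occur as cardinalities of general
    fibres. *)

Inductive pexpr (S : Type) : Type :=
| PConst of K
| PVar of S
| PAdd of pexpr S & pexpr S
| PMul of pexpr S & pexpr S.
Arguments PConst {S}.

(** The target ring is arbitrary so that an expression can also be evaluated in [{poly K}], which
    restricts it to a line. *)
Fixpoint peval (S : Type) (L : comPzRingType) (h : K -> L) (u : S -> L)
    (e : pexpr S) : L :=
  match e with
  | PConst c => h c
  | PVar i => u i
  | PAdd a b => peval h u a + peval h u b
  | PMul a b => peval h u a * peval h u b
  end.

Definition polyfun (S : Type) (phi : (S -> K) -> K) : Prop :=
  exists e : pexpr S, forall s, phi s = peval id s e.

Definition nonzero_fun (S : Type) (phi : (S -> K) -> K) : Prop :=
  exists s, phi s != 0.

Section Closure.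
Variable S : Type.
Implicit Types phi psi : (S -> K) -> K.

Lemma polyfun_const c : polyfun (fun _ : S -> K => c).
Proof. by exists (PConst c). Qed.

Lemma polyfun_coord i : polyfun (fun s : S -> K => s i).
Proof. by exists (PVar i). Qed.

Lemma polyfunD phi psi : polyfun phi -> polyfun psi ->
  polyfun (fun s => phi s + psi s).
Proof. by move=> [e E] [f F]; exists (PAdd e f) => s /=; rewrite E F. Qed.

Lemma polyfunM phi psi : polyfun phi -> polyfun psi ->
  polyfun (fun s => phi s * psi s).
Proof. by move=> [e E] [f F]; exists (PMul e f) => s /=; rewrite E F. Qed.

Lemma polyfun_ext phi psi : (forall s, phi s = psi s) -> polyfun phi -> polyfun psi.
Proof. by move=> E [e H]; exists e => s; rewrite -E. Qed.

Lemma polyfunN phi : polyfun phi -> polyfun (fun s => - phi s).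
Proof.
move=> P; apply: polyfun_ext (polyfunM (polyfun_const (-1)) P) => s.
by rewrite mulN1r.
Qed.

Lemma polyfunB phi psi : polyfun phi -> polyfun psi ->
  polyfun (fun s => phi s - psi s).
Proof. by move=> P Q; apply: polyfunD (polyfunN Q). Qed.

Lemma polyfun_sum (J : Type) (r : seq J) (P : pred J) (F : J -> (S -> K) -> K) :
  (forall j, polyfun (F j)) -> polyfun (fun s => \sum_(j <- r | P j) F j s).
Proof.
move=> H; elim: r => [|j r IH].
  by apply: polyfun_ext (polyfun_const 0) => s; rewrite big_nil.
case Pj: (P j).
  by apply: polyfun_ext (polyfunD (H j) IH) => s; rewrite big_cons Pj.
by apply: polyfun_ext IH => s; rewrite big_cons Pj.
Qed.

Lemma polyfun_prod (J : Type) (r : seq J) (P : pred J) (F : J -> (S -> K) -> K) :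
  (forall j, polyfun (F j)) -> polyfun (fun s => \prod_(j <- r | P j) F j s).
Proof.
move=> H; elim: r => [|j r IH].
  by apply: polyfun_ext (polyfun_const 1) => s; rewrite big_nil.
case Pj: (P j).
  by apply: polyfun_ext (polyfunM (H j) IH) => s; rewrite big_cons Pj.
by apply: polyfun_ext IH => s; rewrite big_cons Pj.
Qed.

Lemma polyfunX phi m : polyfun phi -> polyfun (fun s => phi s ^+ m).
Proof.
move=> P; elim: m => [|m IH]; first exact: polyfun_const.
by apply: polyfun_ext (polyfunM P IH) => s; rewrite exprS.
Qed.

Lemma polyfun_det m (F : (S -> K) -> 'M[K]_m) :
  (forall i j, polyfun (fun s => F s i j)) -> polyfun (fun s => \det (F s)).
Proof.
move=> H; rewrite /determinant; apply: polyfun_sum => p.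
by apply: polyfunM; [exact: polyfun_const | apply: polyfun_prod].
Qed.

End Closure.

Lemma polyfun_comp (S S2 : Type) (phi : (S -> K) -> K) (F : (S2 -> K) -> S -> K) :
  polyfun phi -> (forall i, polyfun (fun s => F s i)) -> polyfun (fun s => phi (F s)).
Proof.
move=> [e E] H; apply: (@polyfun_ext _ (fun s => peval id (F s) e)) => [s|].
  by rewrite E.
elim: e {E} => [c|i|a IHa b IHb|a IHa b IHb] /=.
- exact: polyfun_const.
- exact: H.
- exact: polyfunD.
- exact: polyfunM.
Qed.

Lemma peval_horner (S : Type) (u : S -> {poly K}) (c : K) (e : pexpr S) :
  (peval (@polyC K) u e).[c] = peval id (fun i => (u i).[c]) e.
Proof.
by elim: e => [d|i|a IHa b IHb|a IHa b IHb] /=; rewrite ?hornerE //= ?IHa ?IHb.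
Qed.

Lemma polyfun_line (S : Type) (phi : (S -> K) -> K) (a b : S -> K) :
  polyfun phi -> exists p : {poly K}, forall c, p.[c] = phi (fun i => a i + c * b i).
Proof.
move=> [e E]; exists (peval (@polyC K) (fun i => (a i)%:P + 'X * (b i)%:P) e) => c.
rewrite peval_horner E; congr (peval _ _ _); apply/funext => i.
by rewrite !hornerE.
Qed.

End PolynomialFunctions.

Arguments PConst {K S}.
Arguments PVar {K S}.

Section Mpoly.
Local Open Scope ring_scope.
Variable K : fieldType.

Lemma polyfun_meval m (f : {mpoly K[m]}) : polyfun (fun v : 'I_m -> K => f.@[v]).
Proof.
apply: (@polyfun_ext _ _ (fun v => \sum_(a <- msupp f) f@_a * \prod_i v i ^+ a i)).
  by move=> s; rewrite mevalE.
apply: polyfun_sum => a; apply: polyfunM; first exact: polyfun_const.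
by apply: polyfun_prod => i; apply/polyfunX/polyfun_coord.
Qed.

Lemma polyfun_mpoly (S : finType) (phi : (S -> K) -> K) : polyfun phi ->
  exists f : {mpoly K[#|S|]}, forall s, f.@[fun i => s (enum_val i)] = phi s.
Proof.
move=> [e E].
suff [f F]: exists f : {mpoly K[#|S|]}, forall s : S -> K,
    f.@[fun i => s (enum_val i)] = peval id s e.
  by exists f => s; rewrite F E.
elim: e {E} => [c|i|a [p P] b [q Q]|a [p P] b [q Q]] /=.
- by exists c%:MP => s; rewrite mevalC.
- by exists 'X_(enum_rank i) => s; rewrite mevalXU enum_rankK.
- by exists (p + q) => s; rewrite mevalD P Q.
- by exists (p * q) => s; rewrite mevalM P Q.
Qed.

End Mpoly.

Section Infinite.
Local Open Scope ring_scope.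
Variable K : fieldType.
Hypothesis charK : [pchar K] =i pred0.

Lemma natK_inj (m n : nat) : m%:R = n%:R :> K -> m = n.
Proof.
wlog lemn : m n / (m <= n)%N.
  by move=> W; case/orP: (leq_total m n) => [|/W H /esym/H]; [exact: W|].
move=> E; have : (n - m)%:R = 0 :> K by rewrite natrB // E subrr.
by move/eqP; rewrite ((pcharf0P K).1 charK) subn_eq0 => H; apply/eqP; rewrite eqn_leq lemn.
Qed.

Lemma poly_vanish (p : {poly K}) B : (size p <= B)%N ->
  (forall i, (i < B)%N -> p.[i%:R] = 0) -> p = 0.
Proof.
move=> sp H; apply: (@roots_geq_poly_eq0 _ p [seq i%:R | i <- iota 0 B]).
- by apply/allP => x /mapP [i]; rewrite mem_iota => /andP[_ /H/eqP ip] ->.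
- by rewrite map_inj_uniq ?iota_uniq // => i j /natK_inj.
- by rewrite size_map size_iota.
Qed.

Lemma poly_vanish_all (p : {poly K}) : (forall c, p.[c] = 0) -> p = 0.
Proof. by move=> H; apply: (@poly_vanish p (size p)). Qed.

(** Irreducibility of affine space: restrict both functions to the line joining a nonzero of each. A
    product of nonzero polynomials in one variable is nonzero, and has a nonzero value since [K] is
    infinite. *)
Lemma nonzero_funM (S : Type) (phi psi : (S -> K) -> K) :
  polyfun phi -> polyfun psi -> nonzero_fun phi -> nonzero_fun psi ->
  nonzero_fun (fun s => phi s * psi s).
Proof.
move=> P Q [a pa] [b qb].
have [p pE] := polyfun_line a (fun i => b i - a i) P.
have [q qE] := polyfun_line a (fun i => b i - a i) Q.
apply: contrapT => H.
have : p * q = 0.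
  apply: poly_vanish_all => c; rewrite hornerM pE qE; apply/eqP.
  by apply: contrapT => /negP N; apply: H; exists (fun i => a i + c * (b i - a i)).
move/eqP; rewrite mulf_eq0 => /orP[] /eqP E.
- have := pE 0; rewrite E horner0 (_ : (fun i => _) = a) => [pa0|].
    by rewrite -pa0 eqxx in pa.
  by apply/funext => i; rewrite mul0r addr0.
- have := qE 1; rewrite E horner0 (_ : (fun i => _) = b) => [qb0|].
    by rewrite -qb0 eqxx in qb.
  by apply/funext => i; rewrite mul1r addrC subrK.
Qed.

Lemma nonzero_fun_prod (S : Type) (J : eqType) (r : seq J) (P : pred J) (F : J -> (S -> K) -> K) :
  (forall j, polyfun (F j)) -> (forall j, P j -> nonzero_fun (F j)) ->
  inhabited (S -> K) ->
  nonzero_fun (fun s => \prod_(j <- r | P j) F j s).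
Proof.
move=> H N [s0]; elim: r => [|j r IH].
  by exists s0; rewrite big_nil oner_eq0.
case Pj: (P j); last by case: IH => s; exists s; rewrite big_cons Pj.
have [s E] := nonzero_funM (H j) (polyfun_prod r P H) (N j Pj) IH.
by exists s; rewrite big_cons Pj.
Qed.

End Infinite.

(** * Bounded degree in each variable, and interpolation on grids *)

Section BoxDegree.
Local Open Scope ring_scope.
Variables (K : fieldType) (S : finType).
Implicit Types phi psi : (S -> K) -> K.

Definition upd (s : S -> K) (i : S) (c : K) : S -> K :=
  fun j => if j == i then c else s j.

Lemma upd_id s i : upd s i (s i) = s.
Proof. by apply/funext => j; rewrite /upd; case: eqP => [->|]. Qed.

(** Degree at most [B] in each variable separately, stated on functions through their restrictions
    to coordinate lines. *)
Definition boxdeg phi (B : nat) : Prop :=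
  forall s i, exists2 p : {poly K}, (size p <= B.+1)%N &
    forall c, p.[c] = phi (upd s i c).

Lemma boxdeg_le phi B C : (B <= C)%N -> boxdeg phi B -> boxdeg phi C.
Proof. by move=> le H s i; have [p sp E] := H s i; exists p => //; apply: leq_trans sp _. Qed.

Lemma boxdeg_const c : boxdeg (fun _ => c) 0.
Proof.
by move=> s i; exists c%:P => [|d]; rewrite ?size_polyC ?hornerC //; case: (c != 0).
Qed.

Lemma boxdeg_coord j : boxdeg (fun s => s j) 1.
Proof.
move=> s i; case: (eqVneq j i) => [->|ji].
  by exists 'X => [|c]; rewrite ?size_polyX // hornerX /upd eqxx.
exists (s j)%:P => [|c]; first by rewrite size_polyC; case: (_ != 0).
by rewrite hornerC /upd (negbTE ji).
Qed.

Lemma boxdegD phi psi B C : boxdeg phi B -> boxdeg psi C ->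
  boxdeg (fun s => phi s + psi s) (maxn B C).
Proof.
move=> HB HC s i; have [p sp pE] := HB s i; have [q sq qE] := HC s i.
exists (p + q) => [|c]; last by rewrite hornerD pE qE.
rewrite (leq_trans (size_polyD p q)) // -maxnSS geq_max.
by rewrite (leq_trans sp) ?leq_maxl // (leq_trans sq) ?leq_maxr.
Qed.

Lemma boxdegM phi psi B C : boxdeg phi B -> boxdeg psi C ->
  boxdeg (fun s => phi s * psi s) (B + C).
Proof.
move=> HB HC s i; have [p sp pE] := HB s i; have [q sq qE] := HC s i.
exists (p * q) => [|c]; last by rewrite hornerM pE qE.
rewrite (leq_trans (size_polyMleq p q)) //.
by rewrite -subn1 leq_subLR add1n -addSn -addnS leq_add.
Qed.

Lemma boxdeg_sum (J : Type) (r : seq J) (P : pred J) (F : J -> (S -> K) -> K) B :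
  (forall j, boxdeg (F j) B) -> boxdeg (fun s => \sum_(j <- r | P j) F j s) B.
Proof.
move=> H; elim: r => [|j r IH] s i.
  have [p sp pE] := boxdeg_le (leq0n B) (boxdeg_const 0) s i.
  by exists p => // c; rewrite pE big_nil.
case Pj: (P j); last by have [p sp E] := IH s i; exists p => // c; rewrite big_cons Pj.
have [p sp E] := boxdegD (H j) IH s i.
by exists p => [|c]; [rewrite maxnn in sp|rewrite big_cons Pj E].
Qed.

Lemma boxdeg_prod (J : Type) (r : seq J) (P : pred J) (F : J -> (S -> K) -> K) B :
  (forall j, boxdeg (F j) B) ->
  boxdeg (fun s => \prod_(j <- r | P j) F j s) (size r * B).
Proof.
move=> H; elim: r => [|j r IH] s i.
  have [p sp pE] := boxdeg_const 1 s i.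
  by exists p => // c; rewrite pE big_nil.
case Pj: (P j).
  have [p sp E] := boxdegM (H j) IH s i.
  by exists p => [|c]; [rewrite /= mulSn|rewrite big_cons Pj E].
have [p sp E] := boxdeg_le (leq_addl B _) IH s i; exists p => [|c].
  by rewrite /= mulSn.
by rewrite big_cons Pj.
Qed.

Lemma polyfun_boxdeg phi : polyfun phi -> exists B, boxdeg phi B.
Proof.
move=> [e E]; suff [B H]: exists B, boxdeg (fun s => peval id s e) B.
  by exists B => s i; have [p sp pE] := H s i; exists p => // c; rewrite pE E.
elim: e {E} => [c|i|a [B HB] b [C HC]|a [B HB] b [C HC]] /=.
- by exists 0%N; apply: boxdeg_const.
- by exists 1%N; apply: boxdeg_coord.
- by exists (maxn B C); apply: boxdegD.
- by exists (B + C)%N; apply: boxdegM.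
Qed.

Definition grid (D : nat) (g : {ffun S -> 'I_D}) : S -> K := fun i => (g i)%:R.

(** The interpolation polynomial of the grid point [g], left unnormalized. *)
Definition lagrange (D : nat) (g : {ffun S -> 'I_D}) (s : S -> K) : K :=
  \prod_i \prod_(a < D | a != g i) (s i - a%:R).

Lemma polyfun_lagrange D (g : {ffun S -> 'I_D}) : polyfun (lagrange g).
Proof.
apply: polyfun_prod => i; apply: polyfun_prod => a.
by apply: polyfunB; [apply: polyfun_coord | apply: polyfun_const].
Qed.

Lemma boxdeg_lagrange D (g : {ffun S -> 'I_D}) : boxdeg (lagrange g) D.-1.
Proof.
move=> s i; exists ((\prod_(j | j != i) \prod_(a < D | a != g j) (s j - a%:R)) *:
                    \prod_(a < D | a != g i) ('X - (a%:R)%:P)).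
  apply: leq_trans (size_scale_leq _ _) _.
  rewrite -big_filter size_prod_XsubC.
  have -> : size [seq a <- index_enum 'I_D | a != g i] = #|[pred a | a != g i]|.
    by rewrite cardE /enum_mem.
  by have := cardC1 (g i); rewrite card_ord => <-.
move=> c; rewrite hornerZ horner_prod /lagrange.
rewrite [RHS](bigD1 i) //= mulrC; congr (_ * _).
  by apply: eq_bigr => a _; rewrite hornerXsubC /upd eqxx.
by apply: eq_bigr => j ji; apply: eq_bigr => a _; rewrite /upd (negbTE ji).
Qed.

Hypothesis charK : [pchar K] =i pred0.

Lemma lagrange_grid D (g h : {ffun S -> 'I_D}) :
  (lagrange g (grid h) != 0) = (g == h).
Proof.
apply/idP/idP => [|/eqP ->].
  apply: contraNT => /eqP gh.
  have [i ghi] : exists i, g i != h i.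
    apply: contrapT => N; apply: gh; apply/ffunP => i; apply/eqP.
    by apply: contrapT => /negP H; apply: N; exists i.
  rewrite /lagrange (bigD1 i) //= (bigD1 (h i)) 1?eq_sym //=.
  by rewrite subrr !mul0r.
apply/prodf_neq0 => i _; apply/prodf_neq0 => a ah; rewrite subr_eq0.
by apply: contraNneq ah => /(natK_inj charK) H; rewrite -val_eqE /= H.
Qed.

(** Induction on the number of coordinates of [s] outside 0, ..., B: along such a coordinate [phi]
    is a polynomial of degree at most B which, by induction, has the B + 1 roots 0, ..., B. *)
Lemma grid_vanish phi B : boxdeg phi B ->
  (forall g : {ffun S -> 'I_B.+1}, phi (grid g) = 0) -> forall s, phi s = 0.
Proof.
move=> bd H s.
pose bad (s : S -> K) := [set i | ~~ [exists a : 'I_B.+1, s i == a%:R]]%SET.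
have [m] := ubnP #|bad s|; elim: m s => // m IH s; rewrite ltnS => le.
have [|[i ib]] := set_0Vmem (bad s) => [b0|].
  have /choice [g gE] : forall i, exists a : 'I_B.+1, s i = a%:R.
    move=> i; have : i \notin bad s by rewrite b0 inE.
    by rewrite inE negbK => /existsP[a /eqP]; exists a.
  rewrite -(H [ffun i => g i]); congr phi; apply/funext => i.
  by rewrite /grid ffunE.
have [p sp pE] := bd s i.
rewrite -(upd_id s i) -pE (_ : p = 0) ?horner0 //.
apply: (poly_vanish charK sp) => a aB; rewrite pE; apply: IH.
apply: leq_trans le; apply/proper_card/properP; split; last first.
  exists i => //; rewrite inE negbK; apply/existsP; exists (Ordinal aB).
  by rewrite /upd eqxx.
apply/fintype.subsetP => j; rewrite !inE; apply: contraNN => /existsP [d dE].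
apply/existsP; rewrite /upd; case: eqP => [_|_]; last by exists d.
by exists (Ordinal aB).
Qed.

End BoxDegree.

Lemma size_index_enum (T : finType) : size (index_enum T) = #|T|.
Proof. by rewrite cardT -deprecated_filter_index_enum filter_predT. Qed.

(** A Bernoulli inequality: it bounds what [hypersurface_image] loses by lowering the degree bound
    from [B] to [B - d] to make room for the factor [f]. *)
Lemma expn_sub_bound B d N : B ^ N.+1 <= (B - d) ^ N.+1 + N.+1 * d * B ^ N.
Proof.
elim: N => [|N IH]; first by rewrite !expn1 expn0 mul1n muln1 addnC -leq_subLR.
rewrite expnS; apply: leq_trans (leq_mul (leqnn B) IH) _.
rewrite mulnDr; have -> : B * (N.+1 * d * B ^ N) = N.+1 * d * B ^ N.+1.
  by rewrite expnS mulnCA.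
have le : B * (B - d) ^ N.+1 <= (B - d) ^ N.+2 + d * B ^ N.+1.
  rewrite (expnS _ N.+1); apply: (@leq_trans ((B - d + d) * (B - d) ^ N.+1)).
    by rewrite leq_mul2r; apply/orP; right; lia.
  rewrite mulnDl leq_add2l leq_mul2l; apply/orP; right.
  by rewrite leq_exp2r // leq_subr.
apply: leq_trans (leq_add le (leqnn _)) _.
by rewrite -addnA leq_add2l [N.+2]lock -lock (mulSn N.+1) mulnDl.
Qed.

Lemma exists_left_kernel (K : fieldType) (U E : finType) (A : U -> E -> K) :
  #|E| < #|U| ->
  exists2 u : U -> K, (exists i, u i != 0%R) & forall e, (\sum_i u i * A i e)%R = 0%R.
Proof.
move=> lt; pose M := (\matrix_(i < #|U|, j < #|E|) A (enum_val i) (enum_val j))%R.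
have : kermx M != 0%R.
  rewrite kermx_eq0 /row_free neq_ltn; apply/orP; left.
  exact: leq_ltn_trans (rank_leq_col M) lt.
move=> /matrix0Pn [i [j ij]]; exists (fun x => kermx M i (enum_rank x)).
  by exists (enum_val j); rewrite enum_valK.
move=> e; have /matrixP /(_ i (enum_rank e)) := mulmx_ker M.
rewrite !mxE => E0; rewrite -[RHS]E0 (reindex (@enum_val U predT)) /=.
  by apply: eq_bigr => l _; rewrite !mxE enum_valK enum_rankK.
by exists enum_rank => l _; rewrite ?enum_valK ?enum_rankK.
Qed.

(* Among the polynomials in the F l of degree < D in each of the N variables   *)
(* and the multiples of f of degree < c D, there are more than (c D)^N          *)
(* generators when D is large, so some combination of the former is a multiple *)
(* of f.                                                                       *)
Lemma hypersurface_image (K : fieldType) (charK : [pchar K]%R =i pred0)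
    (S S' : finType) (F : (S -> K) -> S' -> K) (f : (S -> K) -> K) :
  #|S| = #|S'| -> (forall l, polyfun (fun s => F s l)) ->
  polyfun f -> nonzero_fun f ->
  exists G : (S' -> K) -> K, [/\ polyfun G, nonzero_fun G &
    forall s, f s = 0%R -> G (F s) = 0%R].
Proof.
move=> cardS pF pf nzf.
have [d fd] := polyfun_boxdeg pf.
have [e Fe] : exists e, forall l, boxdeg (fun s => F s l) e.
  have /choice [e0 H] := fun l => polyfun_boxdeg (pF l).
  by exists (\max_l e0 l) => l; apply: boxdeg_le (H l); apply: leq_bigmax.
(* [c] makes a polynomial of degree below D in each variable, composed with [F], of degree below B =
   cD in each variable. [D] exceeds N d c^(N-1), so that for N > 0 the gain D^N outweighs the loss
   B^N - (B - d)^N, which is at most N d B^(N-1). *)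
pose N := #|S|; pose c := N * e + 1; pose D := (N * d * c ^ N.-1).+1.
pose B := c * D.
pose U := ({ffun S' -> 'I_D} + {ffun S -> 'I_(B - d)})%type.
have B0 : 0 < B by rewrite muln_gt0 /c addn1.
have ltEU : #|{ffun S -> 'I_B.-1.+1}| < #|{: U}|.
  have cardE m : #|{ffun S -> 'I_m}| = m ^ N by rewrite card_ffun card_ord.
  have cardE' m : #|{ffun S' -> 'I_m}| = m ^ N by rewrite card_ffun card_ord -cardS.
  rewrite card_sum cardE cardE' cardE prednK // addnC.
  have D0 : 0 < D by [].
  have [N0|N0] := posnP N; first by rewrite N0.
  have DE : N * d * c ^ N.-1 < D by [].
  have BE : B = c * D by [].
  case: (N) N0 DE => [|N'] //= _ DE.
  apply: leq_ltn_trans (expn_sub_bound B d N') _.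
  by rewrite ltn_add2l BE expnMn mulnA expnS ltn_mul2r DE expn_gt0 D0.
pose A (u : U) : (S -> K) -> K := fun s =>
  match u with
  | inl g => lagrange g (F s)
  | inr h => (f s * lagrange h s)%R
  end.
have Abd u : boxdeg (A u) B.-1.
  case: u => [g|h] /=.
  - apply: (@boxdeg_le _ _ _ (size (index_enum S') * (size (index_enum 'I_D) * e))).
      have D0 : 0 < D by [].
      rewrite !size_index_enum card_ord -cardS -/N (mulnC D) mulnA /B /c mulnDl.
      by rewrite mul1n; lia.
    apply: boxdeg_prod => l; apply: boxdeg_prod => a s i.
    have [p sp pE] := boxdegD (Fe l) (@boxdeg_const K S (- a%:R)%R) s i.
    exists p => //; move: sp; rewrite maxn0; exact: id.
  (* If B <= d, then [h] takes values in an empty type, so [S] is empty and there is no variable to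
     test. *)
  - case: (leqP B d) => [le|lt].
      have B'0 : B - d = 0 by apply/eqP; rewrite subn_eq0.
      case: (pickP (@predT S)) => [i _|S0].
        by have := ltn_ord (h i); rewrite [X in _ < X]B'0.
      by move=> s i; have := S0 i.
    apply: boxdeg_le (boxdegM fd (@boxdeg_lagrange K S _ h)).
    lia.
(* There are more generators than grid points, so a nontrivial combination vanishes on the grid,
   hence everywhere. *)
have [u [i0 ui0] uE] := exists_left_kernel (fun x (g : {ffun S -> 'I_B.-1.+1}) => A x (@grid K S _ g)) ltEU.
have van s : (\sum_i u i * A i s)%R = 0%R.
  refine (@grid_vanish K S charK (fun s => \sum_i u i * A i s)%R B.-1 _ uE s).
  apply: boxdeg_sum => x s' i.
  have [p sp pE] := boxdegM (@boxdeg_const K S (u x)) (Abd x) s' i.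
  by exists p.
pose G (y : S' -> K) : K := (\sum_g u (inl g) * lagrange g y)%R.
pose H (s : S -> K) : K := (\sum_h u (inr h) * lagrange h s)%R.
have GH s : (G (F s) + f s * H s = 0)%R.
  rewrite -(van s) big_sumType /=; congr (_ + _)%R.
  by rewrite big_distrr; apply: eq_bigr => h _ /=; rewrite mulrCA.
have indep (T : finType) m (w : {ffun T -> 'I_m} -> K) :
    (forall s, (\sum_g w g * lagrange g s)%R = 0%R) -> forall g, w g = 0%R.
  move=> E g; have := E (@grid K T _ g); rewrite (bigD1 g) //= big1 ?addr0.
    move/eqP; rewrite mulf_eq0 => /orP[/eqP //|].
    by have := lagrange_grid charK g g; rewrite eqxx => /negP nE /nE.
  move=> h hg; have := lagrange_grid charK h g; rewrite (negbTE hg).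
  by move=> /negbFE/eqP ->; rewrite mulr0.
exists G; split.
- apply: polyfun_sum => g; apply: polyfunM; first exact: polyfun_const.
  exact: polyfun_lagrange.
(* If [G] were zero, then f H and hence [H] would be zero, and the independence of the interpolation
   polynomials would kill [u]. *)
- apply: contrapT => nG.
  have G0 y : G y = 0%R.
    by apply/eqP; apply: contrapT => /negP Gy; apply: nG; exists y.
  have H0 s : H s = 0%R.
    apply/eqP; apply: contrapT => /negP Hs.
    have pH : polyfun H.
      apply: polyfun_sum => g; apply: polyfunM; first exact: polyfun_const.
      exact: polyfun_lagrange.
    have [s1] := nonzero_funM charK pf pH nzf (ex_intro _ s Hs).
    by have := GH s1; rewrite G0 add0r => ->; rewrite eqxx.
  case: i0 ui0 => [g|h].
  + by rewrite (indep _ _ (fun g => u (inl g)) G0) eqxx.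
  + by rewrite (indep _ _ (fun g => u (inr g)) H0) eqxx.
- by move=> s fs; have := GH s; rewrite fs mul0r addr0.
Qed.

(** * Dominant maps in characteristic zero *)

Section Derivatives.
Local Open Scope ring_scope.
Variable K : fieldType.

Fixpoint pder (S : Type) (a b : S -> K) (e : pexpr K S) : K :=
  match e with
  | PConst _ => 0
  | PVar i => b i
  | PAdd e1 e2 => pder a b e1 + pder a b e2
  | PMul e1 e2 => pder a b e1 * peval id a e2 + peval id a e1 * pder a b e2
  end.

Fixpoint psubst (S S' : Type) (F : S' -> pexpr K S) (e : pexpr K S') : pexpr K S :=
  match e with
  | PConst c => PConst c
  | PVar i => F i
  | PAdd e1 e2 => PAdd (psubst F e1) (psubst F e2)
  | PMul e1 e2 => PMul (psubst F e1) (psubst F e2)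
  end.

Fixpoint partial (S : eqType) (i : S) (e : pexpr K S) : pexpr K S :=
  match e with
  | PConst _ => PConst 0
  | PVar j => PConst (j == i)%:R
  | PAdd e1 e2 => PAdd (partial i e1) (partial i e2)
  | PMul e1 e2 => PAdd (PMul (partial i e1) e2) (PMul e1 (partial i e2))
  end.

Lemma peval_psubst S S' (F : S' -> pexpr K S) (a : S -> K) e :
  peval id a (psubst F e) = peval id (fun l => peval id a (F l)) e.
Proof. by elim: e => //= [e -> f ->|e -> f ->]. Qed.

Lemma pder_psubst S S' (F : S' -> pexpr K S) (a b : S -> K) e :
  pder a b (psubst F e) =
  pder (fun l => peval id a (F l)) (fun l => pder a b (F l)) e.
Proof. by elim: e => //= [e -> f ->|e -> f ->] //; rewrite !peval_psubst. Qed.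

Lemma pder_partial (S : finType) (a b : S -> K) e :
  pder a b e = \sum_i b i * peval id a (partial i e).
Proof.
elim: e => [c|j|e IHe f IHf|e IHe f IHf] /=.
- by rewrite big1 // => i _; rewrite mulr0.
- rewrite (bigD1 j) //= eqxx mulr1 big1 ?addr0 // => i ij.
  by rewrite eq_sym (negbTE ij) mulr0.
- by rewrite IHe IHf -big_split; apply: eq_bigr => i _; rewrite mulrDr.
- rewrite IHe IHf big_distrl big_distrr -big_split; apply: eq_bigr => i _ /=.
  by rewrite mulrDr; congr (_ + _); [rewrite mulrA | rewrite mulrCA].
Qed.

Lemma pder_line (S : Type) (a b : S -> K) e :
  (peval (@polyC K) (fun i => (a i)%:P + 'X * (b i)%:P) e)^`().[0] = pder a b e.
Proof.
have H f : (peval (@polyC K) (fun i => (a i)%:P + 'X * (b i)%:P) f).[0] = peval id a f.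
  rewrite peval_horner; congr peval; apply/funext => i.
  by rewrite !hornerE ?mul0r ?addr0.
elim: e => [c|i|e IHe f IHf|e IHe f IHf] /=.
- by rewrite derivC horner0.
- by rewrite derivD derivC add0r derivM derivX derivC mulr0 addr0 mul1r hornerC.
- by rewrite derivD hornerD IHe IHf.
- by rewrite derivM hornerD !hornerM IHe IHf !H.
Qed.

(** The linear Taylor coefficient along a line: unlike [pder], it refers to the function and not to
    an expression for it. *)
Definition hasder (S : Type) (phi : (S -> K) -> K) (a b : S -> K) (d : K) : Prop :=
  exists q : {poly K}, forall c,
    phi (fun i => a i + c * b i) = phi a + c * d + c ^+ 2 * q.[c].

Hypothesis charK : [pchar K] =i pred0.

Lemma pder_zero (S : Type) (a b : S -> K) e :
  (forall s, peval id s e = 0) -> pder a b e = 0.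
Proof.
move=> H; rewrite -pder_line (_ : peval _ _ _ = 0) ?deriv0 ?horner0 //.
by apply: (poly_vanish_all charK) => c; rewrite peval_horner H.
Qed.

Lemma pder_hasder (S : Type) (a b : S -> K) e :
  hasder (fun s => peval id s e) a b (pder a b e).
Proof.
set p := peval (@polyC K) (fun i => (a i)%:P + 'X * (b i)%:P) e.
have pE c : p.[c] = peval id (fun i => a i + c * b i) e.
  rewrite peval_horner; congr peval; apply/funext => i.
  by rewrite !hornerE.
exists (drop_poly 2 p) => c; rewrite -pE.
have E := poly_take_drop 2 p.
have -> : peval id a e = p`_0.
  rewrite -horner_coef0 pE; congr peval; apply/funext => i.
  by rewrite mul0r addr0.
have -> : pder a b e = p`_1.
  by rewrite -pder_line -/p horner_coef0 coef_deriv mulr1n.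
rewrite -{1}E hornerD hornerM hornerXn [in RHS]mulrC; congr (_ + _).
  rewrite /take_poly !poly_def !big_ord_recl big_ord0 /= expr0 !hornerE /=.
  by rewrite addr0.
by rewrite mulrC.
Qed.

(* In characteristic zero the derivative of a relation of minimal degree in s i *)
(* is not a relation any more.                                                 *)
Lemma separable_relation (S S' : finType) (F : S' -> pexpr K S) (i : S) :
  #|S| = #|S'| ->
  (forall G, polyfun G -> nonzero_fun G ->
     nonzero_fun (fun s => G (fun l => peval id s (F l)))) ->
  let pt (s : S -> K) (o : option S') :=
    if o is Some l then peval id s (F l) else s i in
  exists G : pexpr K (option S'),
    (forall s, peval id (pt s) G = 0) /\
    nonzero_fun (fun s => peval id (pt s) (partial None G)).
Proof.
move=> cardS dom pt.
pose opt (L : Type) (T : L) (y : S' -> L) (o : option S') := if o is Some l then y l else T.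
pose tpoly (G : pexpr K (option S')) (y : S' -> K) : {poly K} :=
  peval (@polyC K) (opt _ 'X (fun l => (y l)%:P)) G.
have tpolyE G y c : (tpoly G y).[c] = peval id (opt _ c y) G.
  by rewrite peval_horner; congr peval; apply/funext => -[l|] /=; rewrite !hornerE.
pose P m := `[< exists G, [/\ nonzero_fun (fun u => peval id u G),
  forall s, peval id (pt s) G = 0 & forall y, (size (tpoly G y) <= m)%N] >].
have exP : exists m, P m.
  (* An extra source variable [None] makes the two sides equal in size. The hyperplane where it is
     zero has the points [pt s] as its image, so these satisfy a nonzero relation. *)
  have [//|o||G [pG nG GE]] := @hypersurface_image K charK (option S) (option S')
    (fun u => opt _ (u (Some i)) (fun l => peval id (fun s => u (Some s)) (F l)))
    (fun u => u None) _ _ (polyfun_coord _ _).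
  - by rewrite !card_option cardS.
  - case: o => [l|]; last exact: polyfun_coord.
    apply: (polyfun_comp (phi := fun s => peval id s (F l))); first by exists (F l).
    by move=> s; apply: polyfun_coord.
  - by exists (fun=> 1); rewrite oner_eq0.
  have [m mE] := polyfun_boxdeg pG.
  have [e eE] := pG; exists m.+1; apply/asboolP; exists e; split.
  - by case: nG => u; exists u; rewrite -eE.
  - move=> s; by rewrite -eE -(GE (fun o => if o is Some x then s x else 0)).
  - move=> y; have [p sp pE] := mE (opt _ 0 y) None.
    rewrite (_ : tpoly e y = p) //; apply/eqP; rewrite -subr_eq0; apply/eqP.
    apply: (poly_vanish_all charK) => c; rewrite hornerD hornerN pE tpolyE eE.
    apply/eqP; rewrite subr_eq0; apply/eqP; congr peval.
    by apply/funext => -[].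
have [m /asboolP [G [nG GE sG]] minm] := ex_minnP exP.
exists G; split=> //; apply: contrapT => nd.
have dG0 s : peval id (pt s) (partial None G) = 0.
  by apply/eqP; apply: contrapT => /negP H; apply: nd; exists s.
have tpd e y : tpoly (partial None e) y = (tpoly e y)^`().
  elim: e => [c|[l|]|e IHe f IHf|e IHe f IHf] /=.
  - by rewrite /tpoly /= derivC polyC0.
  - by rewrite /tpoly /= derivC polyC0.
  - by rewrite /tpoly /= derivX polyC1.
  - by rewrite [LHS](congr2 +%R IHe IHf) -derivD.
  - by rewrite /tpoly /= in IHe IHf *; rewrite IHe IHf derivM.
have m0 : (0 < m)%N.
  rewrite lt0n; apply/eqP => m0; case: nG => u; have := sG (fun l => u (Some l)).
  rewrite m0 leqn0 size_poly_eq0 => /eqP E.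
  have := tpolyE G (fun l => u (Some l)) (u None); rewrite E horner0.
  have -> : opt _ (u None) (fun l => u (Some l)) = u by apply/funext => -[].
  by move=> <-; rewrite eqxx.
(* If the derivative is a nonzero polynomial, it is a relation of smaller degree in [None]. If it is
   zero, [G] does not involve [None] and is a relation between the [F l] alone, against
   dominance. *)
have [nd'|nd'] := pselect (nonzero_fun (fun u => peval id u (partial None G))).
  suff /minm : P m.-1 by rewrite leqNgt ltn_predL m0.
  apply/asboolP; exists (partial None G); split=> // y; rewrite tpd.
  have [->|nz] := eqVneq (tpoly G y) 0; first by rewrite deriv0 size_poly0.
  by rewrite -ltnS prednK //; apply: leq_trans (sG y); apply: lt_size_deriv.
have G0E u : peval id u G = peval id (opt _ 0 (fun l => u (Some l))) G.
  set y := fun l => u (Some l).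
  have -> : u = opt _ (u None) y by apply/funext => -[].
  rewrite -!tpolyE; suff -> : tpoly G y = ((tpoly G y)`_0)%:P by rewrite !hornerC.
  have d0 : (tpoly G y)^`() = 0.
    apply: (poly_vanish_all charK) => c; rewrite -tpd tpolyE.
    by apply/eqP; apply: contrapT => /negP H; apply: nd'; exists (opt _ c y).
  apply/polyP => -[|j]; rewrite coefC //=.
  have /polyP /(_ j) := d0; rewrite coef_deriv coef0 -mulr_natr => /eqP.
  by rewrite mulf_eq0 ((pcharf0P K).1 charK) orbF => /eqP.
have [||s] := dom (fun y => peval id (opt _ 0 y) G).
- apply: (polyfun_comp (phi := fun u => peval id u G)); first by exists G.
  by case=> [l|]; [apply: polyfun_coord | apply: polyfun_const].
- by case: nG => u; rewrite G0E => H; exists (fun l => u (Some l)).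
- by rewrite -(G0E (pt s)) GE eqxx.
Qed.

(** By [separable_relation] each coordinate satisfies a relation G_i(F(s), s_i) = 0 whose derivative
    in s_i is nonzero at a general point. Differentiating it there shows that a direction killed by
    dF is zero. The Jacobian is square, hence invertible, and only the zero covector kills its
    image. *)
Lemma jacobian_dual (S S' : finType) (F : (S -> K) -> S' -> K) (h : (S -> K) -> K) :
  #|S| = #|S'| -> (forall l, polyfun (fun s => F s l)) ->
  (forall G, polyfun G -> nonzero_fun G -> nonzero_fun (fun s => G (F s))) ->
  polyfun h -> nonzero_fun h ->
  exists2 a, h a != 0 & forall W : S' -> K,
    (forall b d, (forall l, hasder (fun s => F s l) a b (d l)) ->
       \sum_l W l * d l = 0) ->
    forall l, W l = 0.
Proof.
move=> cardS /choice [f fE] dom ph nh.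
have FE s : F s = fun l => peval id s (f l) by apply/funext => l; rewrite fE.
have dom' G : polyfun G -> nonzero_fun G ->
     nonzero_fun (fun s => G (fun l => peval id s (f l))).
  by move=> pG nG; have [s] := dom G pG nG; exists s; rewrite -FE.
pose pt i (s : S -> K) (o : option S') := if o is Some l then peval id s (f l) else s i.
have /choice [G GP] := fun i => separable_relation i cardS dom'.
pose dG i s := peval id (pt i s) (partial None (G i)).
have pdG i : polyfun (dG i).
  apply: (polyfun_comp (phi := fun s => peval id s (partial None (G i)))).
    by exists (partial None (G i)).
  by case=> [l|]; [exists (f l) | apply: polyfun_coord].
have [s hs] : nonzero_fun (fun s => h s * \prod_i dG i s).
  apply: nonzero_funM => //; first exact: polyfun_prod.
  apply: nonzero_fun_prod => //; last by exists; exact: (fun=> 0).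
  by move=> i _; have [_] := GP i.
move: hs; rewrite mulf_eq0 negb_or => /andP[hs /prodf_neq0 dGs].
exists s => // W WE.
have inj (b : S -> K) : (forall l, pder s b (f l) = 0) -> forall i, b i = 0.
  move=> b0 i; have [GE _] := GP i.
  pose fi o := if o is Some l then f l else PVar i.
  have ptE s' : (fun o => peval id s' (fi o)) = pt i s' by apply/funext => -[].
  have : pder s b (psubst fi (G i)) = 0.
    by apply: pder_zero => s'; rewrite peval_psubst ptE GE.
  rewrite pder_psubst ptE pder_partial (bigD1 None) //= big1 ?addr0; last first.
    by case=> [l|] // _; rewrite /= b0 mul0r.
  by move/eqP; rewrite mulf_eq0 => /orP[/eqP //|]; rewrite -/(dG i s) (negbTE (dGs i _)).
pose M := \matrix_(i < #|S|, l < #|S'|) peval id s (partial (enum_val i) (f (enum_val l))).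
have freeM : row_free M.
  rewrite -kermx_eq0; apply/rowV0P => w /sub_kermxP wM; apply/rowP => i.
  rewrite mxE; suff H : forall x, w 0 (enum_rank x) = 0.
    by have := H (enum_val i); rewrite enum_valK.
  apply: inj => l; rewrite pder_partial.
  have /rowP /(_ (enum_rank l)) := wM; rewrite !mxE => E; rewrite -[RHS]E.
  rewrite (reindex (@enum_val S predT)) /=.
    by apply: eq_bigr => x _; rewrite !mxE enum_valK enum_rankK.
  by exists enum_rank => x _; rewrite ?enum_valK ?enum_rankK.
have fullM : row_full M by rewrite /row_full (eqP freeM) cardS.
have /row_fullP [B BM] := fullM.
have MW : M *m (\col_l W (enum_val l)) = 0.
  apply/colP => i; rewrite !mxE.
  pose b x : K := (x == enum_val i)%:R.
  have E : \sum_l W l * pder s b (f l) = 0.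
    apply: (WE b) => l; have [q qE] := pder_hasder s b (f l).
    by exists q => c; rewrite !FE qE.
  rewrite -[RHS]E.
  rewrite (reindex (@enum_val S' predT)) /=; last first.
    by exists enum_rank => x _; rewrite ?enum_valK ?enum_rankK.
  apply: eq_bigr => l _; rewrite !mxE mulrC pder_partial; congr (_ * _).
  rewrite (bigD1 (enum_val i)) //= /b eqxx mul1r big1 ?addr0 // => x xi.
  by rewrite (negbTE xi) mul0r.
have W0 : (\col_(l < #|S'|) W (enum_val l)) = 0 by rewrite -[LHS]mul1mx -BM -mulmxA MW mulmx0.
by move=> l; have /colP /(_ (enum_rank l)) := W0; rewrite !mxE enum_rankK.
Qed.

End Derivatives.

(** * Linear relations between the points of a configuration *)

Section Rado.
Local Open Scope ring_scope.
Variables (K : fieldType) (vT : vectType K).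
Hypothesis charK : [pchar K] =i pred0.

Lemma exists_fresh (L : seq K) : exists c, c \notin L.
Proof.
have [c]: exists2 c, c \in [seq i%:R | i <- iota 0 (size L).+1] & c \notin L.
  apply/allPn/negP => /allP H.
  have U : uniq [seq i%:R : K | i <- iota 0 (size L).+1].
    by rewrite map_inj_uniq ?iota_uniq // => i j /(natK_inj charK).
  by have := uniq_leq_size U H; rewrite size_map size_iota ltnn.
by exists c.
Qed.

Lemma avoid_on_line (s : seq {vspace vT}) (u w : vT) :
  (forall V, V \in s -> ~~ ((u \in V) && (w \in V))) ->
  exists L : seq K, forall c, c \notin L -> forall V, V \in s -> u + c *: w \notin V.
Proof.
elim: s => [|V s IH] H; first by exists [::].
have [|L LP] := IH; first by move=> X Xs; apply: H; rewrite inE Xs orbT.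
have [[c0 c0V]|N] := pselect (exists c, u + c *: w \in V); last first.
  exists L => c cL X; rewrite inE => /orP[/eqP ->|]; last exact: LP.
  by apply/negP => uV; apply: N; exists c.
exists (c0 :: L) => c; rewrite inE negb_or => /andP[cc0 cL] X.
rewrite inE => /orP[/eqP ->|]; last exact: LP.
apply: contra (H V (mem_head _ _)) => cV.
have wV : w \in V.
  have := memvB cV c0V; rewrite opprD addrACA subrr add0r -scalerBl.
  by rewrite rpredZeq subr_eq0 (negbTE cc0).
by rewrite wV andbT -(addrK (c0 *: w) u) memvB // memvZ.
Qed.

(** A vector space over an infinite field is not a finite union of proper subspaces: if [u] avoids
    the other subspaces and [w] avoids [V], all but finitely many points of the line u + c w avoid
    them all. *)
Lemma avoid_subspaces (U : {vspace vT}) (s : seq {vspace vT}) :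
  (forall V, V \in s -> ~~ (U <= V)%VS) ->
  exists2 u, u \in U & forall V, V \in s -> u \notin V.
Proof.
elim: s => [|V s IH] H; first by exists 0; rewrite ?mem0v.
have [|u uU us] := IH; first by move=> X Xs; apply: H; rewrite inE Xs orbT.
have [w wU wV] : exists2 w, w \in U & w \notin V.
  by apply/subvPn; apply: H; rewrite mem_head.
have [|L LP] := @avoid_on_line s u w.
  by move=> X /us /negbTE ->.
have [uV|uV] := boolP (u \in V); last first.
  by exists u => // X; rewrite inE => /orP[/eqP ->|/us].
have [c] := exists_fresh (0 :: L); rewrite inE negb_or => /andP[c0 cL].
exists (u + c *: w); first by rewrite memvD // memvZ.
move=> X; rewrite inE => /orP[/eqP ->|]; last exact: LP.
apply: contra wV => H'; have := memvB H' uV.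
by rewrite addrC addKr rpredZeq (negbTE c0).
Qed.

Lemma dimv_add_line (U : {vspace vT}) v : v \notin U -> \dim (U + <[v]>)%VS = (\dim U).+1.
Proof.
move=> vU; have v0 : v != 0 by apply: contraNneq vU => ->; rewrite mem0v.
rewrite dimv_disjoint_sum ?dim_vline ?v0 ?addn1 //.
apply/eqP; rewrite -subv0; apply/subvP => x; rewrite memv_cap => /andP[xU].
case/vlineP => c xE; rewrite xE in xU *; move: xU; rewrite rpredZeq (negbTE vU) orbF.
by move=> /eqP ->; rewrite scale0r mem0v.
Qed.

(* Choose e a outside all Q + sum_(j in S) E j that do not contain E a, replace  *)
(* Q by Q + <e a> and iterate.                                                 *)
Lemma rado (J : finType) (E : J -> {vspace vT}) (A : {set J}) (Q : {vspace vT}) :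
  (forall S : {set J}, S \subset A ->
     (\dim Q + #|S| <= \dim (Q + \sum_(j in S) E j)%VS)%N) ->
  exists2 e : J -> vT, (forall j, j \in A -> e j \in E j) &
    \dim (Q + \sum_(j in A) <[e j]>)%VS = (\dim Q + #|A|)%N.
Proof.
have [m] := ubnP #|A|; elim: m A Q => // m IH A Q; rewrite ltnS => leA hall.
have [->|[a aA]] := finset.set_0Vmem A.
  exists (fun=> 0) => [j|]; first by rewrite inE.
  by rewrite finset.big_set0 addv0 cards0 addn0.
pose Ws := [seq W <- map (fun X : {set J} => Q + \sum_(j in X) E j)%VS (enum (finset.powerset (A :\ a)))
               | ~~ (E a <= W)%VS].
have [|e0 e0E e0W] := @avoid_subspaces (E a) Ws.
  by move=> V; rewrite mem_filter => /andP[].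
have avoid (S : {set J}) : S \subset (A :\ a) -> ~~ (E a <= Q + \sum_(j in S) E j)%VS ->
    e0 \notin (Q + \sum_(j in S) E j)%VS.
  move=> SA nE; apply: e0W; rewrite mem_filter nE /=.
  by apply/mapP; exists S; rewrite // mem_enum powersetE.
have e0Q : e0 \notin Q.
  have := avoid finset.set0 (finset.sub0set _); rewrite finset.big_set0 addv0; apply.
  have := hall [set a]%SET; rewrite finset.sub1set aA finset.big_set1 cards1 addn1 => /(_ isT).
  by apply: contraL => EQ; rewrite -leqNgt dimvS // subv_add subvv.
have cA : #|A| = #|A :\ a|.+1 by rewrite (cardsD1 a A) aA.
have [||e eE dE] := IH (A :\ a)%SET (Q + <[e0]>)%VS.
- by rewrite -ltnS -cA ltnS.
- move=> S SA; rewrite (dimv_add_line e0Q) addSnnS.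
  have aS : a \notin S by apply/negP => /(fintype.subsetP SA); rewrite !inE eqxx.
  rewrite -addvA (addvC <[e0]>%VS) addvA.
  have SA' : S \subset A by apply: fintype.subset_trans SA (finset.subD1set _ _).
  (* If the sum already contains E a, the hypothesis for S with [a] added supplies the extra
     dimension; otherwise [e0] lies outside the sum and adds one. *)
  have [EQ|nEQ] := boolP (E a <= Q + \sum_(j in S) E j)%VS.
    have := hall (a |: S)%SET; rewrite finset.subUset finset.sub1set aA SA' => /(_ isT).
    rewrite cardsU1 aS add1n => /leq_trans; apply; apply: dimvS.
    rewrite (finset.big_setU1 _ aS) /= subv_add; apply/andP; split.
      by apply: subv_trans (addvSl _ _); apply: addvSl.
    rewrite subv_add; apply/andP; split.
      by apply: subv_trans EQ (addvSl _ _).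
    by apply: subv_trans (addvSl _ _); apply: addvSr.
  by rewrite dimv_add_line ?avoid // addnS ltnS hall.
exists (fun j => if j == a then e0 else e j) => [j jA|].
  by case: eqP => [->//|/eqP ja]; apply: eE; rewrite !inE ja.
rewrite (finset.big_setD1 _ aA) /= eqxx addvA.
rewrite (eq_bigr (fun j => <[e j]>%VS)) => [|j]; last by rewrite !inE => /andP[/negbTE ->].
by rewrite dE (dimv_add_line e0Q) cA addSnnS.
Qed.

End Rado.

Lemma outer_mxE (K : fieldType) p q (x : 'cV[K]_p) (y : 'rV[K]_q) i j :
  ((x *m y) i j = x i 0 * y 0 j)%R.
Proof. by rewrite mxE big_ord1. Qed.

(** * Relations between the rows of a matrix, and their diagonal pairing *)

Section Relations.
Local Open Scope ring_scope.
Variables (K : fieldType) (n r : nat).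

Definition diag_row (A : 'M[K]_n) : 'rV[K]_n := \row_i A i i.

Fact diag_row_is_linear : linear diag_row.
Proof. by move=> c A B; apply/rowP => i; rewrite !mxE. Qed.

HB.instance Definition _ :=
  GRing.isLinear.Build K 'M[K]_n 'rV[K]_n _ diag_row diag_row_is_linear.

Definition relations (V : 'M[K]_(n, r)) : {vspace 'rV[K]_n} := lker (linfun (mulmxr V)).

Definition supported (J : {set 'I_n}) : {vspace 'rV[K]_n} :=
  lker (linfun (mulmxr (diag_mx (\row_i (i \notin J)%:R)))).

Lemma mem_relations (V : 'M[K]_(n, r)) (c : 'rV[K]_n) : (c \in relations V) = (c *m V == 0).
Proof. by rewrite memv_ker lfunE. Qed.

Lemma mem_supported (J : {set 'I_n}) (c : 'rV[K]_n) : reflect (forall i, i \notin J -> c 0 i = 0) (c \in supported J).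
Proof.
rewrite memv_ker lfunE /= mul_mx_diag; apply: (iffP eqP) => [/rowP H i iJ|H].
  by have := H i; rewrite !mxE iJ mulr1.
by apply/rowP => i; rewrite !mxE; case: (boolP (i \in J)) => [|/H ->]; rewrite ?mulr0 ?mul0r.
Qed.

(** Double annihilator: what the left kernel of [V] kills is the column space. Such a [t] consists
    of the values of a linear form on the points. *)
Lemma relations_ortho (V : 'M[K]_(n, r)) (t : 'cV[K]_n) :
  (forall c, c \in relations V -> c *m t = 0) -> exists p, t = V *m p.
Proof.
move=> H; have Kt : kermx V *m t = 0.
  apply/row_matrixP => i; rewrite row_mul row0; apply: H.
  by rewrite mem_relations -row_mul mulmx_ker row0.
have sub : (V^T <= kermx (kermx V)^T)%MS.
  by apply/sub_kermxP; rewrite -trmx_mul mulmx_ker trmx0.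
have : (t^T <= V^T)%MS.
  apply: (submx_trans (B := kermx (kermx V)^T)).
    by apply/sub_kermxP; rewrite -trmx_mul Kt trmx0.
  rewrite -(geq_leqif (mxrank_leqif_sup sub)).
  by rewrite mxrank_ker !mxrank_tr mxrank_ker subKn // rank_leq_row.
by case/submxP => p E; exists p^T; rewrite -[t]trmxK E trmx_mul trmxK.
Qed.

Lemma dim_relations (V : 'M[K]_(n, r)) : \rank V = r -> \dim (relations V) = (n - r)%N.
Proof.
move=> rV; pose f : 'Hom('rV[K]_n, 'rV[K]_r) := linfun (mulmxr V).
have := limg_ker_dim f fullv; rewrite capfv dimvf /dim /= mul1n => E.
suff limf : limg f = fullv.
  by move: E; rewrite limf dimvf /dim /= mul1n => E; rewrite -[X in (X - r)%N]E addnK.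
apply/eqP; rewrite eqEsubv subvf /=.
apply/subvP => y _; have /row_fullP [B BV] : row_full V by rewrite /row_full rV.
have -> : y = f (y *m B) by rewrite lfunE /= -mulmxA BV mulmx1.
by apply: memv_img; rewrite memvf.
Qed.

Variable V : 'M[K]_(n, r).
Hypothesis charK : [pchar K] =i pred0.
Hypothesis rowV0 : forall i, row i V != 0.
Hypothesis rowV_sep : forall i i', i != i' ->
  exists2 a : 'cV[K]_r, row i V *m a = 0 & row i' V *m a != 0.

Lemma exists_nonvanishing_form : exists a : 'cV[K]_r, forall i, (V *m a) i 0 != 0.
Proof.
pose F (i : 'I_n) (s : 'I_r -> K) : K := \sum_a V i a * s a.
have pF i : polyfun (F i).
  by apply: polyfun_sum => a; apply: polyfunM; [apply: polyfun_const | apply: polyfun_coord].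
have [i _||s] := @nonzero_fun_prod K charK _ 'I_n (index_enum 'I_n) predT F pF.
- have /rV0Pn [a] := rowV0 i; rewrite mxE => ia.
  exists (fun b => (b == a)%:R); rewrite /F (bigD1 a) //= eqxx mulr1 big1 ?addr0 //.
  by move=> b /negbTE ->; rewrite mulr0.
- by exists; exact: (fun=> 0).
- move/prodf_neq0 => H; exists (\col_a s a) => i; have := H i isT.
  by congr (_ != 0); rewrite !mxE; apply: eq_bigr => a _; rewrite mxE.
Qed.

(* The pairing W |-> (W i . V i)_i on the tensor product of M with K^r has rank at *)
(* least dim M + 1: a general covector a embeds M by c |-> (c i (a . V i))_i,   *)
(* and when c has minimal support in M and b . V i0 = 0 for some i0 in it, the  *)
(* vector (c i (b . V i))_i is not in the image.                               *)
Lemma rank_diag_pairing (M : {vspace 'rV[K]_n}) :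
  (M <= relations V)%VS -> M != 0%VS ->
  exists U : {vspace 'M[K]_(n, r)},
    (\dim U + (\dim M).+1 <= r * \dim M)%N /\
    forall W : 'M[K]_(n, r), (forall a, (col a W)^T \in M) ->
      (forall i, (W *m V^T) i i = 0) -> W \in U.
Proof.
move=> Mrel M0; set m := \dim M.
pose B : 'M[K]_(m, n) := \matrix_i (vbasis M)`_i.
pose g : 'Hom('M[K]_(m, r), 'rV[K]_n) := linfun (diag_row \o mulmxr V^T \o mulmx B^T).
pose f : 'Hom('M[K]_(m, r), 'M[K]_(n, r)) := linfun (mulmx B^T).
have yB (y : 'rV[K]_m) : y *m B = \sum_i y 0 i *: (vbasis M)`_i.
  by rewrite mulmx_sum_row; apply: eq_bigr => i _; rewrite rowK.
have gE (y : 'rV[K]_m) (a : 'cV[K]_r) : g (y^T *m a^T) = \row_i ((y *m B) 0 i * (V *m a) i 0).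
  apply/rowP => i; rewrite lfunE /= /diag_row [LHS]mxE [RHS]mxE.
  rewrite mulmxA -trmx_mul -mulmxA -[a^T *m V^T]trmx_mul.
  by rewrite [LHS]outer_mxE [(y *m B)^T i _]mxE [(V *m a)^T _ i]mxE.
have rk : (m < \dim (limg g))%N.
  have [a aP] := exists_nonvanishing_form.
  have exM : exists s, `[< exists2 c : 'rV[K]_n, c \in M /\ c != 0 & #|[set i | c 0 i != 0]%SET| = s >].
    exists #|[set i | vpick M 0 i != 0]%SET|; apply/asboolP; exists (vpick M) => //.
    by rewrite memv_pick vpick0.
  have [s /asboolP [c [cM c0] cs] smin] := ex_minnP exM.
  have [i0 ci0] := rV0Pn _ c0.
  have crel : c *m V = 0 by apply/eqP; rewrite -mem_relations (subvP Mrel).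
  have [i1 [i10 ci1]] : exists i1, i1 != i0 /\ c 0 i1 != 0.
    apply: contrapT => N; have : c 0 i0 *: row i0 V == 0.
      move: crel; rewrite mulmx_sum_row (bigD1 i0) //= big1 ?addr0 => [->//|i ii0].
      case: (eqVneq (c 0 i) 0) => [->|ci]; first by rewrite scale0r.
      by case: N; exists i.
    by rewrite scaler_eq0 (negbTE ci0) (negbTE (rowV0 i0)).
  have [b b0 b1] : exists2 b : 'cV[K]_r, row i0 V *m b = 0 & row i1 V *m b != 0.
    by apply: rowV_sep; rewrite eq_sym.
  pose h : 'Hom('rV[K]_m, 'rV[K]_n) :=
    linfun (mulmxr (diag_mx (\row_i (V *m a) i 0)) \o mulmxr B).
  have hE y : h y = \row_i ((y *m B) 0 i * (V *m a) i 0).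
    by rewrite lfunE /= mul_mx_diag; apply/rowP => i; rewrite !mxE.
  have hg : (limg h <= limg g)%VS.
    apply/subvP => _ /memv_imgP [y _ ->]; rewrite hE -gE.
    by apply: memv_img; rewrite memvf.
  have hm : \dim (limg h) = m.
    have := limg_ker_dim h fullv; rewrite capfv dimvf /dim /= mul1n.
    suff /eqP -> : lker h == 0%VS by rewrite dimv0 add0n.
    rewrite -subv0; apply/subvP => y; rewrite memv_ker hE memv0 => /eqP /rowP hy.
    have yB0 : y *m B = 0.
      apply/rowP => i; have := hy i.
      rewrite [X in X = _ -> _]mxE => E0.
      have : (y *m B) 0 i * (V *m a) i 0 = 0 by rewrite E0 mxE.
      by move=> /eqP; rewrite mulf_eq0 (negbTE (aP i)) orbF => /eqP ->; rewrite mxE.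
    have /freeP fr := basis_free (vbasisP M).
    apply/eqP/rowP => i; rewrite mxE; apply: (fr (fun i => y 0 i)).
    by apply: etrans yB0; rewrite yB.
  pose yc : 'rV[K]_m := \row_i coord (vbasis M) i c.
  have ycB : yc *m B = c.
    by rewrite yB [RHS](coord_vbasis cM); apply: eq_bigr => i _; rewrite mxE.
  pose w := g (yc^T *m b^T).
  (* If w = h(y), the element c' = y B of [M] has support inside that of [c], vanishes at [i0], and
     is nonzero because of [i1], against the minimality of the support of [c]. *)
  have wh : w \notin limg h.
    apply/negP => /memv_imgP [y _]; rewrite hE /w gE ycB => /rowP E.
    set c' := y *m B in E.
    have E' i : c 0 i * (V *m b) i 0 = c' 0 i * (V *m a) i 0 by have := E i; rewrite mxE [in X in _ = X -> _]mxE.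
    have rowE i : (row i V *m b) 0 0 = (V *m b) i 0 by rewrite -row_mul [LHS]mxE.
    have c'M : c' \in M.
      by rewrite /c' yB; apply: memv_suml => i _; apply: memvZ; apply: vbasis_mem; apply: mem_nth; rewrite size_tuple.
    have c'0 : c' != 0.
      apply: contraNneq b1 => c'0; have := E' i1.
      have -> : c' 0 i1 = 0 by rewrite c'0 mxE.
      rewrite mul0r => /eqP.
      rewrite mulf_eq0 (negbTE ci1) /= -rowE => /eqP b1.
      by apply/eqP/rowP => j; rewrite ord1 b1 mxE.
    have := smin #|[set i | c' 0 i != 0]%SET|.
    have /[swap] /[apply] : `[< exists2 d : 'rV[K]_n, d \in M /\ d != 0 &
          #|[set i | d 0 i != 0]%SET| = #|[set i | c' 0 i != 0]%SET| >].
      by apply/asboolP; exists c'.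
    rewrite leqNgt -cs => /negP; apply; apply/proper_card/properP; split.
      apply/fintype.subsetP => i; rewrite !inE; apply: contraNneq => ci.
      by have := E' i; rewrite ci mul0r => /esym/eqP; rewrite mulf_eq0 (negbTE (aP i)) orbF.
    exists i0; rewrite !inE // negbK.
    have := E' i0; rewrite -rowE b0.
    have -> : (0 : 'M[K]_1) 0 0 = 0 by rewrite mxE.
    rewrite mulr0 => /esym/eqP.
    by rewrite mulf_eq0 (negbTE (aP i0)) orbF.
  have := dimv_add_line wh; rewrite hm => <-; apply: dimvS; rewrite subv_add hg /=.
  by rewrite -memvE /w; apply: memv_img; rewrite memvf.
exists (f @: lker g)%VS; split.
  have := limg_ker_dim g fullv; rewrite capfv dimvf /dim /= => E.
  have le : (\dim (f @: lker g) <= \dim (lker g))%N by rewrite -(limg_ker_dim f (lker g)) leq_addl.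
  by rewrite -/m mulnC -E leq_add.
move=> W WM Wd; pose A : 'M[K]_(m, r) := \matrix_(i, a) coord (vbasis M) i (col a W)^T.
have WE : W = B^T *m A.
  apply/matrixP => i a; have /rowP /(_ i) := coord_vbasis (WM a); rewrite !mxE => ->.
  by rewrite summxE; apply: eq_bigr => j _; rewrite !mxE mulrC.
have -> : W = f A by rewrite lfunE.
apply: memv_img; rewrite memv_ker lfunE /= -WE; apply/eqP/rowP => i.
by rewrite /diag_row [LHS]mxE Wd mxE.
Qed.

End Relations.

(** * Cotangent spaces and the strict Hall condition *)

Section Hall.
Local Open Scope ring_scope.
Variables (K : fieldType) (n r k : nat).
Variables (V : 'M[K]_(n, r)) (I : 'I_k -> {set 'I_n}).
Hypothesis charK : [pchar K] =i pred0.
Hypothesis r2 : (2 <= r)%N.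
Hypothesis hI : forall j, #|I j| = (r + 2)%N.
Hypothesis rowV0 : forall i, row i V != 0.
Hypothesis rowV_sep : forall i i', i != i' ->
  exists2 a : 'cV[K]_r, row i V *m a = 0 & row i' V *m a != 0.

Definition local_relations j := (relations V :&: supported K (I j))%VS.

(* A cotangent vector of X(r, n) at the configuration V is a family of covectors *)
(* W i with W i . V i = 0 and sum_i V i (x) W i = 0; the condition is that the  *)
(* sum of the cotangent spaces of the X(r, I j) embeds in that of X(r, n).     *)
Definition cotangent_independent : Prop := forall W : 'I_k -> 'M[K]_(n, r),
  (forall j i a, i \notin I j -> W j i a = 0) ->
  (forall j, V^T *m W j = 0) -> (forall j i, (W j *m V^T) i i = 0) ->
  \sum_j W j = 0 -> forall j, W j = 0.

Lemma enum_markings : exists f : 'I_k -> 'I_(r + 2) -> 'I_n,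
  (forall j, injective (f j)) /\ (forall j i, i \in I j -> exists x, f j x = i) /\
  (forall j x, f j x \in I j).
Proof.
exists (fun j x => enum_val (cast_ord (esym (hI j)) x)); split; [|split] => j.
- by move=> x y /enum_val_inj /cast_ord_inj.
- move=> i iI; exists (cast_ord (hI j) (enum_rank_in iI i)).
  by rewrite cast_ordK enum_rankK_in.
- by move=> x; apply: enum_valP.
Qed.

(* Otherwise the cotangent spaces of the X(r, I j) for j in S, of dimension at   *)
(* least r - 1 each, would be too large for rank_diag_pairing.                 *)
Lemma hall (S : {set 'I_k}) : cotangent_independent -> S != finset.set0 ->
  (#|S| < \dim (\sum_(j in S) local_relations j)%VS)%N.
Proof.
move=> star S0; rewrite ltnNge; apply/negP => small.
set M := (\sum_(j in S) local_relations j)%VS in small.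
have s0 : (0 < #|S|)%N by rewrite card_gt0.
have Mrel : (M <= relations V)%VS.
  by apply/subv_sumP => j _; apply: capvSl.
have [U [dU UP]] : exists U : {vspace 'M[K]_(n, r)},
    (\dim U < #|S| * (r - 1))%N /\
    forall W : 'M[K]_(n, r), (forall a, (col a W)^T \in M) ->
      (forall i, (W *m V^T) i i = 0) -> W \in U.
  have [M0|M0] := eqVneq M 0%VS.
    exists 0%VS; split=> [|W WM _]; first by rewrite dimv0 muln_gt0 s0 subn_gt0.
    rewrite memv0; apply/eqP/matrixP => i a; have := WM a; rewrite M0 memv0.
    by move=> /eqP/rowP/(_ i); rewrite !mxE.
  have [U [dU UP]] := rank_diag_pairing charK rowV0 rowV_sep Mrel M0.
  exists U; split=> //; nia.
have [f [finj [fsur fin]]] := enum_markings.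
pose sg : 'I_#|S| -> 'I_k := enum_val.
have sginj : injective sg by apply: enum_val_inj.
(* With s = #|S|, there are s(r + 2)r unknown entries, and r^2 + (r + 1) equations for each index
   together with dim U equations for the sum. The excess s(r - 1) - dim U is positive. Only r + 1 of
   the r + 2 diagonal conditions are imposed, those reached by [up]; the one at [x0] will follow
   from the trace. *)
pose X := ('I_#|S| * 'I_(r + 2) * 'I_r)%type.
pose Y := ('I_#|S| * ('I_r * 'I_r) + 'I_#|S| * 'I_(r + 1) + 'I_(\dim U))%type.
pose D (p : X) : 'M[K]_(n, r) := delta_mx (f (sg p.1.1) p.1.2) p.2.
have r20 : (0 < r + 2)%N by rewrite addn2.
pose x0 : 'I_(r + 2) := Ordinal r20.
have r21 (y : 'I_(r + 1)) : (y.+1 < r + 2)%N by have := ltn_ord y; lia.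
pose up (y : 'I_(r + 1)) : 'I_(r + 2) := Ordinal (r21 y).
pose A (p : X) (e : Y) : K := match e with
  | inl (inl q) => (p.1.1 == q.1)%:R * (V^T *m D p) q.2.1 q.2.2
  | inl (inr q) => (p.1.1 == q.1)%:R *
      (D p *m V^T) (f (sg q.1) (up q.2)) (f (sg q.1) (up q.2))
  | inr b => coord (vbasis U) b (D p)
  end.
have ltXY : (#|{: Y}| < #|{: X}|)%N.
  rewrite /Y /X !card_sum !card_prod !card_ord; nia.
have [u [p0 up0] uA] := exists_left_kernel A ltXY.
pose Wl l : 'M[K]_(n, r) := \sum_(p : X | p.1.1 == l) u p *: D p.
have WlI l i a : i \notin I (sg l) -> Wl l i a = 0.
  move=> iI; rewrite summxE big1 // => p /eqP pl; rewrite !mxE.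
  case: eqP => [E|_]; last by rewrite mulr0.
  by move: iI; rewrite E pl fin.
have WlV l : V^T *m Wl l = 0.
  apply/matrixP => a b; rewrite mulmx_sumr summxE mxE.
  have E := uA (inl (inl (l, (a, b)))); rewrite -[RHS]E big_mkcond /=.
  apply: eq_bigr => p _; case: eqP => _; last by rewrite mul0r mulr0.
  by rewrite -scalemxAr [LHS]mxE mul1r.
have Wlup l y : (Wl l *m V^T) (f (sg l) (up y)) (f (sg l) (up y)) = 0.
  rewrite mulmx_suml summxE.
  have E := uA (inl (inr (l, y))); rewrite -[RHS]E big_mkcond /=.
  apply: eq_bigr => p _; case: eqP => _; last by rewrite mul0r mulr0.
  by rewrite -scalemxAl [LHS]mxE mul1r.
have Wlout l i : i \notin I (sg l) -> (Wl l *m V^T) i i = 0.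
  by move=> iI; rewrite mxE big1 // => a _; rewrite WlI ?mul0r.
have Wld l i : (Wl l *m V^T) i i = 0.
  have [iI|iI] := boolP (i \in I (sg l)); last exact: Wlout.
  have [x <-] := fsur _ _ iI.
  have : \tr (Wl l *m V^T) = 0 by rewrite mxtrace_mulC WlV mxtrace0.
  rewrite /mxtrace (bigD1 (f (sg l) x0)) //= big1 ?addr0 => [Z|i' i'x].
    have [->//|xx0] := eqVneq x x0.
    have xx : (x.-1 < r + 1)%N by have := ltn_ord x; move: xx0; rewrite -val_eqE /=; lia.
    suff -> : x = up (Ordinal xx) by apply: Wlup.
    by apply/val_inj; move: xx0; rewrite -val_eqE /=; lia.
  have [iI'|] := boolP (i' \in I (sg l)); last exact: Wlout.
  have [y yE] := fsur _ _ iI'; rewrite -yE.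
  have yy0 : y != x0 by apply: contraNneq i'x => yx; rewrite -yE yx.
  have yy : (y.-1 < r + 1)%N by have := ltn_ord y; move: yy0; rewrite -val_eqE /=; lia.
  suff -> : y = up (Ordinal yy) by apply: Wlup.
  by apply/val_inj; move: yy0; rewrite -val_eqE /=; lia.
have Wsum : \sum_l Wl l = \sum_p u p *: D p.
  by rewrite [RHS](partition_big (fun p : X => p.1.1) predT).
(* The columns of each [Wl l] are local relations, so those of the sum lie in [M]; the last group of
   equations, its coordinates in [U], then makes the sum zero. *)
have WU : \sum_l Wl l \in U.
  apply: UP => [a|i]; last by rewrite mulmx_suml summxE big1.
  rewrite !linear_sum /=; apply: memv_suml => l _.
  have lS : sg l \in S by apply: enum_valP.
  apply: (subvP (sumv_sup (sg l) lS (subvv _))); rewrite memv_cap; apply/andP; split.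
    by rewrite mem_relations -[V]trmxK -trmx_mul colE mulmxA WlV mul0mx trmx0.
  by apply/mem_supported => i iI; rewrite !mxE WlI.
have W0 : \sum_l Wl l = 0.
  rewrite (coord_vbasis WU) big1 // => b _; rewrite Wsum linear_sum /=.
  rewrite (eq_bigr (fun p => u p * A p (inr b))) => [|p _]; last by rewrite linearZ.
  by rewrite uA scale0r.
pose W j := \sum_(l | sg l == j) Wl l.
have W'0 : forall j, W j = 0.
  apply: star.
  - by move=> j i a iI; rewrite summxE big1 // => l /eqP lj; rewrite WlI ?lj.
  - by move=> j; rewrite mulmx_sumr big1.
  - by move=> j i; rewrite mulmx_suml summxE big1.
  - by rewrite -[RHS]W0 [RHS](partition_big sg predT).
case: p0 up0 => -[l x] a; have := W'0 (sg l); rewrite /W.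
rewrite (big_pred1 l) => [E|l']; last by rewrite /= (inj_eq sginj).
have : Wl l (f (sg l) x) a = 0 by rewrite E mxE.
rewrite summxE.
rewrite (bigD1 (l, x, a)) //= big1 => [|[[l' x'] a'] /= /andP[/eqP -> ne]].
  by rewrite !mxE !eqxx mulr1 addr0 => ->; rewrite eqxx.
rewrite !mxE /=; case: eqP => [/finj E2|_]; last by rewrite mulr0.
case: eqP => [E3|_]; last by rewrite mulr0.
by move: ne; rewrite E2 E3 eqxx.
Qed.

(** The strict inequality in [hall] leaves room for the line of [c] in Rado's theorem. Then [c] and
    the k vectors [e j] span a space of dimension k + 1 = n - r, which is all of [relations V], and
    [relations_ortho] applies. *)
Lemma local_relations_span (c : 'rV[K]_n) : cotangent_independent ->
  n = (k + r + 1)%N -> \rank V = r -> c \in relations V -> c != 0 ->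
  exists2 e : 'I_k -> 'rV[K]_n, (forall j, e j \in local_relations j) &
    forall t : 'cV[K]_n, c *m t = 0 -> (forall j, e j *m t = 0) ->
      exists p, t = V *m p.
Proof.
move=> star nk rV crel c0.
have [S _|e eE de] := @rado K 'rV[K]_n charK 'I_k local_relations finset.setT <[c]>%VS.
  rewrite dim_vline c0 /= add1n.
  have [->|S0] := eqVneq S finset.set0.
    by rewrite finset.big_set0 addv0 cards0 dim_vline c0.
  by apply: leq_trans (hall star S0) _; apply: dimvS; apply: addvSr.
exists e => [j|t ct et]; first by apply: eE; rewrite inE.
apply: relations_ortho => d drel.
have relE : (<[c]> + \sum_(j in finset.setT) <[e j]>)%VS = relations V.
  apply/eqP; rewrite eqEdim subv_add -memvE crel /=; apply/andP; split.
    apply/subv_sumP => j _; rewrite -memvE.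
    by have := eE j; rewrite inE memv_cap => /(_ isT) /andP[].
  rewrite dim_relations // de dim_vline c0 cardsT card_ord nk; lia.
move: drel; rewrite -relE => /memv_addP [x /vlineP [a ->]] [y /memv_sumP [z zP ->] ->].
rewrite mulmxDl -scalemxAl ct scaler0 add0r mulmx_suml big1 // => j _.
by have /vlineP [b ->] := zP j (finset.in_setT j); rewrite -scalemxAl et scaler0.
Qed.

End Hall.

(** * Configurations and their orbits *)

Lemma extend_injection (T : finType) m r (g : 'I_m -> T) (le_mr : m <= r) :
  r <= #|T| -> injective g ->
  exists2 f : 'I_r -> T, injective f & forall a, f (widen_ord le_mr a) = g a.
Proof.
move=> rT ginj; case: r le_mr rT => [|r] le_mr rT.
  have f : 'I_0 -> T by case.
  by exists f => [[]//|a]; case: (widen_ord le_mr a).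
have t0 : T.
  suff : 0 < #|T| by move=> /card_gt0P/sigW [t].
  exact: leq_ltn_trans rT.
pose s := codom g ++ enum [predC codom g].
have us : uniq s.
  rewrite cat_uniq enum_uniq (map_inj_uniq ginj) enum_uniq /= andbT.
  by apply/hasPn => x; rewrite mem_enum.
have ss : size s = #|T|.
  by rewrite size_cat size_codom -cardE -(cardC (mem (codom g))); congr (_ + _); rewrite -(fintype.card_codom ginj).
exists (fun a : 'I_r.+1 => nth t0 s a) => [a b /eqP|a].
  rewrite nth_uniq ?ss //; try exact: leq_trans (ltn_ord _) rT.
  by move=> /eqP /val_inj.
rewrite nth_cat size_codom card_ord /= ltn_ord (nth_map a) ?size_enum_ord //.
by rewrite nth_ord_enum.
Qed.

Section Vectors.
Local Open Scope ring_scope.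
Variables (K : fieldType) (r : nat) (T : finType).
Implicit Types v w : T -> 'rV[K]_r.

Definition minor v (f : 'I_r -> T) : K := \det (\matrix_a v (f a)).

Definition general v : Prop := forall f : 'I_r -> T, injective f -> minor v f != 0.

(** Packs generality into the nonvanishing of one polynomial; a repeated index would make a minor
    zero. *)
Definition minors_prod v : K := \prod_(f : {ffun 'I_r -> T} | injectiveb f) minor v f.

(** Equality of PGL_r orbits on the level of representing vectors. *)
Definition proj_equiv v w : Prop :=
  exists A : 'M[K]_r, exists l : T -> K,
    [/\ A \in unitmx, forall i, l i != 0 & forall i, w i = l i *: (v i *m A)].

Definition span_config v : config K r T := fun i => <[v i]>%VS.

Lemma generalP v : general v <-> minors_prod v != 0.
Proof.
split=> [gv|/prodf_neq0 gv f finj].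
  by apply/prodf_neq0 => f /injectiveP /gv.
have := gv [ffun a => f a]; rewrite (_ : injectiveb _); last first.
  by apply/injectiveP => a b; rewrite !ffunE => /finj.
move=> /(_ isT); congr (\det _ != 0).
by apply/row_matrixP => a; rewrite !rowK ffunE.
Qed.

Lemma proj_equiv_refl v : proj_equiv v v.
Proof.
exists 1%:M, (fun=> 1); split=> [|i|i]; rewrite ?unitmx1 ?oner_eq0 //.
by rewrite mulmx1 scale1r.
Qed.

Lemma proj_equiv_sym v w : proj_equiv v w -> proj_equiv w v.
Proof.
move=> [A [l [uA l0 E]]]; exists (invmx A), (fun i => (l i)^-1); split=> [|i|i].
- by rewrite unitmx_inv.
- by rewrite invr_eq0.
- by rewrite E -scalemxAl mulmxK // scalerA mulVf // scale1r.
Qed.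

Lemma proj_equiv_trans v w x : proj_equiv v w -> proj_equiv w x -> proj_equiv v x.
Proof.
move=> [A [l [uA l0 E]]] [B [m [uB m0 F]]].
exists (A *m B), (fun i => m i * l i); split=> [|i|i].
- by rewrite unitmx_mul uA uB.
- by rewrite mulf_neq0.
- by rewrite F E -scalemxAl mulmxA scalerA.
Qed.

Lemma general_equiv v w : proj_equiv v w -> general v -> general w.
Proof.
move=> [A [l [uA l0 E]]] gv f finj; rewrite /minor.
have -> : \matrix_a w (f a) = diag_mx (\row_a l (f a)) *m (\matrix_a v (f a)) *m A.
  apply/row_matrixP => a; rewrite rowK E !row_mul row_diag_mx mxE.
  by rewrite -!scalemxAl -rowE rowK.
rewrite !det_mulmx det_diag !mulf_neq0 //; last by rewrite -unitfE -unitmxE.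
  by apply/prodf_neq0 => a _; rewrite mxE.
exact: gv.
Qed.

Hypothesis rT : (r <= #|T|)%N.

Lemma general_indep v m (g : 'I_m -> T) (y : 'I_m -> K) : general v ->
  (m <= r)%N -> injective g -> \sum_a y a *: v (g a) = 0 -> forall a, y a = 0.
Proof.
move=> gv le_mr ginj E; have [f finj fE] := extend_injection le_mr rT ginj.
have uA : \matrix_a v (f a) \in unitmx by rewrite unitmxE unitfE; apply: gv.
pose z : 'rV[K]_r := \sum_a y a *: delta_mx 0 (widen_ord le_mr a).
have z0 : z = 0.
  apply: (can_inj (mulmxK uA)); rewrite mul0mx -E mulmx_suml; apply: eq_bigr => a _.
  by rewrite -scalemxAl -rowE rowK fE.
move=> a; have : z 0 (widen_ord le_mr a) = 0 by rewrite z0 mxE.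
rewrite summxE (bigD1 a) //= !mxE !eqxx mulr1 big1 ?addr0 // => b ba.
rewrite !mxE eqxx /= -val_eqE /= eq_sym val_eqE (negbTE ba) mulr0 //.
Qed.

Hypothesis r2 : (2 <= r)%N.

Lemma general_neq0 v i : general v -> v i != 0.
Proof.
move=> gv; apply/eqP => vi.
have := @general_indep v 1 (fun=> i) (fun=> 1) gv (ltnW r2) _ _ ord0.
rewrite big_ord1 vi scaler0 => H.
suff /eqP : (1 : K) = 0 by rewrite oner_eq0.
by apply: H => // a b _; rewrite !ord1.
Qed.

Lemma general_sep v i i' : general v -> i != i' ->
  exists2 a : 'cV[K]_r, v i *m a = 0 & v i' *m a != 0.
Proof.
move=> gv ii'; pose g (a : 'I_2) := if a == ord0 then i' else i.
have ginj : injective g.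
  move=> [[|[|a]] // pa] [[|[|b]] // pb] //=; rewrite /g /= => E; apply/val_inj => //=.
    by rewrite E eqxx in ii'.
  by rewrite E eqxx in ii'.
have [f finj fE] := extend_injection r2 rT ginj.
have uA : \matrix_a v (f a) \in unitmx by rewrite unitmxE unitfE; apply: gv.
set A := \matrix_a v (f a) in uA.
pose o0 := widen_ord r2 ord0; pose o1 := widen_ord r2 (lift ord0 ord0).
exists (col o0 (invmx A)).
  have -> : v i = row o1 A by rewrite rowK fE.
  rewrite -row_mul colE mulmxA mulmxV // mul1mx; apply/matrixP => a b.
  by rewrite !ord1 !mxE.
have -> : v i' = row o0 A by rewrite rowK fE.
rewrite -row_mul colE mulmxA mulmxV // mul1mx; apply/eqP => /matrixP /(_ 0 0).
by rewrite !mxE !eqxx => /eqP; rewrite oner_eq0.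
Qed.

(** A vanishing minor puts r points in a hyperplane, against the case l = r - 2. Conversely, l + 2
    <= r points of a general family are independent and do not fit in dimension l + 1. *)
Lemma lin_generalP v : lin_general K r T (span_config v) <-> general v.
Proof.
split=> [[d1 lg] f finj|gv].
  rewrite /minor -det_tr; apply/negP => /det0P [y y0 yA].
  have ry : \rank y^T = 1%N by rewrite mxrank_tr rank_rV y0.
  have dW : \dim (relations y^T) = (r - 2).+1 by rewrite dim_relations //; lia.
  have := lg _ (leqnn _) _ dW; rewrite subnK // ltnNge => /negP; apply.
  rewrite -[X in (X <= _)%N](card_ord r) -(fintype.card_codom finj).
  apply/subset_leq_card/fintype.subsetP => _ /codomP [a ->].
  rewrite inE -memvE mem_relations -[v _]trmxK -trmx_mul.
  have -> : (v (f a))^T = col a (\matrix_a v (f a))^T by rewrite -tr_row rowK.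
  by rewrite colE mulmxA yA mul0mx trmx0.
split=> [i|l lr W dW]; first by rewrite dim_vline (general_neq0 _ gv).
rewrite ltnNge; apply/negP => le.
have lr' : (l + 2 <= r)%N by rewrite addnC -leq_subRL.
pose P := [pred i | span_config v i <= W]%VS.
pose g (a : 'I_(l + 2)) : T := enum_val (widen_ord le a : 'I_#|P|).
have ginj : injective g.
  by move=> a b /enum_val_inj /(congr1 val) E; apply: val_inj.
have gW a : v (g a) \in W by have := enum_valP (widen_ord le a : 'I_#|P|); rewrite inE memvE.
pose h : 'Hom('rV[K]_(l + 2), 'rV[K]_r) := linfun (mulmxr (\matrix_a v (g a))).
have hE y : h y = \sum_a y 0 a *: v (g a).
  by rewrite lfunE /= mulmx_sum_row; apply: eq_bigr => a _; rewrite rowK.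
have : (\dim (limg h) <= l.+1)%N.
  rewrite -dW; apply: dimvS; apply/subvP => _ /memv_imgP [y _ ->]; rewrite hE.
  by apply: memv_suml => a _; apply: memvZ.
have := limg_ker_dim h fullv; rewrite capfv dimvf /dim /= mul1n.
suff /eqP -> : lker h == 0%VS by rewrite dimv0 add0n => ->; rewrite leqNgt addn2 leqnn.
rewrite -subv0; apply/subvP => y; rewrite memv_ker hE memv0 => /eqP y0.
apply/eqP/rowP => a; rewrite mxE.
exact: (general_indep (y := fun a => y 0 a) gv lr' ginj y0).
Qed.

Lemma span_lineZ (c : K) (x : 'rV[K]_r) : c != 0 -> <[c *: x]>%VS = <[x]>%VS.
Proof.
move=> c0; apply/eqP; rewrite eqEsubv -!memvE memvZ ?memv_line //=.
by rewrite -[X in X \in _](scalerK c0) memvZ // memv_line.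
Qed.

Lemma dim1_line (U : {vspace 'rV[K]_r}) : \dim U = 1%N -> U = <[vpick U]>%VS /\ vpick U != 0.
Proof.
move=> dU; have U0 : vpick U != 0 by rewrite vpick0 -dimv_eq0 dU.
split=> //; apply/esym/eqP; rewrite eqEdim -memvE memv_pick dU dim_vline.
by rewrite U0.
Qed.

Lemma lin_general_span (p : config K r T) : lin_general K r T p ->
  exists2 v, p = span_config v & general v.
Proof.
move=> gp; have [d1 _] := gp; exists (fun i => vpick (p i)).
  by apply/funext => i; rewrite /span_config -(dim1_line (d1 i)).1.
by apply/lin_generalP; move: gp; congr (lin_general _ _ _ _); apply/funext => i; apply: (dim1_line (d1 i)).1.
Qed.

Lemma pgl_orbitP v (q : config K r T) :
  pgl_orbit (span_config v) q <-> exists2 w, q = span_config w & proj_equiv v w.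
Proof.
split=> [[g /= g0 <-]|[w -> [A [l [uA l0 E]]]]].
  exists (fun i => g (v i)).
    by apply/funext => i; rewrite /span_config limg_line.
  exists (lin1_mx g), (fun=> 1); split=> [|i|i]; rewrite ?oner_eq0 //; last first.
    by rewrite scale1r mul_rV_lin1.
  rewrite -row_free_unit -kermx_eq0; apply/rowV0P => y /sub_kermxP.
  by rewrite mul_rV_lin1 => gy; apply/eqP; rewrite -memv0 -(eqP g0) memv_ker gy.
exists (linfun (mulmxr A)).
  rewrite /= -subv0; apply/subvP => y; rewrite memv_ker lfunE /= memv0 => /eqP yA.
  by rewrite -[y](mulmxK uA) yA mul0mx.
apply/funext => i; rewrite /span_config limg_line lfunE /= E.
by rewrite span_lineZ.
Qed.

Lemma pgl_orbit_eq v w : (forall i, v i != 0) -> (forall i, w i != 0) ->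
  pgl_orbit (span_config v) = pgl_orbit (span_config w) <-> proj_equiv v w.
Proof.
move=> v0 w0; split=> [E|E].
  have : pgl_orbit (span_config w) (span_config w).
    by apply/pgl_orbitP; exists w => //; apply: proj_equiv_refl.
  rewrite -E => /pgl_orbitP [x wx vx]; apply: proj_equiv_trans vx _.
  have /choice [c cE] : forall i, exists c, w i = c *: x i.
    move=> i; have : w i \in <[x i]>%VS.
      have /(congr1 (fun p => p i)) := wx; rewrite /span_config => <-.
      exact: memv_line.
    by case/vlineP => c; exists c.
  exists 1%:M, c; split=> [|i|i]; rewrite ?unitmx1 ?mulmx1 //.
  by apply: contraNneq (w0 i) => c0; rewrite cE c0 scale0r.
apply/seteqP; split=> q /pgl_orbitP [x -> vx]; apply/pgl_orbitP; exists x => //.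
  by apply: proj_equiv_trans vx; apply: proj_equiv_sym.
exact: proj_equiv_trans E vx.
Qed.

Lemma moduliP x : moduli K r T x <->
  exists2 v, general v & x = pgl_orbit (span_config v).
Proof.
split=> [[p /lin_general_span [v -> gv] <-]|[v gv ->]]; first by exists v.
by exists (span_config v) => //; apply/lin_generalP.
Qed.

End Vectors.

Section VectorPolynomials.
Local Open Scope ring_scope.
Variables (K : fieldType) (r : nat).

Definition vectors (X : Type) (s : X * 'I_r -> K) : X -> 'rV[K]_r :=
  fun x => \row_a s (x, a).

Definition coords (X : Type) (v : X -> 'rV[K]_r) : X * 'I_r -> K :=
  fun xa => v xa.1 0 xa.2.

Lemma coordsK X : cancel (@coords X) (@vectors X).
Proof. by move=> v; apply/funext => x; apply/rowP => a; rewrite mxE. Qed.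

Definition vpolyfun (X : Type) (phi : (X -> 'rV[K]_r) -> K) : Prop :=
  polyfun (fun s => phi (vectors s)).

Lemma vpolyfun_entry X (x : X) a : vpolyfun (fun v => v x 0 a).
Proof.
by apply: (polyfun_ext (phi := fun s => s (x, a))) (polyfun_coord _ _) => s; rewrite mxE.
Qed.

Lemma vpolyfun_comp X Y (phi : (X -> 'rV[K]_r) -> K) (F : (Y -> K) -> X -> 'rV[K]_r) :
  vpolyfun phi -> (forall x a, polyfun (fun s => F s x 0 a)) ->
  polyfun (fun s => phi (F s)).
Proof.
move=> pphi pF; apply: (polyfun_ext (phi := fun s => phi (vectors (coords (F s))))).
  by move=> s; rewrite coordsK.
by apply: (polyfun_comp (F := fun s => coords (F s)) pphi) => -[x a]; apply: pF.
Qed.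

Lemma vpolyfun_nonzero X (phi : (X -> 'rV[K]_r) -> K) v :
  phi v != 0 -> nonzero_fun (fun s => phi (vectors s)).
Proof. by move=> H; exists (coords v); rewrite coordsK. Qed.

Lemma polyfun_minor X Y (F : (Y -> K) -> X -> 'rV[K]_r) (f : 'I_r -> X) :
  (forall x a, polyfun (fun s => F s x 0 a)) ->
  polyfun (fun s => \det (\matrix_a F s (f a))).
Proof.
move=> pF; apply: polyfun_det => a b.
by apply: (polyfun_ext _ (pF (f a) b)) => s; rewrite mxE.
Qed.

Lemma polyfun_minors_prod (X : finType) Y (F : (Y -> K) -> X -> 'rV[K]_r) :
  (forall x a, polyfun (fun s => F s x 0 a)) ->
  polyfun (fun s => minors_prod (F s)).
Proof. by move=> pF; apply: polyfun_prod => f; apply: polyfun_minor. Qed.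

Hypothesis charK : [pchar K] =i pred0.

(* Points on the moment curve. *)
Lemma general_exists (X : finType) : exists v : X -> 'rV[K]_r, general v.
Proof.
exists (fun x => \row_a (enum_rank x)%:R ^+ a) => f finj; rewrite /minor -det_tr.
have -> : (\matrix_a \row_b ((enum_rank (f a))%:R ^+ b))^T =
    Vandermonde r (\row_a (enum_rank (f a))%:R : 'rV[K]_r).
  by apply/matrixP => a b; rewrite !mxE.
rewrite det_Vandermonde; apply/prodf_neq0 => a _; apply/prodf_neq0 => b ab.
rewrite !mxE subr_eq0; apply/negP => /eqP /(natK_inj charK) /val_inj /enum_rank_inj /finj E.
by rewrite E ltnn in ab.
Qed.

End VectorPolynomials.

(** * Open subsets of the product of moduli spaces as nonvanishing loci *)

Section OpenSets.
Local Open Scope ring_scope.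
Local Open Scope classical_set_scope.
Variables (K : fieldType) (r k : nat) (T : 'I_k -> finType).
Hypothesis charK : [pchar K]%R =i pred0.
Hypothesis r2 : (2 <= r)%N.
Hypothesis rT : forall j, (r <= #|T j|)%N.

Definition block (q : {j : 'I_k & T j} -> 'rV[K]_r) (j : 'I_k) : T j -> 'rV[K]_r :=
  fun t => q (Tagged (fun j => T j) t).

Arguments block : clear implicits.

Definition general_blocks q : Prop := forall j, general (block q j).

Definition orbits (q : {j : 'I_k & T j} -> 'rV[K]_r) : forall j, set (config K r (T j)) :=
  fun j => pgl_orbit (span_config (block q j)).

Definition blocks_prod (q : {j : 'I_k & T j} -> 'rV[K]_r) : K := \prod_j minors_prod (block q j).

Lemma general_blocksP q : general_blocks q <-> blocks_prod q != 0.
Proof.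
split=> [H|/prodf_neq0 H j]; first by apply/prodf_neq0 => j _; apply/generalP.
exact/generalP/H.
Qed.

Lemma polyfun_blocks_prod Y (F : (Y -> K) -> {j : 'I_k & T j} -> 'rV[K]_r) :
  (forall x a, polyfun (fun s => F s x 0 a)) -> polyfun (fun s => blocks_prod (F s)).
Proof.
move=> pF; apply: polyfun_prod => j.
by apply: (polyfun_minors_prod (F := fun s => block (F s) j)) => x a; apply: pF.
Qed.

Lemma polyfun_vectors (X : Type) x a :
  polyfun (fun s : X * 'I_r -> K => vectors s x 0 a).
Proof. exact: vpolyfun_entry. Qed.

Lemma general_blocks_exists : exists q, general_blocks q.
Proof.
have ex j := @general_exists K r charK (T j).
exists (fun t => projT1 (cid (ex (tag t))) (tagged t)) => j.
exact: (projT2 (cid (ex j))).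
Qed.

Lemma general_blocks_neq0 q t : general_blocks q -> q t != 0.
Proof. by case: t => j t gq; apply: (general_neq0 (rT j) r2 t (gq j)). Qed.

Lemma nonzero_general_blocks (phi : ({j : 'I_k & T j} -> 'rV[K]_r) -> K) q0 :
  vpolyfun phi -> phi q0 != 0 -> exists q, general_blocks q /\ phi q != 0.
Proof.
move=> pphi q0P; have [q1 gq1] := general_blocks_exists.
have [|||s] := @nonzero_funM K charK _ (fun s => phi (vectors s))
    (fun s => blocks_prod (vectors s)) pphi.
- by apply: polyfun_blocks_prod; apply: polyfun_vectors.
- exact: vpolyfun_nonzero q0P.
- by apply: (vpolyfun_nonzero (v := q1)); apply/general_blocksP.
rewrite mulf_eq0 negb_or => /andP[p1 /general_blocksP p2].
by exists (vectors s).
Qed.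

(** Take the polynomial describing the open set near a representative [q0] of a point of [V], times
    [blocks_prod] to ensure generality. *)
Lemma open_nonzero (V : set (forall j, set (config K r (T j)))) :
  moduli_prod_open V -> V !=set0 ->
  exists2 phi, vpolyfun phi & (exists q, phi q != 0) /\
    forall q, phi q != 0 -> general_blocks q /\ V (orbits q).
Proof.
move=> [VM Vo] [y Vy].
have ex j : exists v : T j -> 'rV[K]_r, general v /\ y j = pgl_orbit (span_config v).
  by have /(moduliP (rT j) r2) [v gv yE] := VM y Vy j; exists v.
pose q0 (t : {j : 'I_k & T j}) : 'rV[K]_r := projT1 (cid (ex (tag t))) (tagged t).
have gq0 : general_blocks q0 by move=> j; case: (projT2 (cid (ex j))).
have q0y : orbits q0 = y.
  by apply/functional_extensionality_dep => j; case: (projT2 (cid (ex j))).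
have [t||f fq0 fP] := Vo q0; first exact: general_blocks_neq0.
  split=> [j|]; first by apply/(lin_generalP (rT j) r2); apply: gq0.
  by move: Vy; rewrite -q0y.
have pf : vpolyfun (fun q : {j : 'I_k & T j} -> 'rV[K]_r => f.@[hcoord q]).
  apply: (polyfun_comp (F := fun s => hcoord (vectors s)) (polyfun_meval f)) => m.
  exact: polyfun_vectors.
exists (fun q => f.@[hcoord q] * blocks_prod q); last split.
- by apply: polyfunM => //; apply: polyfun_blocks_prod; apply: polyfun_vectors.
- by exists q0; rewrite mulf_neq0 //; apply/general_blocksP.
move=> q; rewrite mulf_eq0 negb_or => /andP[fq /general_blocksP gq]; split=> //.
by have [t|//|_] := fP q; first exact: general_blocks_neq0.
Qed.

(** The orbits that meet the nonvanishing locus of [phi] form an open set: near [v] whose orbit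
    meets it in [q], use [phi] composed with the group element [tr] that carries [v] to [q]. *)
Lemma nonzero_open (phi : ({j : 'I_k & T j} -> 'rV[K]_r) -> K) q0 :
  vpolyfun phi -> phi q0 != 0 ->
  exists2 V : set (forall j, set (config K r (T j))),
    moduli_prod_open V /\ V !=set0 &
    forall y, V y -> exists q, [/\ general_blocks q, y = orbits q & phi q != 0].
Proof.
move=> pphi q0P.
pose V : set (forall j, set (config K r (T j))) :=
  [set y | exists q, [/\ general_blocks q, y = orbits q & phi q != 0]].
exists V => //; split; last first.
  by have [q [gq pq]] := nonzero_general_blocks pphi q0P; exists (orbits q), q.
split=> [y [q [gq -> _]] j|v v0 [vg [q [gq qE pq]]]].
  by apply/(moduliP (rT j) r2); exists (block q j).
have ex j : exists Al : 'M[K]_r * (T j -> K), [/\ Al.1 \in unitmx,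
    forall i, Al.2 i != 0 & forall i, block q j i = Al.2 i *: (block v j i *m Al.1)].
  have [|||A [l Al]] := (pgl_orbit_eq (v := block v j) (w := block q j) _ _).1.
  - by move=> i; apply: v0.
  - by move=> i; apply: general_blocks_neq0.
  - by have /(congr1 (fun y => y j)) := qE.
  - by exists (A, l).
pose A j := (projT1 (cid (ex j))).1.
pose l j := (projT1 (cid (ex j))).2.
have AlP j := projT2 (cid (ex j)).
pose tr (w : {j : 'I_k & T j} -> 'rV[K]_r) t :=
  l (tag t) (tagged t) *: (w t *m A (tag t)).
have trE w : (forall j, general (block w j)) ->
    general_blocks (tr w) /\ orbits (tr w) = orbits w.
  move=> gw; have eqv j : proj_equiv (block w j) (block (tr w) j).
    by have [uA l0 _] := AlP j; exists (A j), (l j).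
  have gt : general_blocks (tr w) by move=> j; apply: general_equiv (eqv j) (gw j).
  split=> //; apply/functional_extensionality_dep => j; apply/esym.
  apply/pgl_orbit_eq => // i.
    exact: (general_neq0 (rT j) r2 i (gw j)).
  exact: (general_neq0 (rT j) r2 i (gt j)).
have trv : tr v = q by apply/funext => -[j t]; have [_ _ E] := AlP j; apply/esym/(E t).
have ptr : polyfun (fun s => phi (tr (vectors s)) * blocks_prod (vectors s)).
  apply: polyfunM; last by apply: polyfun_blocks_prod; apply: polyfun_vectors.
  apply: (vpolyfun_comp (F := fun s => tr (vectors s)) pphi) => t a.
  apply: (polyfun_ext (phi := fun s =>
     l (tag t) (tagged t) * \sum_b vectors s t 0 b * A (tag t) b a)).
    by move=> s; rewrite !mxE.
  apply: polyfunM; first exact: polyfun_const.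
  apply: polyfun_sum => b; apply: polyfunM; last exact: polyfun_const.
  exact: polyfun_vectors.
have [f fE] := polyfun_mpoly ptr.
have fw w : f.@[hcoord w] = phi (tr w) * blocks_prod w.
  by rewrite (fE (coords w)) coordsK.
have gv : general_blocks v by move=> j; apply/(lin_generalP (rT j) r2).
exists f; first by rewrite fw trv mulf_neq0 //; apply/general_blocksP.
move=> w w0; rewrite fw mulf_eq0 negb_or => /andP[pw /general_blocksP gw]; split.
  by move=> j; apply/(lin_generalP (rT j) r2); apply: gw.
have [gt tE] := trE w gw.
by exists (tr w); split=> //; rewrite tE.
Qed.

End OpenSets.

Arguments block {K r k T} q j _.
Arguments orbits {K r k T} q j _.

(** * Dominance and fibre cardinalities in terms of representing vectors *)

Section Counts.
Local Open Scope card_scope.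
Local Open Scope ring_scope.
Local Open Scope classical_set_scope.
Variables (K : fieldType) (r n k : nat) (I : 'I_k -> {set 'I_n}).
Hypothesis charK : [pchar K]%R =i pred0.
Hypothesis r2 : (2 <= r)%N.
Hypothesis rn : (r <= n)%N.
Hypothesis rI : forall j, (r <= #|I j|)%N.

Definition local_labels (j : 'I_k) : finType := labels (I j).

Definition local_vectors := {j : 'I_k & local_labels j} -> 'rV[K]_r.

Definition lies_over (v : 'I_n -> 'rV[K]_r) (q : local_vectors) : Prop :=
  forall j, proj_equiv (fun i : local_labels j => v (val i)) (block q j).

Definition fibre (q : local_vectors) : set (set (config K r 'I_n)) :=
  moduli K r 'I_n `&` fgts I @^-1` [set orbits q].

Let rT j : (r <= #|local_labels j|)%N.
Proof. by rewrite card_sig (leq_trans (rI j)) // (eq_leq (eq_card _)). Qed.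

Let rn' : (r <= #|'I_n|)%N. Proof. by rewrite card_ord. Qed.

Lemma fgt_orbit (J : {set 'I_n}) (p : config K r 'I_n) :
  fgt J (pgl_orbit p) = pgl_orbit (fun i : labels J => p (val i)).
Proof.
apply/seteqP; split=> [_ [_ [g g0 <-] <-]|_ [g g0 <-]]; first by exists g.
by exists (fun i => (g @: p i)%VS) => //; exists g.
Qed.

Lemma general_restrict (J : {set 'I_n}) (v : 'I_n -> 'rV[K]_r) :
  general v -> general (fun i : labels J => v (val i)).
Proof. by move=> gv f finj; apply: (gv (fun a => val (f a))) => a b /val_inj/finj. Qed.

Lemma lies_over_fgts v q : general v -> general_blocks q ->
  lies_over v q <-> fgts I (pgl_orbit (span_config v)) = orbits q.
Proof.
move=> gv gq; have H j : proj_equiv (fun i : local_labels j => v (val i)) (block q j) <->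
    fgt (I j) (pgl_orbit (span_config v)) = orbits q j.
  rewrite fgt_orbit; apply: iff_sym; apply: pgl_orbit_eq => i.
    by apply: (general_neq0 rn' r2 (val i) gv).
  by apply: (general_neq0 (rT j) r2 i (gq j)).
split=> [E|E j]; last by apply/H; have /(congr1 (fun y => y j)) := E.
by apply/functional_extensionality_dep => j; apply/H.
Qed.

Lemma fibreP q x : general_blocks q -> fibre q x <->
  exists v, [/\ general v, lies_over v q & x = pgl_orbit (span_config v)].
Proof.
move=> gq; split=> [[/(moduliP rn' r2) [v gv ->] /= E]|[v [gv vq ->]]].
  by exists v; split=> //; apply/lies_over_fgts.
by split; [apply/(moduliP rn' r2); exists v|apply/lies_over_fgts].
Qed.

Definition poly_dominant : Prop :=
  forall phi : local_vectors -> K, vpolyfun phi -> (exists q, phi q != 0) ->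
  exists v q, [/\ general v, lies_over v q & phi q != 0].

Lemma fgts_dominantP : fgts_dominant K r I <-> poly_dominant.
Proof.
split=> [dom phi pphi [q0 q0P]|dom V Vo V0].
  have [V [Vo V0] VP] := nonzero_open charK r2 rT pphi q0P.
  have [_ [/VP [q [gq -> pq]] [x /(moduliP rn' r2) [v gv ->] E]]] := dom V Vo V0.
  by exists v, q; split=> //; apply/lies_over_fgts.
have [phi pphi [exq qP]] := open_nonzero r2 rT Vo V0.
have [v [q [gv vq pq]]] := dom phi pphi exq.
have [gq Vq] := qP q pq; exists (orbits q); split=> //.
exists (pgl_orbit (span_config v)); first by apply/(moduliP rn' r2); exists v.
by apply/lies_over_fgts.
Qed.

Lemma general_fibre_cardP d : general_fibre_card K r I d <->
  exists phi : local_vectors -> K, [/\ vpolyfun phi, exists q, phi q != 0 &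
    forall q, phi q != 0 -> general_blocks q /\ fibre q #= `I_d].
Proof.
split=> [[V [Vo V0 Vd]]|[phi [pphi [q0 q0P] qP]]].
  have [phi pphi [exq qP]] := open_nonzero r2 rT Vo V0.
  by exists phi; split=> // q /qP [gq Vq]; split=> //; apply: Vd.
have [V [Vo V0] VP] := nonzero_open charK r2 rT pphi q0P.
by exists V; split=> // _ /VP [q [gq -> /qP []]].
Qed.

End Counts.

(** * A parametrization of the families of local configurations *)

Section NormalForm.
Local Open Scope ring_scope.
Variables (K : fieldType) (r n : nat).
Hypothesis r2 : (2 <= r)%N.
Hypothesis rn : (r + 1 <= n)%N.

(* The first r vectors are the standard basis, the next one is (1, ..., 1) and  *)
(* the remaining ones have first coordinate 1.                                 *)
Definition normal_default (i : 'I_n) (a : 'I_r) : K :=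
  if (i < r)%N then (nat_of_ord i == a)%:R else 1.

Definition normal_free (i : 'I_n) (a : 'I_r) : bool := (r < i)%N && (0 < a)%N.

Definition normal (v : 'I_n -> 'rV[K]_r) : Prop :=
  forall i a, ~~ normal_free i a -> v i 0 a = normal_default i a.

Let rn' : (r <= #|'I_n|)%N. Proof. by rewrite card_ord; lia. Qed.

Let o (a : 'I_r) : 'I_n := widen_ord (leq_trans (leq_addr 1 r) rn) a.

Lemma coordinate_neq0 (v : 'I_n -> 'rV[K]_r) (i : 'I_n) (a : 'I_r) : general v ->
  (forall b, v (o b) = delta_mx 0 b) -> (r <= i)%N -> v i 0 a != 0.
Proof.
move=> gv vo ri; apply/eqP => via.
pose g b := if b == a then i else o b.
have ginj : injective g.
  move=> b c; rewrite /g; case: eqP => [->|_]; case: eqP => [->|_] // /(congr1 val) /= E.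
  - by move: ri; rewrite E leqNgt ltn_ord.
  - by move: ri; rewrite -E leqNgt ltn_ord.
  - exact/val_inj.
have := general_indep rn' (y := fun b => if b == a then -1 else v i 0 b) gv (leqnn r) ginj.
have H : \sum_b (if b == a then -1 else v i 0 b) *: v (g b) = 0.
  rewrite (bigD1 a) //= eqxx /g eqxx scaleN1r {1}[v i]row_sum_delta.
  rewrite (bigD1 a) //= via scale0r add0r addrC; apply/eqP; rewrite subr_eq0; apply/eqP.
  by apply: eq_bigr => b /negbTE ->; rewrite vo.
by move=> /(_ H a); rewrite eqxx => /eqP; rewrite oppr_eq0 oner_eq0.
Qed.

(** Send the first r vectors to the standard basis. The next one then has nonzero coordinates, and a
    diagonal matrix makes it (1, ..., 1); the factors [l] restore the basis vectors and bring the
    remaining first coordinates to 1. *)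
Lemma normal_form (v : 'I_n -> 'rV[K]_r) : general v ->
  exists2 w, normal w & proj_equiv v w.
Proof.
move=> gv; pose A := \matrix_a v (o a).
have oinj : injective o by move=> a b /(congr1 val) /= /val_inj.
have uA : A \in unitmx by rewrite unitmxE unitfE; apply: gv.
have [w1 e1 w1o] : exists2 w1, proj_equiv v w1 & forall b, w1 (o b) = delta_mx 0 b.
  exists (fun i => v i *m invmx A) => [|b].
    exists (invmx A), (fun=> 1); split=> [|i|i]; rewrite ?unitmx_inv ?oner_eq0 //.
    by rewrite scale1r.
  by rewrite -[v (o b)](rowK (fun a => v (o a))) rowE -mulmxA mulmxV // mulmx1.
have gw1 := general_equiv e1 gv.
have rn1 : (r < n)%N by rewrite -addn1.
pose ir : 'I_n := Ordinal rn1.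
have w1r a : w1 ir 0 a != 0 by apply: coordinate_neq0.
pose D : 'M[K]_r := diag_mx (\row_a (w1 ir 0 a)^-1).
have uD : D \in unitmx.
  by rewrite unitmxE unitfE det_diag; apply/prodf_neq0 => a _; rewrite mxE invr_eq0.
have r0 : (0 < r)%N by apply: ltnW.
pose a0 : 'I_r := Ordinal r0.
pose l (i : 'I_n) : K := if insub (val i) is Some a then w1 ir 0 a
  else if (i == r :> nat) then 1 else (w1 i 0 a0)^-1 * w1 ir 0 a0.
have l0 i : l i != 0.
  rewrite /l; case: insubP => [a _ _|]; first exact: w1r.
  rewrite -leqNgt => ri; case: ifP => _; first by rewrite oner_eq0.
  by rewrite mulf_neq0 ?invr_eq0 //; apply: coordinate_neq0.
exists (fun i => l i *: (w1 i *m D)); last first.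
  by apply: proj_equiv_trans e1 _; exists D, l.
move=> i a nf; rewrite mxE mul_mx_diag !mxE /l /normal_default.
case: insubP => [b ib bi|].
  rewrite ib; have -> : i = o b by apply: val_inj.
  rewrite w1o mxE eqxx /= /o /=; case: (eqVneq a b) => [->|ab].
    by rewrite eqxx mul1r mulfV.
  by rewrite val_eqE eq_sym (negbTE ab) mul0r mulr0.
rewrite -leqNgt => ri; rewrite ltnNge ri /=; case: eqP => [ir'|ir'].
  have -> : i = ir by apply: val_inj.
  by rewrite mul1r mulfV.
move: nf; rewrite negb_and -leqNgt (leq_eqVlt i) (negbTE (introN eqP ir')) /=.
rewrite ltnNge ri /= -eqn0Ngt => /eqP a0E.
have -> : a = a0 by apply: val_inj.
by rewrite mulrACA mulVf ?mul1r ?mulfV //; apply: coordinate_neq0.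
Qed.

End NormalForm.

Lemma sum_ord_gt n m : \sum_(i < n | m < i) 1 = n - m.+1.
Proof.
elim: n => [|n IH]; first by rewrite big_ord0.
rewrite big_mkcond big_ord_recr -big_mkcond /= IH; case: ifP; lia.
Qed.

Section Source.
Local Open Scope ring_scope.
Variables (K : fieldType) (r n k : nat) (I : 'I_k -> {set 'I_n}).
Hypothesis charK : [pchar K] =i pred0.
Hypothesis r2 : (2 <= r)%N.
Hypothesis nk : n = (k + r + 1)%N.
Hypothesis hI : forall j, #|I j| = (r + 2)%N.
Variable base : forall j, local_labels I j.

Let rn : (r + 1 <= n)%N. Proof. by rewrite nk; lia. Qed.
Let rn' : (r <= #|'I_n|)%N. Proof. by rewrite card_ord; lia. Qed.

Notation labelled := {j : 'I_k & local_labels I j}.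

Definition all_parameters : Type := ('I_n * 'I_r + 'I_k * ('I_r * 'I_r) + labelled)%type.

HB.instance Definition _ := Finite.on all_parameters.

(** The scalar at [base j] is fixed because it can be absorbed in the matrix of index [j]. *)
Definition parameter_free (p : all_parameters) : bool :=
  match p with
  | inl (inl q) => normal_free q.1 q.2
  | inl (inr _) => true
  | inr t => t != Tagged (local_labels I) (base (tag t))
  end.

Definition parameter_default (p : all_parameters) : K :=
  match p with inl (inl q) => normal_default K q.1 q.2 | _ => 1 end.

Definition parameters : finType := {p : all_parameters | parameter_free p}.

(** [parameter_default] as [dflt] gives points in normal form; the zero function gives tangent
    directions. *)
Definition extend (dflt : all_parameters -> K) (s : parameters -> K) (p : all_parameters) : K :=
  if insub p is Some p' then s p' else dflt p.

Definition param_vectors dflt s (i : 'I_n) : 'rV[K]_r :=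
  \row_a extend dflt s (inl (inl (i, a))).
Definition param_matrix dflt s (j : 'I_k) : 'M[K]_r :=
  \matrix_(a, b) extend dflt s (inl (inr (j, (a, b)))).
Definition param_scale dflt s (t : labelled) : K := extend dflt s (inr t).

Notation vx := (param_vectors parameter_default).
Notation gx := (param_matrix parameter_default).
Notation lx := (param_scale parameter_default).

(* All the families lying over the normal configuration vx s arise by varying   *)
(* the other parameters.                                                       *)
Definition param_family (s : parameters -> K) (t : labelled) : 'rV[K]_r :=
  lx s t *: (vx s (val (tagged t)) *m gx s (tag t)).

(** With n - r - 1 = k, there are k(r - 1) coordinates, k r^2 matrix entries and k(r + 1) scalars,
    in all k(r + 2)r. *)
Lemma card_parameters : #|parameters| = #|{: labelled * 'I_r}|.
Proof.
have cL : #|{: labelled}| = (k * (r + 2))%N.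
  rewrite card_tagged sumnE big_map big_enum /=.
  rewrite (eq_bigr (fun=> (r + 2)%N)) => [|j _]; first by rewrite sum_nat_const card_ord.
  by rewrite card_sig -(hI j); apply: eq_card.
rewrite card_prod cL card_ord card_sig -sum1_card big_sumType /= big_sumType /=.
have -> : (\sum_(q : 'I_n * 'I_r | normal_free q.1 q.2) 1 = (n - r.+1) * (r - 1))%N.
  rewrite -(pair_big (fun i : 'I_n => r < i)%N (fun a : 'I_r => 0 < a)%N (fun _ _ => 1%N)) /=.
  rewrite (eq_bigr (fun=> (1 * (r - 1))%N)) => [|i _]; last by rewrite sum_ord_gt mul1n.
  by rewrite -big_distrl /= sum_ord_gt.
have -> : (\sum_(q : 'I_k * ('I_r * 'I_r)) 1 = k * (r * r))%N.
  by rewrite sum1_card !card_prod !card_ord.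
have -> : (\sum_(t : labelled | t != Tagged (local_labels I) (base (tag t))) 1 = k * (r + 1))%N.
  pose g j : labelled := Tagged (local_labels I) (base j).
  have ginj : injective g by move=> i j /(congr1 (@tag _ _)).
  rewrite sum1_card; have := cardC (mem (codom g)).
  rewrite (fintype.card_codom ginj) card_ord cL => E.
  rewrite (eq_card (B := [predC codom g])); first by apply/eqP; rewrite -(eqn_add2l k) [X in X == _]E; apply/eqP; nia.
  move=> t; rewrite !inE; congr (~~ _); apply/eqP/codomP => [tE|[j ->//]].
  by exists (tag t).
rewrite nk; nia.
Qed.

Lemma source_point (v : 'I_n -> 'rV[K]_r) (A : 'I_k -> 'M[K]_r) (l : labelled -> K) :
  normal v -> (forall j, l (Tagged (local_labels I) (base j)) = 1) ->
  exists s, [/\ vx s = v, gx s = A & lx s = l].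
Proof.
move=> nv l1; pose f (p : all_parameters) : K := match p with
  | inl (inl q) => v q.1 0 q.2 | inl (inr q) => A q.1 q.2.1 q.2.2 | inr t => l t end.
have fE p : extend parameter_default (fun p' => f (val p')) p = f p.
  rewrite /extend; case: insubP => [p' _ -> //|].
  case: p => [[[i a]|q]|[j t]] //= H; first by rewrite nv.
  have -> : t = base j by apply/eqP; move: H; rewrite negbK /= -tag_eqE /tag_eq /= eqxx tagged_asE.
  by rewrite l1.
exists (fun p => f (val p)); split.
- by apply/funext => i; apply/rowP => a; rewrite mxE fE.
- by apply/funext => j; apply/matrixP => a b; rewrite mxE fE.
- by apply/funext => t; rewrite /param_scale fE.
Qed.

Lemma polyfun_extend p : polyfun (fun s => extend parameter_default s p).
Proof.
rewrite /extend; case: insubP => [p' _ _|_]; first exact: polyfun_coord.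
exact: polyfun_const.
Qed.

Lemma polyfun_family t a : polyfun (fun s => param_family s t 0 a).
Proof.
apply: (polyfun_ext (phi := fun s => lx s t *
   \sum_b vx s (val (tagged t)) 0 b * gx s (tag t) b a)).
  by move=> s; rewrite !mxE.
apply: polyfunM; first exact: polyfun_extend.
apply: polyfun_sum => b; apply: polyfunM.
  by apply: polyfun_ext (polyfun_extend _) => s; rewrite mxE.
by apply: polyfun_ext (polyfun_extend _) => s; rewrite mxE.
Qed.

Lemma family_surjective v (q : local_vectors K r I) : general v -> lies_over v q ->
  exists s, [/\ proj_equiv v (vx s), param_family s = q,
    forall j, gx s j \in unitmx & forall t, lx s t != 0].
Proof.
move=> gv vq; have [w nw vw] := normal_form r2 rn gv.
have wq j : proj_equiv (fun i : local_labels I j => w (val i)) (block q j).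
  apply: proj_equiv_trans (vq j); apply: proj_equiv_sym.
  by have [B [m [uB m0 mE]]] := vw; exists B, (fun i => m (val i)); split.
have ex j : exists Al : 'M[K]_r * (local_labels I j -> K), [/\ Al.1 \in unitmx,
    forall i, Al.2 i != 0 & forall i, block q j i = Al.2 i *: (w (val i) *m Al.1)].
  by have [A [l [uA l0 E]]] := wq j; exists (A, l).
pose A j := (projT1 (cid (ex j))).1.
pose l j := (projT1 (cid (ex j))).2.
have AlP j : [/\ A j \in unitmx, forall i, l j i != 0 &
  forall i, block q j i = l j i *: (w (val i) *m A j)] := projT2 (cid (ex j)).
have b0 j : l j (base j) != 0 by have [_ ->] := AlP j.
have [|s [vE gE lE]] := @source_point w (fun j => l j (base j) *: A j)
   (fun t => l (tag t) (tagged t) / l (tag t) (base (tag t))) nw.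
  by move=> j /=; rewrite mulfV.
exists s; split.
- by rewrite vE.
- apply/funext => -[j i]; rewrite /param_family vE gE lE /=.
  have [_ _ E] := AlP j; rewrite -scalemxAr scalerA divfK //.
  exact/esym/(E i).
- move=> j; rewrite gE unitmxE detZ unitrM unitfE expf_neq0 //=.
  by have [] := AlP j.
- by move=> t; rewrite lE mulf_neq0 ?invr_eq0 //; have [_ ->] := AlP (tag t).
Qed.

Lemma family_dominant : poly_dominant K r I ->
  forall G : (labelled * 'I_r -> K) -> K, polyfun G -> nonzero_fun G ->
  nonzero_fun (fun s => G (coords (param_family s))).
Proof.
move=> dom G pG [y0 Gy0].
have vK (y : labelled * 'I_r -> K) : coords (vectors y) = y.
  by apply/funext => -[t a]; rewrite /coords mxE.
have [||v [q [gv vq Gq]]] := dom (fun q => G (coords q)).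
- apply: polyfun_ext pG => y; by rewrite vK.
- by exists (vectors y0); rewrite vK.
by have [s [_ sq _ _]] := family_surjective gv vq; exists s; rewrite sq.
Qed.

End Source.

Section DerivativeUnique.
Local Open Scope ring_scope.

Lemma hasder_unique (K : fieldType) (charK : [pchar K]%R =i pred0) (S : Type)
    (phi : (S -> K) -> K) (a b : S -> K) (d e : K) :
  hasder phi a b d -> hasder phi a b e -> d = e.
Proof.
move=> [p pE] [q qE]; have E : ((d - e)%:P + 'X * (p - q)) * 'X = 0.
  apply: (poly_vanish_all charK) => c; rewrite !hornerE.
  have E : phi a + c * d + c ^+ 2 * p.[c] = phi a + c * e + c ^+ 2 * q.[c].
    by rewrite -pE -qE.
  have -> : (d - e + c * (p.[c] - q.[c])) * c =
    (phi a + c * d + c ^+ 2 * p.[c]) - (phi a + c * e + c ^+ 2 * q.[c]) by ring.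
  by rewrite E subrr.
move/eqP: E; rewrite mulf_eq0 polyX_eq0 orbF => /eqP /(congr1 (fun p => p.[0])).
by rewrite !hornerE => /eqP; rewrite subr_eq0 => /eqP.
Qed.

End DerivativeUnique.

(** * Dominance makes the local cotangent spaces independent *)

Section Star.
Local Open Scope ring_scope.
Variables (K : fieldType) (r n k : nat) (I : 'I_k -> {set 'I_n}).
Hypothesis charK : [pchar K] =i pred0.
Hypothesis r2 : (2 <= r)%N.
Hypothesis nk : n = (k + r + 1)%N.
Hypothesis hI : forall j, #|I j| = (r + 2)%N.
Variable base : forall j, local_labels I j.

Notation labelled := {j : 'I_k & local_labels I j}.
Notation vx := (@param_vectors K r n k I base (@parameter_default K r n k I)).
Notation gx := (@param_matrix K r n k I base (@parameter_default K r n k I)).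
Notation lx := (@param_scale K r n k I base (@parameter_default K r n k I)).
Notation vx0 := (@param_vectors K r n k I base (fun=> 0)).
Notation gx0 := (@param_matrix K r n k I base (fun=> 0)).
Notation lx0 := (@param_scale K r n k I base (fun=> 0)).

Lemma extend_line d (a b : parameters r base -> K) c p :
  extend d (fun i => a i + c * b i) p = extend d a p + c * extend (fun=> 0) b p.
Proof. by rewrite /extend; case: insubP => // _; rewrite mulr0 addr0. Qed.

Definition family_der (s b : parameters r base -> K) (t : labelled) : 'rV[K]_r :=
  lx0 b t *: (vx s (val (tagged t)) *m gx s (tag t))
  + lx s t *: (vx0 b (val (tagged t)) *m gx s (tag t))
  + lx s t *: (vx s (val (tagged t)) *m gx0 b (tag t)).

Lemma hasder_family s b t a :
  hasder (fun s => param_family s t 0 a) s b (family_der s b t 0 a).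
Proof.
set i := val (tagged t); set j := tag t.
exists ((lx0 b t * (vx0 b i *m gx s j) 0 a + lx0 b t * (vx s i *m gx0 b j) 0 a
         + lx s t * (vx0 b i *m gx0 b j) 0 a)%:P + 'X * (lx0 b t * (vx0 b i *m gx0 b j) 0 a)%:P) => c.
have vE : vx (fun i => s i + c * b i) i = vx s i + c *: vx0 b i.
  by apply/rowP => e; rewrite !mxE extend_line.
have gE : gx (fun i => s i + c * b i) j = gx s j + c *: gx0 b j.
  by apply/matrixP => d e; rewrite !mxE extend_line.
have lE : lx (fun i => s i + c * b i) t = lx s t + c * lx0 b t by exact: extend_line.
rewrite /param_family -/i -/j vE gE lE hornerD hornerM hornerX !hornerC mulmxDl !mulmxDr -!scalemxAl -!scalemxAr.
have addE (A B : 'rV[K]_r) : (A + B) 0 a = A 0 a + B 0 a by rewrite mxE.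
have scaleE (e : K) (A : 'rV[K]_r) : (e *: A) 0 a = e * A 0 a by rewrite mxE.
rewrite /family_der -/i -/j !(addE, scaleE).
by ring.
Qed.

Lemma sum_labelled (F : 'I_k -> 'I_n -> K) : (forall j i, i \notin I j -> F j i = 0) ->
  \sum_(t : labelled) F (tag t) (val (tagged t)) = \sum_j \sum_i F j i.
Proof.
move=> F0; have -> : \sum_(t : labelled) F (tag t) (val (tagged t)) =
    \sum_j \sum_(i : local_labels I j) F j (val i).
  by rewrite (sig_big_dep _ (fun j _ => true) (fun j i => F j (val i))).
apply: eq_bigr => j _; rewrite -(big_sub (I j) (F j)) [RHS](bigID (mem (I j))) /=.
by rewrite [X in _ + X]big1 ?addr0 // => i /F0.
Qed.

(** A family [W] as in [cotangent_independent] becomes a covector [Wt] on the target that kills the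
    image of the differential, so it is zero by [jacobian_dual]. Each kind of parameter uses one
    condition: the scalars that W_j i . V i = 0, the matrices that V^T W_j = 0, and the vectors that
    the W_j sum to zero. *)
Lemma dominant_cotangent_independent : poly_dominant K r I ->
  exists s, [/\ general (vx s), forall j, gx s j \in unitmx, forall t, lx s t != 0 &
    cotangent_independent (\matrix_i vx s i) I].
Proof.
move=> dom; pose h s := minors_prod (vx s) * \prod_j \det (gx s j) * \prod_t lx s t.
have pext p := @polyfun_extend K r n k I base p.
have [|||||s hs sW] := @jacobian_dual K charK (parameters r base)
  {: labelled * 'I_r}%type (fun s => coords (param_family s)) h.
- exact: card_parameters.
- by move=> [t a]; apply: polyfun_family.
- by apply: family_dominant.
- apply: polyfunM; first apply: polyfunM.
  + apply: polyfun_minors_prod => i a.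
    by apply: polyfun_ext (pext (inl (inl (i, a)))) => s; rewrite mxE.
  + apply: polyfun_prod => j; apply: polyfun_det => a b.
    by apply: polyfun_ext (pext (inl (inr (j, (a, b))))) => s; rewrite mxE.
  + by apply: polyfun_prod => t; apply: pext.
- have rn1 : (r + 1 <= n)%N by rewrite nk; lia.
  have [v gv] := general_exists r charK 'I_n.
  have [w nw vw] := normal_form r2 rn1 gv.
  have [//|s [vE gE lE]] := @source_point K r n k I base w (fun=> 1%:M) (fun=> 1) nw.
  exists s; rewrite /h vE gE lE !mulf_neq0 //.
  + by apply/generalP; apply: general_equiv vw gv.
  + by apply/prodf_neq0 => j _; rewrite det1 oner_eq0.
  + by apply/prodf_neq0 => t _; rewrite oner_eq0.
move: hs; rewrite /h !mulf_eq0 !negb_or => /andP[/andP[/generalP gv /prodf_neq0 dg] /prodf_neq0 l0].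
have ug j : gx s j \in unitmx by rewrite unitmxE unitfE dg.
exists s; split=> // [t|]; first exact: l0.
set V := \matrix_i vx s i => W WI WV WVd W0.
pose w (t : labelled) : 'cV[K]_r := (row (val (tagged t)) (W (tag t)))^T.
pose Wt (x : labelled * 'I_r) : K :=
  (lx s x.1)^-1 * (invmx (gx s (tag x.1)) *m w x.1) x.2 0.
suff H : forall x, Wt x = 0.
  move=> j; apply/matrixP => i a; rewrite [RHS]mxE.
  have [iI|iI] := boolP (i \in I j); last exact: WI.
  pose t : labelled := Tagged (local_labels I) (Sub i iI : local_labels I j).
  have : invmx (gx s j) *m w t = 0.
    apply/colP => b; have := H (t, b); rewrite /Wt /= => /eqP.
    by rewrite mulf_eq0 invr_eq0 (negbTE (l0 t isT)) /= => /eqP ->; rewrite mxE.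
  move/(congr1 (mulmx (gx s j))); rewrite mulKVmx // mulmx0 => /colP /(_ a).
  by rewrite !mxE.
apply: sW => b d dE.
pose V' := \matrix_i vx0 b i.
pose X j := gx0 b j *m invmx (gx s j).
pose F j i := (V' *m (W j)^T) i i + (V *m X j *m (W j)^T) i i.
have rowF (A : 'M[K]_(n, r)) j i : (row i A *m (row i (W j))^T) 0 0 = (A *m (W j)^T) i i.
  by rewrite !mxE; apply: eq_bigr => a _; rewrite !mxE.
have term (t : labelled) : \sum_a Wt (t, a) * d (t, a) = F (tag t) (val (tagged t)).
  set j := tag t; set i := val (tagged t).
  have -> : \sum_a Wt (t, a) * d (t, a) =
      (lx s t)^-1 * (family_der s b t *m (invmx (gx s j) *m w t)) 0 0.
    rewrite [in RHS]mxE big_distrr; apply: eq_bigr => a _ /=.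
    rewrite /Wt /= -mulrA; congr (_ * _); rewrite mulrC; congr (_ * _).
    exact: hasder_unique charK _ _ _ _ _ _ (dE (t, a)) (hasder_family s b t a).
  rewrite mulmxA /family_der -/i -/j !mulmxDl -!scalemxAl !mulmxK //.
  rewrite -(mulmxA (vx s i)) -/(X j).
  have vi : vx s i = row i V by rewrite rowK.
  have vi' : vx0 b i = row i V' by rewrite rowK.
  rewrite /F vi vi' -(row_mul i V (X j)) /w -/i -/j.
  have addE (A B : 'M[K]_1) : (A + B) 0 0 = A 0 0 + B 0 0 by rewrite mxE.
  have scaleE (e : K) (A : 'M[K]_1) : (e *: A) 0 0 = e * A 0 0 by rewrite mxE.
  rewrite !(addE, scaleE) !rowF.
  have -> : (V *m (W j)^T) i i = 0 by rewrite -[V]trmxK -trmx_mul mxE WVd.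
  by rewrite mulr0 add0r -mulrDr mulKf // l0.
have -> : \sum_x Wt x * d x = \sum_t \sum_a Wt (t, a) * d (t, a).
  by rewrite pair_bigA; apply: eq_bigr => -[t a].
rewrite (eq_bigr _ (fun t _ => term t)) sum_labelled => [|j i iI].
  rewrite (eq_bigr (fun j => \tr (V' *m (W j)^T))) => [|j _].
    have -> : \sum_j \tr (V' *m (W j)^T) = \tr (V' *m (\sum_j W j)^T).
      by rewrite [(\sum_j W j)^T]linear_sum mulmx_sumr linear_sum.
    by rewrite W0 trmx0 mulmx0 mxtrace0.
  rewrite big_split /= -[X in _ + X]/(\tr (V *m X j *m (W j)^T)).
  have -> : \tr (V *m X j *m (W j)^T) = 0; last by rewrite addr0.
  by rewrite mxtrace_mulC mulmxA -[V]trmxK -trmx_mul WV trmx0 mul0mx mxtrace0.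
have col0 (A : 'M[K]_(n, r)) : (A *m (W j)^T) i i = 0.
  by rewrite mxE big1 // => a _; rewrite mxE WI ?mulr0.
by rewrite /F !col0 addr0.
Qed.

End Star.

(** * Lifting configurations *)

Section LastColumn.
Local Open Scope ring_scope.
Variables (K : fieldType) (m : nat).

Definition last_det (A : 'M[K]_(m + 1, m)) (w : 'cV[K]_(m + 1)) : K := \det (row_mx A w).

Lemma cofactor_last (A : 'M[K]_(m + 1, m)) (w : 'cV[K]_(m + 1)) x :
  cofactor (row_mx A w) x (rshift m 0) = cofactor (row_mx A 0) x (rshift m 0).
Proof.
rewrite /cofactor; congr (_ * \det _); apply/matrixP => y z; rewrite !mxE.
case: splitP => // u uE; case: (negP (neq_lift (rshift m 0) z)).
by apply/eqP/val_inj; rewrite [RHS]uE /= ord1.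
Qed.

Lemma last_det_linear (A : 'M[K]_(m + 1, m)) n (B : 'M[K]_(m + 1, n)) (t : 'cV[K]_n) :
  last_det A (B *m t) = \sum_i t i 0 * last_det A (col i B).
Proof.
have E w : last_det A w = \sum_x w x 0 * cofactor (row_mx A 0) x (rshift m 0).
  rewrite /last_det (expand_det_col _ (rshift m 0)); apply: eq_bigr => x _.
  by rewrite cofactor_last row_mxEr.
rewrite E; under eq_bigr => x _ do rewrite mxE big_distrl.
rewrite exchange_big; apply: eq_bigr => i _ /=; rewrite E big_distrr.
by apply: eq_bigr => x _ /=; rewrite mxE mulrA [B x i * _]mulrC.
Qed.

Lemma last_det_eq0 (A : 'M[K]_(m + 1, m)) w : last_det A w = 0 ->
  exists y : 'cV[K]_m, exists2 c : K, (y != 0) || (c != 0) & A *m y + c *: w = 0.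
Proof.
rewrite /last_det => D0; have : \det (row_mx A w)^T == 0 by rewrite det_tr D0.
move/det0P => [u u0 uA]; exists (lsubmx u)^T, (rsubmx u 0 0).
  apply: contraNT u0; rewrite negb_or !negbK => /andP[/eqP y0 /eqP c0].
  apply/eqP; rewrite -[LHS]hsubmxK -[lsubmx u]trmxK y0 trmx0.
  by rewrite [rsubmx u]mx11_scalar c0 raddf0 row_mx0.
move: uA; rewrite -{1}[u]hsubmxK tr_row_mx mul_row_col => /(congr1 trmx).
rewrite trmx0 raddfD /= !trmx_mul !trmxK => <-; congr (_ + _).
by rewrite [in RHS](mx11_scalar (rsubmx u)) tr_scalar_mx mul_mx_scalar.
Qed.

Lemma last_det_dep (A : 'M[K]_(m + 1, m)) y : last_det A (A *m y) = 0.
Proof.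
apply/eqP; rewrite /last_det -det_tr; apply/det0P.
exists (row_mx y^T (-1)).
  apply/negP => /eqP /(congr1 rsubmx); rewrite row_mxKr raddf0 => /eqP.
  by rewrite oppr_eq0 oner_eq0.
by rewrite tr_row_mx mul_row_col trmx_mul mulNmx mul1mx subrr.
Qed.

Lemma polyfun_last_det (S : Type) (A : (S -> K) -> 'M[K]_(m + 1, m)) (w : (S -> K) -> 'cV[K]_(m + 1)) :
  (forall x a, polyfun (fun s => A s x a)) -> (forall x, polyfun (fun s => w s x 0)) ->
  polyfun (fun s => last_det (A s) (w s)).
Proof.
move=> pA pw; apply: polyfun_det => x a.
case: (split_ordP a) => b ->.
  by apply: polyfun_ext (pA x b) => s; rewrite row_mxEl.
by apply: polyfun_ext (pw x) => s; rewrite row_mxEr ord1.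
Qed.

End LastColumn.

Lemma general_ker (K : fieldType) (r : nat) (T : finType) (v : T -> 'rV[K]_r)
    (f : 'I_r -> T) (y : 'cV[K]_r) :
  general v -> injective f -> (forall a, v (f a) *m y = 0)%R -> y = 0%R.
Proof.
move=> gv finj fy; have uA : (\matrix_a v (f a) \in unitmx)%R by rewrite unitmxE unitfE; apply: gv.
apply: (can_inj (mulKmx uA)); rewrite mulmx0; apply/row_matrixP => a.
by rewrite row_mul rowK row0 fy.
Qed.

Section Dependence.
Local Open Scope ring_scope.

Lemma last_det_comb (K : fieldType) r (X : finType) (v : X -> 'rV[K]_r) (t : X -> K) (R : 'I_(r + 1) -> X)
    (p : 'cV[K]_r) c : c != 0 -> (forall a, (v (R a) *m p) 0 0 + c * t (R a) = 0) ->
  last_det (\matrix_a v (R a)) (\col_a t (R a)) = 0.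
Proof.
move=> c0 E; rewrite (_ : \col_a t (R a) = (\matrix_a v (R a)) *m (- c^-1 *: p)).
  exact: last_det_dep.
apply/colP => a; rewrite -scalemxAr [RHS]mxE [LHS]mxE; apply: (mulfI c0).
have -> : c * t (R a) = - (v (R a) *m p) 0 0 by apply/eqP; rewrite -addr_eq0 addrC E.
rewrite mulrA mulrN mulfV // mulN1r !mxE; congr (- _).
by apply: eq_bigr => b _; rewrite !mxE.
Qed.

End Dependence.

(** * The linear system for the extra coordinates of a lift *)

Section System.
Local Open Scope ring_scope.
Variables (K : fieldType) (r n k : nat) (I : 'I_k -> {set 'I_n}).
Hypothesis charK : [pchar K] =i pred0.
Hypothesis r2 : (2 <= r)%N.
Hypothesis nk : n = (k + r + 1)%N.
Hypothesis hI : forall j, #|I j| = (r + 2)%N.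
Variable base : forall j, local_labels I j.
Variable mark : forall j, 'I_(r + 1 + 1) -> local_labels I j.
Hypothesis mark_bij : forall j, bijective (@mark j).

Notation labelled := {j : 'I_k & local_labels I j}.

(** Up to the order of columns, a minor of the lifted configuration on r + 1 points other than the
    appended one. *)
Definition lift_minor (v : 'I_n -> 'rV[K]_r) (R : 'I_(r + 1) -> 'I_n) (t : 'cV[K]_n) : K :=
  last_det (\matrix_a v (R a)) (\col_a t (R a) 0).

(* The vanishing of this determinant says that on I j, the vectors tau, l t and *)
(* the coordinates of the l v are linearly dependent.                          *)
Definition local_det (v : 'I_n -> 'rV[K]_r) (l tau : labelled -> K) (j : 'I_k)
    (t : 'cV[K]_n) : K :=
  let p x : labelled := Tagged (local_labels I) (mark j x) in
  last_det (row_mx (\matrix_x (l (p x) *: v (val (mark j x)))) (\col_x tau (p x)))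
    (\col_x (l (p x) * t (val (mark j x)) 0)).

(* The vector t of last coordinates of a lift of v matters only modulo the       *)
(* coordinates of v, hence the normalization t y = 0 for y < r; the rows y > r  *)
(* express that t lifts the prescribed tau, and the row y = r that t is general *)
(* on R.                                                                       *)
Definition system_row v l tau R (y : 'I_n) (t : 'cV[K]_n) : K :=
  if (y < r)%N then t y 0
  else if (y == r :> nat) then lift_minor v R t
  else if insub (y - r.+1)%N is Some j then local_det v l tau j t else 0.

Definition system v l tau R : 'M[K]_n :=
  \matrix_(y, i) system_row v l tau R y (delta_mx i 0).

Lemma lift_minor_sum v R t :
  lift_minor v R t = \sum_i t i 0 * lift_minor v R (delta_mx i 0).
Proof.
rewrite /lift_minor (_ : \col_a t (R a) 0 = (\matrix_(a, i) (R a == i)%:R) *m t).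
  rewrite last_det_linear; apply: eq_bigr => i _; congr (_ * last_det _ _).
  by apply/colP => a; rewrite !mxE eqxx andbT.
apply/colP => a; rewrite !mxE (bigD1 (R a)) //= !mxE eqxx mul1r big1 ?addr0 // => i ia.
by rewrite !mxE eq_sym (negbTE ia) mul0r.
Qed.

Lemma local_det_sum v l tau j t :
  local_det v l tau j t = \sum_i t i 0 * local_det v l tau j (delta_mx i 0).
Proof.
rewrite /local_det /=; set p := fun x : 'I_(r + 1 + 1) => Tagged (local_labels I) (mark j x) : labelled.
rewrite (_ : (\col_x (l (p x) * t (val (mark j x)) 0)) =
   (\matrix_(x, i) (l (p x) * (val (mark j x) == i)%:R)) *m t).
  rewrite last_det_linear; apply: eq_bigr => i _; congr (_ * last_det _ _).
  by apply/colP => a; rewrite !mxE eqxx andbT.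
apply/colP => a; rewrite !mxE (bigD1 (val (mark j a))) //= !mxE eqxx mulr1 big1 ?addr0 //.
by move=> i ia; rewrite !mxE eq_sym (negbTE ia) mulr0 mul0r.
Qed.

Lemma systemE v l tau R t y : (system v l tau R *m t) y 0 = system_row v l tau R y t.
Proof.
rewrite mxE /system_row; case: ifP => yr.
  rewrite (bigD1 y) //= !mxE /system_row yr !mxE !eqxx mul1r big1 ?addr0 // => i iy.
  by rewrite !mxE /system_row yr mxE eq_sym (negbTE iy) mul0r.
case: ifP => yr'.
  by rewrite lift_minor_sum; apply: eq_bigr => i _; rewrite mxE /system_row yr yr' mulrC.
case E: insub => [j|].
  by rewrite local_det_sum; apply: eq_bigr => i _; rewrite mxE /system_row yr yr' E mulrC.
by rewrite big1 // => i _; rewrite mxE /system_row yr yr' E mul0r.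
Qed.

Lemma system_kernel v l tau R t :
  system v l tau R *m t = 0 <->
  [/\ forall i : 'I_n, (i < r)%N -> t i 0 = 0, lift_minor v R t = 0 &
      forall j, local_det v l tau j t = 0].
Proof.
have rn : (r < n)%N by rewrite nk addn1 ltnS leq_addl.
split=> [/colP E|[t0 m0 d0]].
  have E' y : system_row v l tau R y t = 0 by rewrite -systemE E mxE.
  split=> [i ir||j]; first by have := E' i; rewrite /system_row ir.
    by have := E' (Ordinal rn); rewrite /system_row /= ltnn eqxx.
  (* Row r + 1 + j carries the equation of j; since n = k + r + 1, these are exactly the rows after
     row r. *)
  have jn : (r.+1 + j < n)%N by have := ltn_ord j; rewrite nk; lia.
  have c1 : (r.+1 + j < r)%N = false by lia.
  have c2 : (r.+1 + j == r)%N = false by lia.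
  have c3 : (r.+1 + j - r.+1)%N = j by lia.
  by have := E' (Ordinal jn); rewrite /system_row [val _]/= c1 c2 c3 valK.
apply/colP => y; rewrite systemE mxE /system_row; case: ifP => [/t0//|_].
by case: ifP => // _; case: insub => [j|] //; rewrite d0.
Qed.

Lemma polyfun_system (S : Type) (v : (S -> K) -> 'I_n -> 'rV[K]_r) l tau R :
  (forall i a, polyfun (fun s => v s i 0 a)) -> (forall x, polyfun (fun s => l s x)) ->
  (forall x, polyfun (fun s => tau s x)) ->
  polyfun (fun s => \det (system (v s) (l s) (tau s) R)).
Proof.
move=> pv pl pt; apply: polyfun_det => y i.
apply: (polyfun_ext (phi := fun s => system_row (v s) (l s) (tau s) R y (delta_mx i 0))).
  by move=> s; rewrite mxE.
rewrite /system_row; case: (y < r)%N; first exact: polyfun_const.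
case: (nat_of_ord y == r).
  apply: polyfun_last_det => [x a|x].
    by apply: polyfun_ext (pv (R x) a) => s; rewrite mxE.
  exact: polyfun_const.
case: (insub (y - r.+1)%N : option 'I_k) => [j|]; last exact: polyfun_const.
apply: polyfun_last_det => [x a|x].
  case: (split_ordP a) => b ->.
    apply: (polyfun_ext (phi := fun s => l s (Tagged (local_labels I) (mark j x)) * v s (val (mark j x)) 0 b)).
      by move=> s; rewrite row_mxEl !mxE.
    exact: polyfunM.
  by apply: polyfun_ext (pt _) => s; rewrite row_mxEr mxE.
apply: (polyfun_ext (phi := fun s => l s (Tagged (local_labels I) (mark j x)) *
   (delta_mx i 0 : 'cV[K]_n) (val (mark j x)) 0)).
  by move=> s; rewrite [RHS]mxE.
by apply: polyfunM => //; apply: polyfun_const.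
Qed.

Lemma local_det_eq0 v l tau j t : local_det v l tau j t = 0 ->
  exists p : 'cV[K]_r, exists b c : K, [|| p != 0, b != 0 | c != 0] /\
    forall i : local_labels I j, let x := Tagged (local_labels I) i in
      l x * (v (val i) *m p) 0 0 + b * tau x + c * (l x * t (val i) 0) = 0.
Proof.
move=> /last_det_eq0 [y [c yc E]]; exists (usubmx y), (dsubmx y 0 0), c; split.
  case/orP: yc => [y0|->]; last by rewrite !orbT.
  apply: contraNT y0; rewrite !negb_or !negbK => /and3P[/eqP u0 /eqP d0 _].
  by apply/eqP; rewrite -[LHS]vsubmxK u0 (mx11_scalar (dsubmx y)) d0 raddf0 col_mx0.
move=> i x; have [g _ gK] := mark_bij j; have zi := gK i; set z := g i in zi.
have /colP /(_ z) := E; rewrite -{1}[y]vsubmxK mul_row_col => Ez.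
have Z0 : (0 : 'cV[K]_(r + 1 + 1)) z 0 = 0 by rewrite mxE.
apply: etrans (etrans Ez Z0); rewrite [RHS]mxE [X in _ = X + _]mxE; congr (_ + _ + _).
- rewrite [RHS]mxE [X in _ * X]mxE big_distrr; apply: eq_bigr => a _ /=.
  by rewrite !mxE mulrA /x -zi.
- by rewrite [RHS]mxE big_ord1 !mxE mulrC /x -zi.
- by rewrite !mxE /x -zi.
Qed.

Lemma local_det_dep v l tau j (t : 'cV[K]_n) (p : 'cV[K]_r) c : c != 0 ->
  (forall i : local_labels I j, let x := Tagged (local_labels I) i in
     tau x = l x * (c * t (val i) 0 + (v (val i) *m p) 0 0)) ->
  local_det v l tau j t = 0.
Proof.
move=> c0 E; rewrite /local_det /=.
set A := row_mx _ _; set w := (X in last_det A X).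
suff -> : w = A *m col_mx (- c^-1 *: p) (c^-1)%:M by apply: last_det_dep.
apply/colP => x; rewrite mul_row_col [LHS]mxE [RHS]mxE [X in _ = _ + X]mxE big_ord1.
rewrite [X in _ = _ + X * _]mxE E [(c^-1)%:M _ _]mxE eqxx mulr1n.
rewrite -scalemxAr [X in _ = X + _]mxE.
set M := \matrix_x0 _.
have -> : (M *m p) x 0 = l (Tagged (local_labels I) (mark j x)) * (v (val (mark j x)) *m p) 0 0.
  rewrite !mxE big_distrr /=.
  by apply: eq_bigr => a _; rewrite !mxE mulrA.
set L := l _; set z := (_ *m p) 0 0; set y := t _ _.
by field.
Qed.

Lemma lift_minor_eq0 v R (t : 'cV[K]_n) : lift_minor v R t = 0 ->
  exists p : 'cV[K]_r, exists2 c : K, (p != 0) || (c != 0) &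
    forall a, (v (R a) *m p) 0 0 + c * t (R a) 0 = 0.
Proof.
move=> /last_det_eq0 [p [c pc E]]; exists p, c => // a.
have /colP /(_ a) Ea := E; have Z0 : (0 : 'cV[K]_(r + 1)) a 0 = 0 by rewrite mxE.
apply: etrans (etrans Ea Z0); rewrite [RHS]mxE; congr (_ + _); last by rewrite !mxE.
by rewrite !mxE; apply: eq_bigr => b _; rewrite !mxE.
Qed.

End System.

Lemma det_neq0_ker (K : fieldType) m (A : 'M[K]_m) :
  (forall t : 'cV[K]_m, A *m t = 0 -> t = 0)%R -> (\det A != 0)%R.
Proof.
move=> H; rewrite -det_tr; apply/negP => /det0P [u u0 uA].
move/eqP: u0; apply; apply: trmx_inj; rewrite trmx0; apply: H.
by rewrite -[A]trmxK -trmx_mul uA trmx0.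
Qed.

Lemma separate_line (K : fieldType) n (e c : 'rV[K]_n) : c \notin <[e]>%VS ->
  exists2 t : 'cV[K]_n, (e *m t = 0)%R & (c *m t != 0)%R.
Proof.
move=> ce; have : ~~ (c <= e)%MS.
  by apply: contra ce => /sub_rVP [a ->]; apply: memvZ; apply: memv_line.
rewrite submxE => /matrix0Pn [i [j ij]]; exists (col j (cokermx e)).
  by rewrite colE mulmxA mulmx_coker mul0mx.
apply: contraNneq ij; rewrite colE mulmxA -colE => /colP /(_ i).
by rewrite [X in X = _ -> _]mxE => ->; rewrite mxE.
Qed.

(** * A point where the system is invertible *)

Section GoodLocus.
Local Open Scope ring_scope.
Variables (K : fieldType) (r n k : nat) (I : 'I_k -> {set 'I_n}).
Hypothesis charK : [pchar K] =i pred0.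
Hypothesis r2 : (2 <= r)%N.
Hypothesis nk : n = (k + r + 1)%N.
Hypothesis hI : forall j, #|I j| = (r + 2)%N.
Variable base : forall j, local_labels I j.
Variable mark : forall j, 'I_(r + 1 + 1) -> local_labels I j.
Hypothesis mark_bij : forall j, bijective (@mark j).

Notation labelled := {j : 'I_k & local_labels I j}.
Notation vx := (@param_vectors K r n k I base (@parameter_default K r n k I)).
Notation gx := (@param_matrix K r n k I base (@parameter_default K r n k I)).
Notation lx := (@param_scale K r n k I base (@parameter_default K r n k I)).

Let rn' : (r <= #|'I_n|)%N. Proof. by rewrite card_ord nk; lia. Qed.

Let rn : (r <= n)%N. Proof. by rewrite nk; lia. Qed.

Lemma first_ker (v : 'I_n -> 'rV[K]_r) (p : 'cV[K]_r) : general v ->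
  (forall i : 'I_n, (i < r)%N -> (v i *m p) 0 0 = 0) -> p = 0.
Proof.
move=> gv H; apply: (general_ker gv (f := widen_ord rn)).
  by move=> a b /(congr1 val) /= /val_inj.
move=> a; apply/matrixP => x y; rewrite !ord1 H ?mxE //=.
Qed.

Lemma local_ker (v : 'I_n -> 'rV[K]_r) (p : 'cV[K]_r) j : general v ->
  (forall i, i \in I j -> (v i *m p) 0 0 = 0) -> p = 0.
Proof.
move=> gv H; have lr : (r <= r + 1 + 1)%N by lia.
have [g mg gm] := mark_bij j.
apply: (general_ker gv (f := fun a => val (mark j (widen_ord lr a)))).
  by move=> a b /val_inj /(can_inj mg) /(congr1 val) /= /val_inj.
move=> a; apply/matrixP => x y; rewrite !ord1 H ?mxE //.
exact: (valP (mark j (widen_ord lr a))).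
Qed.

Lemma minor_ker (v : 'I_n -> 'rV[K]_r) (p : 'cV[K]_r) (R : 'I_(r + 1) -> 'I_n) :
  general v -> injective R -> (forall a, (v (R a) *m p) 0 0 = 0) -> p = 0.
Proof.
move=> gv Rinj H; apply: (general_ker gv (f := fun a => R (widen_ord (leq_addr 1 r) a))).
  by move=> a b /Rinj /(congr1 val) /= /val_inj.
by move=> a; apply/matrixP => x y; rewrite !ord1 H mxE.
Qed.

(** The r + 1 vectors [v (R a)] have a nontrivial relation [c]. If the minor vanishes, [t] agrees on
    [R] with a linear form, as generality excludes a dependence between the coordinates of [v]
    alone, and [c] kills linear forms. *)
Lemma minor_relation (v : 'I_n -> 'rV[K]_r) (R : 'I_(r + 1) -> 'I_n) : injective R ->
  general v ->
  exists c : 'rV[K]_n, [/\ c != 0, c \in relations (\matrix_i v i) &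
    forall t, lift_minor v R t = 0 -> c *m t = 0].
Proof.
move=> Rinj gv; have : kermx (\matrix_a v (R a)) != 0.
  rewrite kermx_eq0 /row_free neq_ltn; apply/orP; left.
  by apply: leq_ltn_trans (rank_leq_col _) _; rewrite addn1.
move/rowV0Pn => [y /sub_kermxP yR y0].
pose c : 'rV[K]_n := \sum_a y 0 a *: delta_mx 0 (R a).
have cE m (B : 'M[K]_(n, m)) : c *m B = \sum_a y 0 a *: row (R a) B.
  by rewrite mulmx_suml; apply: eq_bigr => a _; rewrite -scalemxAl -rowE.
exists c; split.
- apply: contraNneq y0 => c0; apply/eqP/rowP => a; rewrite mxE.
  have : c 0 (R a) = 0 by rewrite c0 mxE.
  rewrite summxE (bigD1 a) //= !mxE !eqxx mulr1 big1 ?addr0 // => b ba.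
  by rewrite !mxE eqxx /= (inj_eq Rinj) eq_sym (negbTE ba) mulr0.
- rewrite mem_relations cE; apply/eqP; apply: etrans yR; rewrite mulmx_sum_row.
  by apply: eq_bigr => a _; rewrite !rowK.
move=> t /lift_minor_eq0 [p [b pb E]].
have b0 : b != 0.
  apply: contraTneq pb => b0; rewrite b0 eqxx orbF negbK; apply/eqP.
  by apply: (minor_ker gv Rinj) => a; have := E a; rewrite b0 mul0r addr0.
apply/matrixP => x z; rewrite !ord1 cE summxE mxE.
apply: (mulfI b0); rewrite mulr0 big_distrr /=.
have yp : \sum_a y 0 a * (v (R a) *m p) 0 0 = 0.
  have : (y *m ((\matrix_a v (R a)) *m p)) 0 0 = 0 by rewrite mulmxA yR mul0mx mxE.
  rewrite mxE => E'; rewrite -[RHS]E'; apply: eq_bigr => a _; congr (_ * _).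
  by rewrite !mxE; apply: eq_bigr => d _; rewrite !mxE.
rewrite -[RHS]oppr0 -[X in - X]yp -sumrN; apply: eq_bigr => a _.
have -> : (y 0 a *: row (R a) t) 0 0 = y 0 a * t (R a) 0 by rewrite !mxE.
rewrite mulrCA -mulrN; congr (_ * _).
by apply/eqP; rewrite -addr_eq0 addrC E.
Qed.

(** The relation [c] of [minor_relation] is completed by local relations [e j] as in
    [local_relations_span], and [tau] is chosen so that the equation of j implies e_j . t = 0. A
    kernel vector [t] is then given by a linear form, which the normalization on the first r points
    makes zero. *)
Lemma system_nonzero (R : 'I_(r + 1) -> 'I_n) : injective R -> poly_dominant K r I ->
  exists s tau, \det (system mark (vx s) (lx s) tau R) != 0.
Proof.
move=> Rinj dom.
have [s [gv _ l0 star]] := dominant_cotangent_independent charK r2 nk hI base dom.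
set v := vx s in gv star; set V := \matrix_i v i in star.
have rV : \rank V = r.
  rewrite -mxrank_tr; apply/eqP; rewrite -/(row_free _) -kermx_eq0; apply/rowV0P => u.
  move=> /sub_kermxP uV; apply: trmx_inj; rewrite trmx0; apply: (first_ker gv) => i _.
  have : (V *m u^T) i 0 = 0 by rewrite -[V]trmxK -trmx_mul uV trmx0 mxE.
  by move=> E; rewrite -[RHS]E !mxE; apply: eq_bigr => a _; rewrite !mxE.
have rowV0 i : row i V != 0 by rewrite rowK; apply: (general_neq0 rn' r2 i gv).
have rowV_sep i i' : i != i' -> exists2 a : 'cV[K]_r, row i V *m a = 0 & row i' V *m a != 0.
  by rewrite !rowK; apply: general_sep.
have [c [c0 crel cP]] := minor_relation Rinj gv.
have [e eE eP] := local_relations_span charK r2 hI rowV0 rowV_sep star nk rV crel c0.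
have /choice [T TP] : forall j, exists T : 'cV[K]_n * 'rV[K]_n,
    [/\ T.2 \in local_relations V I j, e j *m T.1 = 0 & T.2 *m T.1 != 0].
  (* By [hall] the local relations have dimension at least 2, so one of them, [d], is no multiple of
     [e j]; some column kills [e j] but not [d]. *)
  move=> j; have := hall charK r2 hI rowV0 rowV_sep (S := [set j]%SET) star.
  rewrite finset.big_set1 cards1 -card_gt0 cards1 => /(_ isT) dj.
  have /subvPn [d dj' de] : ~~ (local_relations V I j <= <[e j]>)%VS.
    apply/negP => /dimvS; rewrite dim_vline leqNgt => /negP; apply.
    by apply: leq_trans dj; rewrite ltnS leq_b1.
  by have [t et dt] := separate_line de; exists (t, d).
pose tau (x : labelled) := lx s x * (T (tag x)).1 (val (tagged x)) 0.
exists s, tau; apply: det_neq0_ker => t /(system_kernel r2 nk) [t0 tR tj].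
have ct := cP t tR.
have et j : e j *m t = 0.
  have [p [b [a [pba E]]]] := local_det_eq0 mark_bij (tj j).
  have [dE eT dT] := TP j.
  (* Pairing the dependence with a local relation removes the linear form [p]. *)
  have H (d : 'rV[K]_n) : d \in local_relations V I j -> b *: (d *m (T j).1) + a *: (d *m t) = 0.
    rewrite memv_cap mem_relations => /andP[/eqP dV /mem_supported ds].
    have -> : b *: (d *m (T j).1) + a *: (d *m t) = d *m (V *m p + b *: (T j).1 + a *: t).
      by rewrite !mulmxDr mulmxA dV mul0mx add0r -!scalemxAr.
    apply/matrixP => x y; rewrite !ord1 mxE [RHS]mxE big1 // => i _.
    have [iI|/ds ->] := boolP (i \in I j); last by rewrite mul0r.
    apply/eqP; rewrite mulf_eq0; apply/orP; right; apply/eqP.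
    have := E (Sub i iI : local_labels I j); rewrite /= /tau /=.
    set L := lx s _ => E'; apply: (mulfI (l0 (Tagged (local_labels I) (Sub i iI : local_labels I j)))).
    rewrite -/L mulr0 -E' !mxE !mulrDr [in RHS]mulrCA; congr (_ + _ + _).
      by congr (_ * _); apply: eq_bigr => z _; rewrite !mxE.
    by rewrite mulrCA.
  have a0 : a != 0.
    apply: contraTneq pba => a0; rewrite a0 eqxx orbF negb_or !negbK.
    have /eqP b0 : b == 0.
      have /eqP := H _ dE; rewrite a0 scale0r addr0 scaler_eq0.
      by rewrite (negbTE dT) orbF.
    rewrite b0 eqxx andbT; apply/eqP/(local_ker gv (j := j)) => i iI.
    have := E (Sub i iI : local_labels I j); rewrite /= a0 b0 !mul0r !addr0 => /eqP.
    by rewrite mulf_eq0 (negbTE (l0 _)) => /eqP.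
  have /eqP := H _ (eE j); rewrite eT scaler0 add0r scaler_eq0 (negbTE a0) /=.
  by move/eqP.
have [p tE] := eP t ct et.
rewrite tE (_ : p = 0) ?mulmx0 //; apply: (first_ker gv) => i ir.
have := t0 i ir; rewrite tE => E; rewrite -[RHS]E !mxE.
by apply: eq_bigr => a _; rewrite !mxE.
Qed.

End GoodLocus.

(** * Cones, for the whole set of labels and for each I_j alike *)

Section Cone.
Local Open Scope ring_scope.
Variables (K : fieldType) (r : nat) (X X' : finType) (src : X' -> option X).
Variable tgt : option X -> X'.
Hypothesis srcK : cancel src tgt.
Hypothesis tgtK : cancel tgt src.
Implicit Types (v w : X -> 'rV[K]_r) (t u : X -> K).

(* The configuration of which v is the projection from the point tgt None.     *)
Definition cone v t (x : X') : 'rV[K]_r.+1 :=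
  if src x is Some i then row_mx (t i)%:M (v i) : 'rV[K]_(1 + r)
  else row_mx 1 0 : 'rV[K]_(1 + r).

Lemma cone_some v t i : cone v t (tgt (Some i)) = row_mx (t i)%:M (v i).
Proof. by rewrite /cone tgtK. Qed.

Lemma cone_none v t : cone v t (tgt None) = row_mx 1 0.
Proof. by rewrite /cone tgtK. Qed.

(** A matrix fixing the line of the apex is block triangular: the diagonal blocks [c] and [g] scale
    [t] and transform the projection, and the remaining block [p] adds a linear form to the extra
    coordinates. *)
Lemma cone_equiv v t w u : proj_equiv (cone v t) (cone w u) <->
  exists g : 'M[K]_r, exists l : X -> K, exists c : K, exists p : 'cV[K]_r,
    [/\ g \in unitmx, forall i, l i != 0, c != 0 &
        forall i, w i = l i *: (v i *m g) /\ u i = l i * (c * t i + (v i *m p) 0 0)].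
Proof.
split=> [[A [l [uA l0 E]]]|[g [l [c [p [ug l0 c0 E]]]]]].
- pose B : 'M[K]_(1 + r) := A.
  have mulB (a : 'M[K]_1) (b : 'rV[K]_r) : row_mx a b *m B =
      row_mx (a *m ulsubmx B + b *m dlsubmx B) (a *m ursubmx B + b *m drsubmx B).
    by rewrite -mul_row_block submxK.
  have E' x : (cone w u x : 'rV[K]_(1 + r)) = l x *: ((cone v t x : 'rV[K]_(1 + r)) *m B) := E x.
  have := E' (tgt None); rewrite !cone_none mulB.
  rewrite !mul1mx !mul0mx !addr0 scale_row_mx => /eq_row_mx [ul ur].
  have ur0 : ursubmx B = 0.
    by apply: (scalerI (l0 (tgt None))); rewrite -ur scaler0.
  pose c := ulsubmx B 0 0.
  have ulE : ulsubmx B = c%:M by apply: mx11_scalar.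
  have uB : B \in unitmx by [].
  have : (c != 0) && (drsubmx B \in unitmx).
    move: uB; rewrite unitmxE -{1}[B]submxK ur0 det_lblock ulE det_scalar1 unitrM unitfE.
    by rewrite -unitmxE.
  move=> /andP[c0 ug].
  exists (drsubmx B), (fun i => l (tgt (Some i))), c, (dlsubmx B); split=> // i.
  have := E' (tgt (Some i)); rewrite !cone_some mulB scale_row_mx.
  rewrite ur0 mulmx0 add0r ulE => /eq_row_mx [uE ->]; split=> //.
  have := congr1 (fun M : 'M[K]_1 => M 0 0) uE.
  rewrite -scalar_mxM mxE eqxx mulr1n => ->; rewrite mxE; congr (_ * _).
  by rewrite mxE; congr (_ + _); rewrite mxE eqxx mulr1n mulrC.
- pose B : 'M[K]_(1 + r) := block_mx c%:M 0 p g.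
  have uB : B \in unitmx.
    by rewrite unitmxE det_lblock det_scalar1 unitrM unitfE c0 -unitmxE.
  pose L x := if src x is Some i then l i else c^-1.
  suff E' x : (cone w u x : 'rV[K]_(1 + r)) = L x *: ((cone v t x : 'rV[K]_(1 + r)) *m B).
    exists B, L; split=> // x; rewrite /L.
    by case: (src x) => [i|]; rewrite ?invr_eq0.
  rewrite /L -[x]srcK tgtK; case: (src x) => [i|].
    rewrite !cone_some mul_row_block scale_row_mx mulmx0 add0r.
    have [-> ->] := E i; congr row_mx; apply/matrixP => a b.
    rewrite !ord1 -scalar_mxM [LHS]mxE eqxx mulr1n [RHS]mxE; congr (_ * _).
    by rewrite [RHS]mxE; congr (_ + _); rewrite mxE eqxx mulr1n mulrC.
  rewrite !cone_none mul_row_block scale_row_mx !mul1mx !mul0mx !addr0 scaler0.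
  by rewrite scale_scalar_mx mulVf.
Qed.

(** Minors through the apex reduce to minors of [v], and the others are the determinants on [R].
    Vanishing is read off from a kernel vector, split into a scalar [c] and a column [p]. *)
Lemma general_coneP v t : general (cone v t) <->
  general v /\ forall R : 'I_(r + 1) -> X, injective R ->
    last_det (\matrix_a v (R a)) (\col_a t (R a)) != 0.
Proof.
have ker (f : 'I_r.+1 -> X') (c : K) (p : 'cV[K]_r) : (c != 0) || (p != 0) ->
    (forall a, (cone v t (f a) : 'rV[K]_(1 + r)) *m (col_mx c%:M p : 'cV[K]_(1 + r)) = 0) -> minor (cone v t) f = 0.
  move=> cp H; apply/eqP; rewrite /minor -det_tr; apply/det0P.
  exists (col_mx c%:M p : 'cV[K]_(1 + r))^T.
    rewrite -trmx0 (inj_eq trmx_inj); apply: contraTneq cp => cp0.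
    have [cE ->] := eq_col_mx (etrans cp0 (esym (@col_mx0 K 1 r 1)) :
      col_mx c%:M p = col_mx 0 0 :> 'cV[K]_(1 + r)).
    rewrite eqxx orbF negbK; have /matrixP /(_ 0 0) := cE.
    by rewrite !mxE eqxx mulr1n => ->.
  rewrite -trmx_mul -trmx0; congr trmx; apply/row_matrixP => a.
  by rewrite row_mul rowK row0 H.
split=> [gc|[gv gR] f finj].
  split=> [f finj|R Rinj].
    rewrite /minor -det_tr; apply/negP => /det0P [y y0 yA].
    pose f' (a : 'I_r.+1) : X' := if unlift ord0 a is Some b then tgt (Some (f b)) else tgt None.
    have f'inj : injective f'.
      move=> a b; rewrite /f'; case: unliftP => [a'|] ->; case: unliftP => [b'|] -> //.
      - by move/(can_inj tgtK) => [] /finj ->.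
      - by move/(can_inj tgtK).
      - by move/(can_inj tgtK).
    have /eqP := gc f' f'inj; apply; apply: (ker f' 0 y^T).
      by rewrite -trmx0 (inj_eq trmx_inj) y0 orbT.
    move=> a; rewrite /f'; case: unliftP => [b|] _.
      rewrite cone_some mul_row_col mul_mx_scalar scale0r add0r.
      have := congr1 trmx yA; rewrite trmx_mul trmxK trmx0 => /row_matrixP /(_ b).
      by rewrite row_mul rowK row0.
    by rewrite cone_none mul_row_col mul1mx mul0mx addr0 raddf0.
  apply/negP => /eqP /last_det_eq0 [p [c pc E]].
  have f'inj : injective (fun a => tgt (Some (R (cast_ord (esym (addn1 r)) a)))).
    by move=> a b /(can_inj tgtK) [] /Rinj /cast_ord_inj.
  have /eqP := gc _ f'inj; apply.
  apply: (ker _ c p); first by rewrite orbC.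
  move=> a; set b := cast_ord _ a; rewrite cone_some mul_row_col.
  apply/matrixP => x y; rewrite !ord1 -scalar_mxM.
  have /colP /(_ b) Eb := E; apply: etrans (etrans Eb _); last by rewrite !mxE.
  rewrite mxE [RHS]mxE addrC; congr (_ + _).
    by rewrite !mxE; apply: eq_bigr => z _; rewrite !mxE.
  by rewrite !mxE eqxx mulr1n mulrC.
rewrite /minor -det_tr; apply/negP => /det0P [z z0 zA].
pose y : 'cV[K]_(1 + r) := z^T.
have yf a : (cone v t (f a) : 'rV[K]_(1 + r)) *m y = 0.
  have := congr1 trmx zA; rewrite trmx_mul trmxK trmx0 => /row_matrixP /(_ a).
  by rewrite row_mul rowK row0.
pose c := usubmx y 0 0; pose p := dsubmx y.
have yE : y = col_mx c%:M p by rewrite -[LHS]vsubmxK [usubmx y]mx11_scalar.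
have y0 : y != 0 by rewrite -trmx0 (inj_eq trmx_inj).
have [[a0 fa0]|allS] := pselect (exists a0, src (f a0) = None).
  have c0 : c = 0.
    have := yf a0; rewrite /cone fa0 yE mul_row_col mul1mx mul0mx addr0.
    by move=> /matrixP /(_ 0 0); rewrite !mxE eqxx mulr1n.
  have /choice [R RE] : forall a, exists i, src (f (lift a0 a)) = Some i.
    move=> a; case E: (src (f (lift a0 a))) => [i|]; first by exists i.
    have /finj/eqP : f a0 = f (lift a0 a) by apply: (can_inj srcK); rewrite fa0 E.
    by rewrite (negbTE (neq_lift _ _)).
  have p0 : p = 0.
    apply: (general_ker gv (f := R)) => [a b Rab|a].
      have : f (lift a0 a) = f (lift a0 b) by apply: (can_inj srcK); rewrite !RE Rab.
      by move/finj/lift_inj.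
    have := yf (lift a0 a); rewrite /cone RE yE mul_row_col c0.
    by rewrite mul_mx_scalar scale0r add0r.
  by move: y0; rewrite yE c0 p0 raddf0 col_mx0 eqxx.
have /choice [R RE] : forall a, exists i, src (f a) = Some i.
  by move=> a; case E: (src (f a)) => [i|]; [exists i | case: allS; exists a].
have Rinj : injective (fun a => R (cast_ord (addn1 r) a)).
  move=> a b Rab; have : f (cast_ord (addn1 r) a) = f (cast_ord (addn1 r) b).
    by apply: (can_inj srcK); rewrite !RE Rab.
  by move/finj/cast_ord_inj.
have /eqP := gR _ Rinj; apply.
have [c0|c0] := eqVneq c 0.
  have p0 : p = 0.
    apply: (general_ker gv (f := fun a => R (widen_ord (leqnSn r) a))) => [a b Rab|a].
      have : f (widen_ord (leqnSn r) a) = f (widen_ord (leqnSn r) b).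
        by apply: (can_inj srcK); rewrite !RE Rab.
      by move/finj/(congr1 val) => /= /val_inj.
    have := yf (widen_ord (leqnSn r) a); rewrite /cone RE yE mul_row_col c0.
    by rewrite mul_mx_scalar scale0r add0r.
  by move: y0; rewrite yE c0 p0 raddf0 col_mx0 eqxx.
apply: (last_det_comb c0 (p := p)) => a.
have := yf (cast_ord (addn1 r) a); rewrite /cone RE yE mul_row_col -scalar_mxM.
have addE (A B : 'M[K]_1) : (A + B) 0 0 = A 0 0 + B 0 0 by rewrite mxE.
have scalE (e : K) : (e%:M : 'M[K]_1) 0 0 = e by rewrite mxE eqxx mulr1n.
have zeroE : (0 : 'M[K]_1) 0 0 = 0 by rewrite mxE.
by move=> /matrixP /(_ 0 0); rewrite addE scalE zeroE mulrC addrC.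
Qed.

Lemma cone_exists (w : X' -> 'rV[K]_r.+1) : w (tgt None) != 0 ->
  exists v, exists t, proj_equiv w (cone v t).
Proof.
move=> w0; set y := w (tgt None) in w0.
pose A := invmx (row_ebase y).
have yA : y *m A = col_ebase y 0 0 *: pid_mx 1.
  rewrite -{1}[y]mulmx_ebase rank_rV w0 /A mulmxK ?row_ebase_unit //.
  by rewrite {1}[col_ebase y]mx11_scalar mul_scalar_mx.
have d0 : col_ebase y 0 0 != 0.
  have := col_ebase_unit y; rewrite unitmxE {1}[col_ebase y]mx11_scalar det_scalar1.
  by rewrite unitfE.
exists (fun i => rsubmx (w (tgt (Some i)) *m A : 'rV[K]_(1 + r))).
exists (fun i => lsubmx (w (tgt (Some i)) *m A : 'rV[K]_(1 + r)) 0 0).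
exists A, (fun x => if src x is Some _ then 1 else (col_ebase y 0 0)^-1); split.
- by rewrite unitmx_inv row_ebase_unit.
- by move=> x; case: (src x); rewrite ?oner_eq0 ?invr_eq0.
move=> x; rewrite -[x]srcK tgtK; case: (src x) => [i|].
  by rewrite cone_some scale1r -mx11_scalar hsubmxK.
rewrite cone_none -/y yA scalerA mulVf // scale1r.
exact: esym (pid_mx_row K r 1).
Qed.

End Cone.

(** * Labels with the appended marking *)

Section Labels.
Variables (n k : nat) (I : 'I_k -> {set 'I_n}).

Lemma mem_append_lift j (i : 'I_n) : (lift ord_max i \in append_marking I j) = (i \in I j).
Proof.
have E (i' : 'I_n) : widen_ord (leqnSn n) i' = lift ord_max i'.
  by apply/val_inj/esym/lift_max.
rewrite finset.in_setU1 eq_sym (negbTE (neq_lift _ _)) /= -E finset.mem_imset //.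
by move=> a b /(congr1 val) /= /val_inj.
Qed.

Lemma mem_append_max j : ord_max \in append_marking I j.
Proof. by rewrite !inE eqxx. Qed.

Definition label_src (x : 'I_n.+1) : option 'I_n := unlift ord_max x.
Definition label_tgt (o : option 'I_n) : 'I_n.+1 :=
  if o is Some i then lift ord_max i else ord_max.

Lemma label_srcK : cancel label_src label_tgt.
Proof. by move=> x; rewrite /label_src; case: unliftP => [i ->|->]. Qed.

Lemma label_tgtK : cancel label_tgt label_src.
Proof. by case=> [i|]; rewrite /label_src /= ?liftK ?unlift_none. Qed.

Definition local_src j (x : local_labels (append_marking I) j) : option (local_labels I j) :=
  obind insub (label_src (val x)).

Definition local_tgt j (o : option (local_labels I j)) : local_labels (append_marking I) j :=
  match o with
  | Some i => exist _ (lift ord_max (val i)) (etrans (mem_append_lift j (val i)) (valP i))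
  | None => exist _ ord_max (mem_append_max j)
  end.

Lemma local_srcE j (x : local_labels (append_marking I) j) :
  label_src (val x) = omap val (local_src x).
Proof.
rewrite /local_src; have := valP x; rewrite /label_src.
case: unliftP => [i ->|->] //=; rewrite mem_append_lift => iI.
by rewrite insubT.
Qed.

Lemma local_srcK j : cancel (@local_src j) (@local_tgt j).
Proof.
move=> x; apply/val_inj; rewrite -[RHS]label_srcK local_srcE.
by case: (local_src x).
Qed.

Lemma local_tgtK j : cancel (@local_tgt j) (@local_src j).
Proof.
move=> o; apply: (@inj_omap _ _ (val : local_labels I j -> 'I_n)); first exact: val_inj.
by rewrite -local_srcE; case: o => [i|]; rewrite /= /label_src ?liftK ?unlift_none.
Qed.

Lemma card_append j : #|append_marking I j| = #|I j|.+1.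
Proof.
have E : #|local_labels (append_marking I) j| = #|{: option (local_labels I j)}|.
  exact: bij_eq_card (Bijective (@local_srcK j) (@local_tgtK j)).
have cE m (J : {set 'I_m}) : #|labels J| = #|J| by rewrite card_sig; apply: eq_card.
by move: E; rewrite card_option !cE.
Qed.

End Labels.

(** * Lifted configurations and lifted families *)

Section Lift.
Local Open Scope ring_scope.
Local Open Scope classical_set_scope.
Variables (K : fieldType) (r n k : nat) (I : 'I_k -> {set 'I_n}).
Hypothesis charK : [pchar K]%R =i pred0.
Hypothesis r2 : (2 <= r)%N.
Hypothesis nk : n = (k + r + 1)%N.
Hypothesis hI : forall j, #|I j| = (r + 2)%N.

Notation labelled := {j : 'I_k & local_labels I j}.

Definition lift_config (v : 'I_n -> 'rV[K]_r) (t : 'I_n -> K) : 'I_n.+1 -> 'rV[K]_r.+1 :=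
  cone (@label_src n) v t.

Definition lift_local (q : local_vectors K r I) (tau : labelled -> K) :
    local_vectors K r.+1 (append_marking I) :=
  fun x => cone (@local_src n k I (tag x)) (block q (tag x))
    (fun i => tau (Tagged (local_labels I) i)) (tagged x).

Lemma block_lift q tau j : block (lift_local q tau) j =
  cone (@local_src n k I j) (block q j) (fun i => tau (Tagged (local_labels I) i)).
Proof. by []. Qed.

Lemma restrict_lift v t j :
  (fun x : local_labels (append_marking I) j => lift_config v t (val x)) =
  cone (@local_src n k I j) (fun i => v (val i)) (fun i => t (val i)).
Proof.
apply/funext => x; rewrite /lift_config /cone local_srcE.
by case: (local_src x).
Qed.

Lemma lies_over_lift v t q tau :
  lies_over (lift_config v t) (lift_local q tau) <->
  forall j, exists g : 'M[K]_r, exists l : local_labels I j -> K, exists c : K,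
    exists p : 'cV[K]_r,
    [/\ g \in unitmx, forall i, l i != 0, c != 0 &
        forall i, block q j i = l i *: (v (val i) *m g) /\
          tau (Tagged (local_labels I) i) = l i * (c * t (val i) + (v (val i) *m p) 0 0)].
Proof.
by split=> H j; have := H j; rewrite restrict_lift block_lift => /(cone_equiv (@local_srcK n k I j) (@local_tgtK n k I j)).
Qed.

Lemma lies_over_drop v t q tau :
  lies_over (lift_config v t) (lift_local q tau) -> lies_over v q.
Proof.
move=> /lies_over_lift H j; have [g [l [c [p [ug l0 c0 E]]]]] := H j.
by exists g, l; split=> // i; have [] := E i.
Qed.

Lemma lies_over_trans (v w : 'I_n -> 'rV[K]_r) (q : local_vectors K r I) : proj_equiv v w -> lies_over v q -> lies_over w q.
Proof.
move=> vw vq j; apply: proj_equiv_trans (vq j); apply: proj_equiv_sym.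
by have [B [m [uB m0 mE]]] := vw; exists B, (fun i => m (val i)); split.
Qed.

Lemma general_lift v t : general (lift_config v t) <->
  general v /\ forall R : 'I_(r + 1) -> 'I_n, injective R -> lift_minor v R (\col_i t i) != 0.
Proof.
have E R : lift_minor v R (\col_i t i) = last_det (\matrix_a v (R a)) (\col_a t (R a)).
  by congr last_det; apply/colP => a; rewrite !mxE.
split=> [/(general_coneP (@label_srcK n) (@label_tgtK n) v t) [gv gR]|[gv gR]].
  by split=> // R /gR; rewrite E.
apply/(general_coneP (@label_srcK n) (@label_tgtK n) v t); split=> // R /gR.
by rewrite E.
Qed.

Lemma lift_config_equiv v t w u : proj_equiv (lift_config v t) (lift_config w u) <->
  exists g : 'M[K]_r, exists l : 'I_n -> K, exists c : K, exists p : 'cV[K]_r,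
    [/\ g \in unitmx, forall i, l i != 0, c != 0 &
        forall i, w i = l i *: (v i *m g) /\ u i = l i * (c * t i + (v i *m p) 0 0)].
Proof. exact: (cone_equiv (@label_srcK n) (@label_tgtK n)). Qed.

(* The v i are eigenvectors of A B^-1, and a linear relation between r + 1 of    *)
(* them has no zero coefficient, so the eigenvalues agree.                     *)
Lemma frame_unique (X : finType) (v : X -> 'rV[K]_r) (A B : 'M[K]_r) (l m : X -> K) :
  (r + 1 <= #|X|)%N -> general v -> A \in unitmx -> B \in unitmx ->
  (forall i, l i != 0) -> (forall i, m i != 0) ->
  (forall i, l i *: (v i *m A) = m i *: (v i *m B)) ->
  forall i j, m i / l i = m j / l j.
Proof.
move=> rX gv uA uB l0 m0 E.
pose C := A *m invmx B; pose a i := m i / l i.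
have vC i : v i *m C = a i *: v i.
  apply: (scalerI (l0 i)); rewrite scalerA /a mulrC divfK // /C mulmxA.
  by rewrite scalemxAl E -scalemxAl mulmxK.
have rX' : (r <= #|X|)%N by lia.
suff H i j : i != j -> a i = a j.
  by move=> i j; case: (eqVneq i j) => [->|/H].
move=> ij.
have r1 : (r + 1 <= #|X|)%N by [].
pose g2 (x : 'I_2) : X := if x == ord0 then i else j.
have g2inj : injective g2.
  move=> [[|[|x]] // px] [[|[|y]] // py] //=; rewrite /g2 /= => F; apply/val_inj => //=.
    by rewrite F eqxx in ij.
  by rewrite F eqxx in ij.
have le2 : (2 <= r + 1)%N by lia.
have [f finj fE] := extend_injection le2 r1 g2inj.
have : kermx (\matrix_x v (f x)) != 0.
  rewrite kermx_eq0 /row_free neq_ltn; apply/orP; left.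
  by apply: leq_ltn_trans (rank_leq_col _) _; rewrite addn1.
move/rowV0Pn => [y /sub_kermxP yR y0].
have sy : \sum_x y 0 x *: v (f x) = 0.
  by rewrite -[RHS]yR mulmx_sum_row; apply: eq_bigr => x _; rewrite rowK.
have drop x (z : 'I_(r + 1) -> K) : \sum_w z w *: v (f w) = 0 -> z x = 0 ->
    forall w, z w = 0.
  move=> zs zx w; have [->//|wx] := eqVneq w x.
  pose h (b : 'I_r) : 'I_(r + 1) := cast_ord (esym (addn1 r)) (lift (cast_ord (addn1 r) x) b).
  have hinj : injective h by move=> b c /cast_ord_inj /lift_inj.
  have hs : \sum_b z (h b) *: v (f (h b)) = 0.
    rewrite -[RHS]zs [RHS](bigD1 x) //= zx scale0r add0r.
    rewrite [RHS](reindex_onto h (fun z => if unlift (cast_ord (addn1 r) x) (cast_ord (addn1 r) z) is Some b then b else Ordinal (ltnW r2))) /=.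
      apply: eq_bigl => b; rewrite /h cast_ordKV liftK eqxx andbT.
      by apply/esym/negP => /eqP /(congr1 (cast_ord (addn1 r))); rewrite cast_ordKV => /eqP; rewrite eq_sym (negbTE (neq_lift _ _)).
    move=> b bx; case: unliftP => [b'|] bE.
      by rewrite /h -bE cast_ordK.
    by case/negP: bx; apply/eqP/(can_inj (cast_ordK (addn1 r))).
  have fhinj : injective (fun b => f (h b)) by move=> b c /finj /hinj.
  have := general_indep rX' gv (leqnn r) fhinj hs.
  case: (unliftP (cast_ord (addn1 r) x) (cast_ord (addn1 r) w)) => [b|] wE H.
    by have := H b; rewrite /h -wE cast_ordK.
  by case/negP: wx; apply/eqP/(can_inj (cast_ordK (addn1 r))).
have ynz x : y 0 x != 0.
  apply: contraNneq y0 => yx; apply/eqP/rowP => z; rewrite mxE.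
  exact: (drop x (fun w => y 0 w)).
(* Applying C - a_i to the relation [y] gives a relation with zero coefficient at i, which is
   trivial by [drop]. *)
have key : \sum_x (y 0 x * (a (f x) - a i)) *: v (f x) = 0.
  have E1 : \sum_x (y 0 x * a (f x)) *: v (f x) = 0.
    have := congr1 (mulmx^~ C) sy; rewrite /= mul0mx mulmx_suml => E1; rewrite -[RHS]E1.
    by apply: eq_bigr => x _; rewrite -scalemxAl vC scalerA.
  have E2 : \sum_x (y 0 x * a i) *: v (f x) = 0.
    rewrite -[RHS](scaler0 _ (a i)) -[in RHS]sy scaler_sumr; apply: eq_bigr => x _.
    by rewrite scalerA mulrC.
  rewrite (eq_bigr (fun x => (y 0 x * a (f x)) *: v (f x) - (y 0 x * a i) *: v (f x))).
    by rewrite sumrB E1 E2 subr0.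
  by move=> x _; rewrite mulrBr scalerBl.
have fx0 : f (widen_ord le2 ord0) = i by rewrite fE.
have fx1 : f (widen_ord le2 (lift ord0 ord0)) = j by rewrite fE.
have x0 : y 0 (widen_ord le2 ord0) * (a (f (widen_ord le2 ord0)) - a i) = 0.
  by rewrite fx0 subrr mulr0.
have /eqP := drop _ _ key x0 (widen_ord le2 (lift ord0 ord0)).
by rewrite fx1 mulf_eq0 (negbTE (ynz _)) subr_eq0 => /eqP.
Qed.

End Lift.

(** * The bijection between the fibres *)

Section Fibres.
Local Open Scope ring_scope.
Local Open Scope classical_set_scope.
Local Open Scope card_scope.
Variables (K : fieldType) (r n k : nat) (I : 'I_k -> {set 'I_n}).
Hypothesis charK : [pchar K]%R =i pred0.
Hypothesis r2 : (2 <= r)%N.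
Hypothesis nk : n = (k + r + 1)%N.
Hypothesis hI : forall j, #|I j| = (r + 2)%N.
Variable base : forall j, local_labels I j.
Variable mark : forall j, 'I_(r + 1 + 1) -> local_labels I j.
Hypothesis mark_bij : forall j, bijective (@mark j).

Notation labelled := {j : 'I_k & local_labels I j}.
Notation vx := (@param_vectors K r n k I base (@parameter_default K r n k I)).
Notation gx := (@param_matrix K r n k I base (@parameter_default K r n k I)).
Notation lx := (@param_scale K r n k I base (@parameter_default K r n k I)).
Notation fam := (@param_family K r n k I base).

Definition join_functions (A B : Type) (f : A -> K) (g : B -> K) (x : A + B) : K :=
  match x with inl a => f a | inr b => g b end.

(** All [s] are required so as to control every configuration over [q], and all [R] so that the
    solution of the system is a general lift. *)
Definition good (q : local_vectors K r I) (tau : labelled -> K) : Prop :=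
  forall s, fam s = q -> forall R : 'I_(r + 1) -> 'I_n, injective R ->
    \det (system mark (vx s) (lx s) tau R) != 0.

(** The pairs (s, tau) where some determinant vanishes form a proper hypersurface by
    [system_nonzero], in a space of the same dimension as that of the pairs (q, tau). Its image lies
    in a hypersurface G = 0, off which no bad [s] lies over [q]. *)
Lemma good_locus : poly_dominant K r I ->
  exists G : (labelled * 'I_r + labelled -> K) -> K,
    [/\ polyfun G, nonzero_fun G &
      forall q tau, G (join_functions (coords q) tau) != 0 -> good q tau].
Proof.
move=> dom.
pose S := (parameters r base + labelled)%type.
pose F (u : S -> K) := join_functions (coords (fam (fun p => u (inl p)))) (fun x => u (inr x)).
pose D (R : 'I_(r + 1) -> 'I_n) (u : S -> K) :=
  \det (system mark (vx (fun p => u (inl p))) (lx (fun p => u (inl p))) (fun x => u (inr x)) R).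
have pext p : polyfun (fun u : S -> K => extend (@parameter_default K r n k I) (fun p => u (inl p)) p).
  apply: (polyfun_comp (phi := fun s => extend (@parameter_default K r n k I) s p)).
    exact: polyfun_extend.
  by move=> p'; apply: polyfun_coord.
have pD R : polyfun (D R).
  apply: polyfun_system => [i a|x|x]; last exact: polyfun_coord.
    by apply: polyfun_ext (pext (inl (inl (i, a)))) => s; rewrite mxE.
  exact: pext.
have [|l||| G [pG nG GE]] := @hypersurface_image K charK S (labelled * 'I_r + labelled)%type F
  (fun u => \prod_(R : {ffun 'I_(r + 1) -> 'I_n} | injectiveb R) D R u).
- by rewrite !card_sum (card_parameters r2 nk hI base).
- case: l => [[t a]|t] /=; last exact: polyfun_coord.
  apply: (polyfun_comp (phi := fun s => coords (fam s) (t, a))).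
    exact: polyfun_family.
  by move=> p; apply: polyfun_coord.
- by apply: polyfun_prod => R; apply: pD.
- apply: nonzero_fun_prod => //; last by exists; exact: (fun=> 0).
  move=> R /injectiveP Rinj.
  have [s [tau E]] := system_nonzero charK r2 nk hI base mark_bij Rinj dom.
  by exists (join_functions s tau).
exists G; split=> // q tau Gq s sq R Rinj.
pose u : S -> K := join_functions s tau.
have Fu : F u = join_functions (coords q) tau by rewrite /F /u /= -sq.
have : \prod_(R : {ffun 'I_(r + 1) -> 'I_n} | injectiveb R) D R u != 0.
  by apply: contraNneq Gq => /GE; rewrite Fu => ->.
move/prodf_neq0 => /(_ [ffun a => R a]); have -> : injectiveb [ffun a => R a].
  by apply/injectiveP => a b; rewrite !ffunE => /Rinj.
move=> /(_ isT); rewrite /D /u /=.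
by congr (\det (system _ _ _ _ _) != 0); apply/funext => a; rewrite ffunE.
Qed.

Lemma card_eq_rel (A B : Type) (X : set A) (Y : set B) (Rel : A -> B -> Prop) :
  (forall x, X x -> exists2 y, Y y & Rel x y) ->
  (forall y, Y y -> exists2 x, X x & Rel x y) ->
  (forall x y y', Rel x y -> Rel x y' -> y = y') ->
  (forall x x' y, X x -> X x' -> Y y -> Rel x y -> Rel x' y -> x = x') ->
  X #= Y.
Proof.
move=> XY YX fu inj.
have /choice [f fP] : forall x : set_type X, exists y : set_type Y, Rel (val x) (val y).
  move=> x; have [y Yy xy] := XY _ (set_valP x).
  by exists (exist _ y (mem_set Yy)).
have /choice [g gP] : forall y : set_type Y, exists x : set_type X, Rel (val x) (val y).
  move=> y; have [x Xx xy] := YX _ (set_valP y).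
  by exists (exist _ x (mem_set Xx)).
apply/card_bijP; exists f; exists g => [x|y]; apply/val_inj.
  by apply: (inj _ _ _ (set_valP _) (set_valP _) (set_valP (f x)) (gP _) (fP _)).
by apply: (fu _ _ _ (fP _) (gP _)).
Qed.

Let rn : (r <= n)%N. Proof. by rewrite nk; lia. Qed.
Let rI j : (r <= #|I j|)%N. Proof. by rewrite hI; lia. Qed.
Let rL j : (r + 1 <= #|local_labels I j|)%N.
Proof.
have -> : #|local_labels I j| = #|I j| by rewrite card_sig; apply: eq_card.
by rewrite hI; lia.
Qed.

Lemma lift_config_scale v t w (l : 'I_n -> K) (g : 'M[K]_r) :
  g \in unitmx -> (forall i, l i != 0) -> (forall i, w i = l i *: (v i *m g)) ->
  proj_equiv (lift_config v t) (lift_config w (fun i => l i * t i)).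
Proof.
move=> ug l0 E; apply/lift_config_equiv; exists g, l, 1, 0; split=> // [|i].
  exact: oner_neq0.
by rewrite E mulmx0 mxE addr0 mul1r.
Qed.

Lemma lift_config_shift (v : 'I_n -> 'rV[K]_r) t (c : K) (p : 'cV[K]_r) : c != 0 ->
  proj_equiv (lift_config v t) (lift_config v (fun i => c * t i + (v i *m p) 0 0)).
Proof.
move=> c0; apply/lift_config_equiv; exists 1%:M, (fun=> 1), c, p; split=> // [||i].
- exact: unitmx1.
- by move=> i; apply: oner_neq0.
- by rewrite mulmx1 scale1r mul1r.
Qed.

Lemma first_solve (v : 'I_n -> 'rV[K]_r) (t : 'I_n -> K) : general v ->
  exists p : 'cV[K]_r, forall i : 'I_n, (i < r)%N -> (v i *m p) 0 0 = t i.
Proof.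
move=> gv; pose A := \matrix_(a < r) v (widen_ord rn a).
have uA : A \in unitmx.
  by rewrite unitmxE unitfE; apply: gv => a b /(congr1 val) /= /val_inj.
exists (invmx A *m \col_a t (widen_ord rn a)) => i ir.
have -> : i = widen_ord rn (Ordinal ir) by apply/val_inj.
rewrite -[v _](rowK (fun a => v (widen_ord rn a))) -row_mul mulKVmx // !mxE.
by [].
Qed.

(** By [frame_unique] the scalars of the given equivalence are on I_j a constant multiple of those
    of [s], so [tau] has the form required by [local_det_dep]. *)
Lemma lies_over_local_det s q tau t : general (vx s) -> fam s = q ->
  (forall j, gx s j \in unitmx) -> (forall x, lx s x != 0) ->
  lies_over (lift_config (vx s) t) (lift_local q tau) ->
  forall j, local_det mark (vx s) (lx s) tau j (\col_i t i) = 0.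
Proof.
move=> gv sq ug l0 /lies_over_lift H j; have [g [l [c [p [ug' l0' c0 E]]]]] := H j.
pose L (i : local_labels I j) := lx s (Tagged (local_labels I) i).
have qE i : block q j i = L i *: (vx s (val i) *m gx s j) by rewrite -sq.
have L0 i : L i != 0 by apply: l0.
have LE i : L i *: (vx s (val i) *m gx s j) = l i *: (vx s (val i) *m g).
  by rewrite -qE; have [-> _] := E i.
have ratio := frame_unique r2 nk (rL j) (general_restrict (J := I j) gv) (ug j) ug' L0 l0' LE.
have lE i : l i = l (base j) / L (base j) * L i by rewrite -(ratio i) divfK.
set m := l (base j) / L (base j) in lE.
have m0 : m != 0 by rewrite mulf_neq0 ?invr_eq0 //; apply: l0.
apply: (@local_det_dep K r n k I mark _ _ _ j _ (m *: p) (m * c)); first by rewrite mulf_neq0.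
move=> i x; have [_ ->] := E i; rewrite lE /L -/x -scalemxAr.
have E1 (M : 'M[K]_1) : (m *: M) 0 0 = m * M 0 0 by rewrite mxE.
have E2 : (\col_i t i : 'cV[K]_n) (val i) 0 = t (val i) by rewrite mxE.
by rewrite E1 E2; ring.
Qed.

Lemma lies_over_general_blocks (q : local_vectors K r I) (tau : labelled -> K) : general_blocks (lift_local q tau) -> general_blocks q.
Proof.
move=> H j; have := H j; rewrite block_lift.
by move=> /(general_coneP (@local_srcK n k I j) (@local_tgtK n k I j)) [].
Qed.

(** The r + k homogeneous equations in n = r + k + 1 unknowns have a nonzero solution [t]. Since
    every [system] is invertible, no [lift_minor] vanishes at [t], so the lift is general. *)
Lemma lift_exists s q tau : good q tau -> general_blocks (lift_local q tau) ->
  general (vx s) -> fam s = q -> (forall j, gx s j \in unitmx) -> (forall x, lx s x != 0) ->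
  exists t, general (lift_config (vx s) t) /\
    lies_over (lift_config (vx s) t) (lift_local q tau).
Proof.
move=> gqt gb gv sq ug l0.
pose A (i : 'I_n) (e : 'I_r + 'I_k) : K := match e with
  | inl a => (i == widen_ord rn a)%:R
  | inr j => local_det mark (vx s) (lx s) tau j (delta_mx i 0) end.
have ltA : (#|{: 'I_r + 'I_k}| < #|'I_n|)%N by rewrite card_sum !card_ord nk; lia.
have [t [i0 ti0] tA] := exists_left_kernel A ltA.
have tf (i : 'I_n) : (i < r)%N -> (\col_i t i : 'cV[K]_n) i 0 = 0.
  move=> ir; have := tA (inl (Ordinal ir)) => /= E; rewrite mxE -[RHS]E.
  have -> : widen_ord rn (Ordinal ir) = i by apply/val_inj.
  rewrite (bigD1 i) //= eqxx mulr1 big1 ?addr0 // => i' /negbTE ->.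
  by rewrite mulr0.
have td j : local_det mark (vx s) (lx s) tau j (\col_i t i) = 0.
  rewrite local_det_sum; have := tA (inr j) => /= E; rewrite -[RHS]E.
  by apply: eq_bigr => i _; rewrite mxE.
have tR (R : 'I_(r + 1) -> 'I_n) : injective R -> lift_minor (vx s) R (\col_i t i) != 0.
  move=> Rinj; apply/negP => /eqP tR0.
  have sk : system mark (vx s) (lx s) tau R *m (\col_i t i) = 0.
    by apply/(system_kernel r2 nk); split.
  have uS : system mark (vx s) (lx s) tau R \in unitmx.
    by rewrite unitmxE unitfE; apply: gqt.
  have := congr1 (mulmx (invmx (system mark (vx s) (lx s) tau R))) sk.
  rewrite mulKmx // mulmx0 => /colP /(_ i0); rewrite !mxE => ti00.
  by rewrite ti00 eqxx in ti0.
have gl : general (lift_config (vx s) t) by apply/general_lift.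
exists t; split=> //; apply/lies_over_lift => j.
have [p [b [c [pbc E]]]] := local_det_eq0 mark_bij (td j).
have E2 i : (\col_i t i : 'cV[K]_n) i 0 = t i by rewrite mxE.
have gloc : general (cone (@local_src n k I j) (fun i => vx s (val i)) (fun i => t (val i))).
  by rewrite -restrict_lift; apply: general_restrict gl.
have [_ gR] := (general_coneP (@local_srcK n k I j) (@local_tgtK n k I j) _ _).1 gloc.
have := gb j; rewrite block_lift.
move=> /(general_coneP (@local_srcK n k I j) (@local_tgtK n k I j)) [_ gR'].
pose R0 (a : 'I_(r + 1)) : local_labels I j := mark j (widen_ord (leq_addr 1 (r + 1)) a).
have R0inj : injective R0.
  by have [g gm _] := mark_bij j; move=> a a' /(can_inj gm) /(congr1 val) /= /val_inj.
(* With b = 0, [t] would be a linear form on I_j, against the generality of the lift; with c = 0,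
   [tau] would be one, against the generality of the lifted blocks. *)
have b0 : b != 0.
  apply/negP => /eqP b0; have /eqP := gR R0 R0inj; apply.
  have vpt (i : local_labels I j) : (vx s (val i) *m p) 0 0 + c * t (val i) = 0.
    have := E i; rewrite /= b0 mul0r addr0 E2 mulrCA -mulrDr => /eqP.
    by rewrite mulf_eq0 (negbTE (l0 _)) => /eqP.
  apply: (last_det_comb (p := p) (c := c)) => [|a]; last exact: vpt.
  apply: contraTneq pbc => c0; rewrite b0 c0 !eqxx !orbF negbK; apply/eqP.
  apply: (local_ker r2 nk mark_bij gv (j := j)) => i iI.
  by have := vpt (exist _ i iI); rewrite c0 mul0r addr0.
have c0 : c != 0.
  apply/negP => /eqP c0; have /eqP := gR' R0 R0inj; apply.
  apply: (@last_det_comb K r _ (block q j) (fun i => tau (Tagged (local_labels I) i)) R0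
    (invmx (gx s j) *m p) b) => // a.
  have := E (R0 a); rewrite /= c0 mul0r addr0 => Ea; rewrite -[RHS]Ea; congr (_ + _).
  have -> : block q j (R0 a) = lx s (Tagged (local_labels I) (R0 a)) *: (vx s (val (R0 a)) *m gx s j).
    by rewrite -sq.
  by rewrite mulmxA -scalemxAl mulmxK // -scalemxAl mxE.
exists (gx s j), (fun i => lx s (Tagged (local_labels I) i)), (- (c / b)), (- b^-1 *: p).
split=> // [|i]; first by rewrite oppr_eq0 mulf_neq0 ?invr_eq0.
split; first by rewrite -sq.
have Ei := E i; apply: (mulfI b0).
have E1 (M : 'M[K]_1) : (- b^-1 *: M) 0 0 = - b^-1 * M 0 0 by rewrite mxE.
rewrite -scalemxAr E1.
have -> : b * tau (Tagged (local_labels I) i) = - (lx s (Tagged (local_labels I) i) * (vx s (val i) *m p) 0 0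
   + c * (lx s (Tagged (local_labels I) i) * t (val i))).
  apply/eqP; rewrite -addr_eq0; apply/eqP; rewrite -[RHS]Ei /= E2; ring.
by field.
Qed.

Let rn'' : (r <= #|'I_n|)%N. Proof. by rewrite card_ord. Qed.
Let r2' : (2 <= r.+1)%N. Proof. exact: leqW. Qed.
Let rn1 : (r.+1 <= n.+1)%N. Proof. by rewrite ltnS. Qed.
Let rn1'' : (r.+1 <= #|'I_n.+1|)%N. Proof. by rewrite card_ord. Qed.
Let rI' j : (r.+1 <= #|append_marking I j|)%N. Proof. by rewrite card_append ltnS. Qed.

Lemma orbit_eq (v w : 'I_n -> 'rV[K]_r) : general v -> general w ->
  pgl_orbit (span_config v) = pgl_orbit (span_config w) <-> proj_equiv v w.
Proof.
by move=> gv gw; apply: pgl_orbit_eq => i; [apply: (general_neq0 rn'' r2 i gv) | apply: (general_neq0 rn'' r2 i gw)].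
Qed.

Lemma orbit_eq' (v w : 'I_n.+1 -> 'rV[K]_r.+1) : general v -> general w ->
  pgl_orbit (span_config v) = pgl_orbit (span_config w) <-> proj_equiv v w.
Proof.
by move=> gv gw; apply: pgl_orbit_eq => i; [apply: (general_neq0 rn1'' r2' i gv) | apply: (general_neq0 rn1'' r2' i gw)].
Qed.

Lemma lift_reduce (v w : 'I_n -> 'rV[K]_r) t : general v -> proj_equiv v w ->
  exists t', proj_equiv (lift_config v t) (lift_config w t') /\
    forall i : 'I_n, (i < r)%N -> t' i = 0.
Proof.
move=> gv vw; have gw := general_equiv vw gv; have [B [m [uB m0 E]]] := vw.
have [p pE] := first_solve (fun i => - (m i * t i)) gw.
exists (fun i => 1 * (m i * t i) + (w i *m p) 0 0); split.
  apply: proj_equiv_trans (lift_config_scale t uB m0 E) _.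
  exact: lift_config_shift (oner_neq0 _).
by move=> i /pE ->; rewrite mul1r subrr.
Qed.

(** The combination of [t] and [u] that kills the minor on one [R] solves the whole invertible
    system, so it is zero and the two are proportional. *)
Lemma lift_unique s q tau t u : good q tau ->
  general (vx s) -> fam s = q -> (forall j, gx s j \in unitmx) -> (forall x, lx s x != 0) ->
  general (lift_config (vx s) t) -> general (lift_config (vx s) u) ->
  lies_over (lift_config (vx s) t) (lift_local q tau) ->
  lies_over (lift_config (vx s) u) (lift_local q tau) ->
  (forall i : 'I_n, (i < r)%N -> t i = 0) -> (forall i : 'I_n, (i < r)%N -> u i = 0) ->
  proj_equiv (lift_config (vx s) t) (lift_config (vx s) u).
Proof.
move=> gqt gv sq ug l0 gt gu lt lu t0 u0.
have dt := lies_over_local_det gv sq ug l0 lt.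
have du := lies_over_local_det gv sq ug l0 lu.
have rn1' : (r + 1 <= n)%N by rewrite nk; lia.
pose R := widen_ord rn1'.
have Rinj : injective R by move=> a b /(congr1 val) /= /val_inj.
have tR : lift_minor (vx s) R (\col_i t i) != 0 by have [_] := (general_lift _ _).1 gt; apply.
have uR : lift_minor (vx s) R (\col_i u i) != 0 by have [_] := (general_lift _ _).1 gu; apply.
set dT := lift_minor _ _ _ in tR; set dU := lift_minor _ _ _ in uR.
set N := system mark (vx s) (lx s) tau R.
have uN : N \in unitmx by rewrite unitmxE unitfE; apply: gqt.
have N0 : N *m (dU *: (\col_i t i) - dT *: (\col_i u i)) = 0.
  apply/colP => y; rewrite mulmxBr -!scalemxAr.
  have -> : (dU *: (N *m \col_i t i) - dT *: (N *m \col_i u i)) y 0 =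
      dU * (N *m \col_i t i) y 0 - dT * (N *m \col_i u i) y 0 by rewrite !(mxE, mulmxE).
  rewrite !systemE [RHS]mxE /system_row; case: ifP => [yr|_].
    by rewrite !mxE t0 ?u0 // !mulr0 subr0.
  case: ifP => _; first by rewrite -/dT -/dU mulrC subrr.
  by case: insub => [j|]; rewrite ?dt ?du !mulr0 subr0.
have E : dU *: (\col_i t i) - dT *: (\col_i u i) = 0 :> 'cV[K]_n.
  by apply: (can_inj (mulKmx uN)); rewrite N0 mulmx0.
have uE i : u i = dU / dT * t i.
  have /colP /(_ i) := E; rewrite !mxE => /eqP; rewrite subr_eq0 => /eqP Ei.
  by apply: (mulfI tR); rewrite -Ei mulrA mulrCA mulfV // mulr1.
have -> : u = fun i => dU / dT * t i + (vx s i *m (0 : 'cV[K]_r)) 0 0.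
  by apply/funext => i; rewrite uE mulmx0 mxE addr0.
by apply: lift_config_shift; rewrite mulf_neq0 ?invr_eq0.
Qed.

(** A point of the lower fibre corresponds to its lift, which exists by [lift_exists] and is unique
    by [lift_unique]; every point of the upper fibre is a cone by [cone_exists], and its projection
    lies over [q]. *)
Lemma fibre_lift q tau : good q tau -> general_blocks (lift_local q tau) ->
  fibre q #= fibre (lift_local q tau).
Proof.
move=> gqt gb; have gq := lies_over_general_blocks gb.
have fP x := fibreP r2 rn rI x gq.
have fP' x := fibreP r2' rn1 rI' x gb.
apply: (card_eq_rel (Rel := fun x x' => exists v t, [/\ general (lift_config v t),
    lies_over (lift_config v t) (lift_local q tau),
    x = pgl_orbit (span_config v) & x' = pgl_orbit (span_config (lift_config v t))])).
- move=> x /fP [v [gv vq xE]].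
  have [s [vs sq ug l0]] := family_surjective r2 nk base gv vq.
  have gs := general_equiv vs gv.
  have [t [gt lt]] := lift_exists gqt gb gs sq ug l0.
  exists (pgl_orbit (span_config (lift_config (vx s) t))).
    by apply/fP'; exists (lift_config (vx s) t).
  by exists (vx s), t; split=> //; rewrite xE; apply/orbit_eq.
- move=> x' /fP' [w [gw lw ->]].
  have [v [t wvt]] := cone_exists (@label_srcK n) (@label_tgtK n) (general_neq0 rn1'' r2' (label_tgt None) gw).
  rewrite -/(lift_config v t) in wvt.
  have gvt := general_equiv wvt gw; have [gv _] := (general_lift v t).1 gvt.
  have lvt := lies_over_trans wvt lw.
  exists (pgl_orbit (span_config v)).
    by apply/fP; exists v; split=> //; apply: lies_over_drop lvt.
  by exists v, t; split=> //; apply/orbit_eq'.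
- move=> x y y' [v [t [gt lt xE ->]]] [w [u [gu lu xE' ->]]].
  have [gv _] := (general_lift v t).1 gt; have [gw _] := (general_lift w u).1 gu.
  have vw : proj_equiv v w by apply/orbit_eq; rewrite -?xE.
  have [s [vs sq ug l0]] := family_surjective r2 nk base gv (lies_over_drop lt).
  have ws := proj_equiv_trans (proj_equiv_sym vw) vs.
  have gs := general_equiv vs gv.
  have [t' [tt' t0]] := lift_reduce t gv vs.
  have [u' [uu' u0]] := lift_reduce u gw ws.
  apply/orbit_eq' => //; apply: (proj_equiv_trans tt').
  apply: (proj_equiv_trans _ (proj_equiv_sym uu')).
  apply: (lift_unique gqt gs sq ug l0 _ _ _ _ t0 u0).
  + exact: general_equiv tt' gt.
  + exact: general_equiv uu' gu.
  + exact: lies_over_trans tt' lt.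
  + exact: lies_over_trans uu' lu.
- move=> x x' y _ _ _ [v [t [gt lt -> yE]]] [w [u [gu lu -> yE']]].
  have [gv _] := (general_lift v t).1 gt; have [gw _] := (general_lift w u).1 gu.
  have /lift_config_equiv [g [l [c [p [ug l0 c0 E]]]]] :
      proj_equiv (lift_config v t) (lift_config w u) by apply/orbit_eq'; rewrite -?yE.
  by apply/orbit_eq => //; exists g, l; split=> // i; have [] := E i.
Qed.

End Fibres.

(** * Polynomial conditions on pairs (q, tau) and on families upstairs *)

Section Transfer.
Local Open Scope ring_scope.
Local Open Scope classical_set_scope.
Local Open Scope card_scope.
Variables (K : fieldType) (r n k : nat) (I : 'I_k -> {set 'I_n}).
Hypothesis charK : [pchar K]%R =i pred0.
Hypothesis r2 : (2 <= r)%N.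
Hypothesis nk : n = (k + r + 1)%N.
Hypothesis hI : forall j, #|I j| = (r + 2)%N.

Notation labelled := {j : 'I_k & local_labels I j}.
Notation lifted := {j : 'I_k & local_labels (append_marking I) j}.
Notation local_vectors' := (local_vectors K r.+1 (append_marking I)).

Let r2' : (2 <= r.+1)%N. Proof. exact: leqW. Qed.
Let rI' j : (r.+1 <= #|append_marking I j|)%N. Proof. by rewrite card_append ltnS hI leq_addr. Qed.
Let rT' j : (r.+1 <= #|local_labels (append_marking I) j|)%N.
Proof.
have -> : #|local_labels (append_marking I) j| = #|append_marking I j|.
  by rewrite card_sig; apply: eq_card.
exact: rI'.
Qed.

Definition equiv_blocks (q q' : local_vectors') : Prop :=
  forall j, proj_equiv (block q j) (block q' j).

Lemma equiv_orbits q q' : general_blocks q -> equiv_blocks q q' ->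
  general_blocks q' /\ orbits q = orbits q'.
Proof.
move=> gq qq'; have gq' : general_blocks q' by move=> j; apply: general_equiv (qq' j) (gq j).
split=> //; apply/functional_extensionality_dep => j; apply/pgl_orbit_eq => // i.
  exact: (general_neq0 (rT' j) r2' i (gq j)).
exact: (general_neq0 (rT' j) r2' i (gq' j)).
Qed.

Lemma polyfun_lift_local (S : Type) (F : (S -> K) -> local_vectors K r I) T :
  (forall x a, polyfun (fun s => F s x 0 a)) -> (forall x, polyfun (fun s => T s x)) ->
  forall x a, polyfun (fun s => lift_local (F s) (T s) x 0 a).
Proof.
move=> pF pT [j x] a; rewrite /lift_local /cone /=.
case: (local_src x) => [i|]; last exact: polyfun_const.
case: (split_ordP (a : 'I_(1 + r))) => b ->.
  apply: polyfun_ext (pT (Tagged (local_labels I) i)) => s.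
  apply: esym; etransitivity; first exact: (@row_mxEl K 1 1 r _ _ 0 b).
  by rewrite !ord1 mxE eqxx mulr1n.
apply: polyfun_ext (pF (Tagged (local_labels I) i) b) => s.
exact: esym (@row_mxEr K 1 1 r _ _ 0 b).
Qed.

(** [phi] is not invariant and may vanish on all lifts [lift_local q tau]. It is therefore composed
    with a fixed group element [tr] that carries one lift to a general family [q1] with phi q1
    nonzero. *)
Lemma pullback (phi : local_vectors' -> K) q0 : vpolyfun phi -> phi q0 != 0 ->
  exists G : (labelled * 'I_r + labelled -> K) -> K,
    [/\ polyfun G, nonzero_fun G & forall q tau, G (join_functions (coords q) tau) != 0 ->
      general_blocks (lift_local q tau) /\
      exists2 q', equiv_blocks (lift_local q tau) q' & phi q' != 0].
Proof.
move=> pphi q0P.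
have [q1 [gq1 q1P]] := nonzero_general_blocks charK pphi q0P.
have ex j : exists vtAl : (local_labels I j -> 'rV[K]_r) * (local_labels I j -> K) *
    ('M[K]_r.+1 * (local_labels (append_marking I) j -> K)),
  [/\ vtAl.2.1 \in unitmx, forall x, vtAl.2.2 x != 0 &
    forall x, block q1 j x = vtAl.2.2 x *: (cone (@local_src n k I j) vtAl.1.1 vtAl.1.2 x *m vtAl.2.1)].
  have [v [t /proj_equiv_sym [A [l [uA l0 E]]]]] := cone_exists (@local_srcK n k I j)
    (@local_tgtK n k I j) (general_neq0 (rT' j) r2' (local_tgt None) (gq1 j)).
  by exists ((v, t), (A, l)).
pose c j := projT1 (cid (ex j)).
have cP j : [/\ (c j).2.1 \in unitmx, forall x, (c j).2.2 x != 0 &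
    forall x, block q1 j x = (c j).2.2 x *: (cone (@local_src n k I j) (c j).1.1 (c j).1.2 x *m (c j).2.1)]
  := projT2 (cid (ex j)).
pose tr (q : local_vectors') : local_vectors' :=
  fun x => (c (tag x)).2.2 (tagged x) *: (q x *m (c (tag x)).2.1).
have trE q : equiv_blocks q (tr q).
  by move=> j; have [uA l0 _] := cP j; exists (c j).2.1, (c j).2.2.
pose L (u : labelled * 'I_r + labelled -> K) : local_vectors' :=
  lift_local (vectors (fun x => u (inl x))) (fun x => u (inr x)).
have pL x a : polyfun (fun u => L u x 0 a).
  apply: polyfun_lift_local => [y b|y]; last exact: polyfun_coord.
  by apply: (polyfun_ext (phi := fun u => u (inl (y, b)))) (polyfun_coord _ _) => u; rewrite mxE.
exists (fun u => blocks_prod (L u) * phi (tr (L u))); split.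
- apply: polyfunM; first exact: polyfun_blocks_prod.
  apply: (vpolyfun_comp (F := fun u => tr (L u)) pphi) => x a.
  apply: (polyfun_ext (phi := fun u =>
     (c (tag x)).2.2 (tagged x) * \sum_b L u x 0 b * (c (tag x)).2.1 b a)).
    by move=> u; rewrite !mxE.
  apply: polyfunM; first exact: polyfun_const.
  by apply: polyfun_sum => b; apply: polyfunM => //; apply: polyfun_const.
- pose qq : local_vectors K r I := fun x => (c (tag x)).1.1 (tagged x).
  exists (join_functions (coords qq) (fun x => (c (tag x)).1.2 (tagged x))).
  rewrite /L /= -/(coords qq) coordsK.
  set l := lift_local _ _.
  have trq : tr l = q1.
    by apply/funext => -[j x]; have [_ _ E] := cP j; apply/esym/(E x).
  have gl : general_blocks l.
    by have [] := equiv_orbits (q := q1) (q' := l) gq1; first by move=> j; apply: proj_equiv_sym; rewrite -trq; apply: trE.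
  by rewrite trq mulf_neq0 //; apply/general_blocksP.
- move=> q tau; rewrite /L /= coordsK mulf_eq0 negb_or => /andP[/general_blocksP gb p0].
  by split=> //; exists (tr (lift_local q tau)).
Qed.

(** Where the apex of each block has nonzero first coordinate, a matrix with entries polynomial in
    [q'] moves the apex to a multiple of the first basis vector; [Q] and [T] are the data of the
    resulting cone, obtained without division. *)
Lemma pushforward (G : (labelled * 'I_r + labelled -> K) -> K) : polyfun G -> nonzero_fun G ->
  exists phi : local_vectors' -> K, [/\ vpolyfun phi, exists q', phi q' != 0 &
    forall q', phi q' != 0 -> exists q tau, equiv_blocks q' (lift_local q tau) /\
      G (join_functions (coords q) tau) != 0].
Proof.
move=> pG [u0 Gu0].
pose at_ (q' : local_vectors') j (o : option (local_labels I j)) : 'rV[K]_(1 + r) :=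
  q' (Tagged (local_labels (append_marking I)) (local_tgt o)).
pose T (q' : local_vectors') (x : labelled) : K := lsubmx (at_ q' (tag x) (Some (tagged x))) 0 0.
pose Q (q' : local_vectors') (x : labelled) : 'rV[K]_r :=
  lsubmx (at_ q' (tag x) None) 0 0 *: rsubmx (at_ q' (tag x) (Some (tagged x)))
  - T q' x *: rsubmx (at_ q' (tag x) None).
pose phi q' := \prod_j lsubmx (at_ q' j None) 0 0 * G (join_functions (coords (Q q')) (T q')).
have pat j o a : polyfun (fun s => at_ (vectors s) j o 0 a).
  exact: (@vpolyfun_entry K r.+1 lifted (Tagged (local_labels (append_marking I)) (local_tgt o)) a).
have pl j o : polyfun (fun s => lsubmx (at_ (vectors s) j o) 0 0).
  by apply: polyfun_ext (pat j o (lshift r 0)) => s; rewrite [RHS]mxE.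
have pr j o a : polyfun (fun s => rsubmx (at_ (vectors s) j o) 0 a).
  by apply: polyfun_ext (pat j o (rshift 1 a)) => s; rewrite [RHS]mxE.
exists phi; split.
- apply: polyfunM; first by apply: polyfun_prod => j; apply: pl.
  apply: (polyfun_comp (F := fun s => join_functions (coords (Q (vectors s))) (T (vectors s))) pG).
  move=> [[x a]|x] /=; last exact: pl.
  rewrite /coords /Q /=.
  apply: (polyfun_ext (phi := fun s => lsubmx (at_ (vectors s) (tag x) None) 0 0 *
     rsubmx (at_ (vectors s) (tag x) (Some (tagged x))) 0 a -
     T (vectors s) x * rsubmx (at_ (vectors s) (tag x) None) 0 a)).
    by move=> s; rewrite [RHS]mxE; congr (_ + _); rewrite !mxE.
  by apply: polyfunB; apply: polyfunM; first [exact: pl | exact: pr].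
- pose q0 : local_vectors K r I := vectors (fun x => u0 (inl x)).
  pose t0 (x : labelled) := u0 (inr x).
  exists (lift_local q0 t0).
  have atE j o : at_ (lift_local q0 t0) j o =
      (if o is Some i then row_mx (t0 (Tagged (local_labels I) i))%:M (q0 (Tagged (local_labels I) i))
      else row_mx 1 0).
    by rewrite /at_ /lift_local /cone /= local_tgtK; case: o.
  rewrite mulf_neq0 //.
    by apply/prodf_neq0 => j _; rewrite atE row_mxKl mxE eqxx oner_eq0.
  have TE : T (lift_local q0 t0) = t0.
    by apply/funext => -[j i]; rewrite /T atE row_mxKl mxE eqxx mulr1n.
  have QE : Q (lift_local q0 t0) = q0.
    apply/funext => -[j i]; rewrite /Q !atE row_mxKl !row_mxKr mxE eqxx scaler0 subr0.
    by rewrite scale1r.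
  rewrite TE QE (_ : join_functions _ _ = u0) //.
  by apply/funext => -[[x a]|x]; rewrite //= /coords /q0 mxE.
move=> q'; rewrite /phi mulf_eq0 negb_or => /andP[/prodf_neq0 b0 Gq].
exists (Q q'), (T q'); split=> // j.
set b := lsubmx (at_ q' j None) 0 0.
have bj : b != 0 by apply: b0.
pose A : 'M[K]_(1 + r) := block_mx 1%:M (- rsubmx (at_ q' j None)) 0 b%:M.
have uA : A \in unitmx.
  by rewrite unitmxE det_ublock det1 mul1r det_scalar unitfE expf_neq0.
have mulA x : x *m A = row_mx (lsubmx x) (b *: rsubmx x - lsubmx x 0 0 *: rsubmx (at_ q' j None)) :> 'rV[K]_(1 + r).
  rewrite -{1}[x]hsubmxK mul_row_block mulmx1 mulmx0 addr0 mulmxN mul_mx_scalar addrC.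
  by rewrite {2}[lsubmx x]mx11_scalar mul_scalar_mx.
exists A, (fun x => if local_src x is Some _ then 1 else b^-1); split=> // [x|x].
  by case: (local_src x); rewrite ?oner_eq0 ?invr_eq0.
have E : block (lift_local (Q q') (T q')) j x =
   (if local_src x is Some _ then 1 else b^-1) *: ((block q' j x : 'rV[K]_(1 + r)) *m A) :> 'rV[K]_(1 + r).
  rewrite block_lift /cone -[x in block q' j x]local_srcK.
  case: (local_src x) => [i|].
    rewrite scale1r; apply: esym; apply: etrans (mulA (at_ q' j (Some i))) _.
    by congr row_mx; rewrite [LHS]mx11_scalar.
  have mulN : at_ q' j None *m A = row_mx b%:M 0.
    by rewrite mulA -/b subrr {1}[lsubmx _]mx11_scalar.
  apply: esym; apply: etrans (congr1 (fun y => b^-1 *: y) mulN) _.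
  by rewrite scale_row_mx scaler0 scale_scalar_mx mulVf.
exact: E.
Qed.

End Transfer.

(** * Comparison of the two counts *)

Section Final.
Local Open Scope ring_scope.
Local Open Scope classical_set_scope.
Local Open Scope card_scope.
Variables (K : fieldType) (r n k : nat) (I : 'I_k -> {set 'I_n}).
Hypothesis charK : [pchar K]%R =i pred0.
Hypothesis r2 : (2 <= r)%N.
Hypothesis nk : n = (k + r + 1)%N.
Hypothesis hI : forall j, #|I j| = (r + 2)%N.

Notation labelled := {j : 'I_k & local_labels I j}.

Let cL j : #|local_labels I j| = (r + 1 + 1)%N.
Proof.
have -> : #|local_labels I j| = #|I j| by rewrite card_sig; apply: eq_card.
by rewrite hI; lia.
Qed.

Definition marking j (x : 'I_(r + 1 + 1)) : local_labels I j :=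
  enum_val (cast_ord (esym (cL j)) x).

Lemma marking_bij j : bijective (@marking j).
Proof.
exists (fun i => cast_ord (cL j) (enum_rank i)) => x.
  by rewrite /marking enum_valK cast_ordKV.
by rewrite /marking cast_ordK enum_rankK.
Qed.

Let base j : local_labels I j := marking j (cast_ord (esym (addn1 (r + 1))) ord0).

Let r2' : (2 <= r.+1)%N. Proof. exact: leqW. Qed.
Let rI j : (r <= #|I j|)%N. Proof. by rewrite hI leq_addr. Qed.
Let rI' j : (r.+1 <= #|append_marking I j|)%N. Proof. by rewrite card_append ltnS. Qed.
Let rn1'' : (r.+1 <= #|'I_n.+1|)%N. Proof. by rewrite card_ord nk; lia. Qed.

Notation goodP := (@good K r n k I base marking).

Lemma lies_over_equiv (w : 'I_n.+1 -> 'rV[K]_r.+1) q q' :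
  equiv_blocks q q' -> lies_over w q -> @lies_over K r.+1 n.+1 k (append_marking I) w q'.
Proof. by move=> qq' wq j; apply: proj_equiv_trans (wq j) (qq' j). Qed.

Lemma equiv_blocks_sym q q' : equiv_blocks q q' -> @equiv_blocks K r n k I q' q.
Proof. by move=> qq' j; apply: proj_equiv_sym. Qed.

Lemma fibre_equiv q q' : general_blocks q -> @equiv_blocks K r n k I q q' ->
  fibre q = fibre q'.
Proof. by move=> gq qq'; rewrite /fibre (equiv_orbits r2 hI gq qq').2. Qed.

Lemma poly_dominant_drop : poly_dominant K r.+1 (append_marking I) -> poly_dominant K r I.
Proof.
move=> dom phi pphi [q0 q0P].
have [||psi [ppsi expsi psiP]] := @pushforward K r n k I
  (fun u => phi (vectors (fun x => u (inl x)))).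
- apply: (vpolyfun_comp (F := fun u => vectors (fun x => u (inl x))) pphi) => x a.
  by apply: (polyfun_ext (phi := fun u => u (inl (x, a)))) (polyfun_coord _ _) => u; rewrite mxE.
- by exists (join_functions (coords q0) (fun=> 0)); rewrite /= -/(coords q0) coordsK.
have [w [q' [gw wq' psiq]]] := dom psi ppsi expsi.
have [q [tau [qq' phiq]]] := psiP q' psiq.
have [v [t wvt]] := cone_exists (@label_srcK n) (@label_tgtK n) (general_neq0 rn1'' r2' (label_tgt None) gw).
have gvt := general_equiv wvt gw; have [gv _] := (general_lift v t).1 gvt.
exists v, q; split=> //; last by move: phiq; rewrite /= coordsK.
by apply: (@lies_over_drop _ _ _ _ _ v t q tau); apply: lies_over_trans wvt (lies_over_equiv qq' wq').
Qed.

(** The conditions of [good_locus] and [pullback] hold together at one point [u]; fixing its [tau]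
    leaves a nonzero polynomial condition on [q] alone. *)
Lemma good_pullback (phi : local_vectors K r.+1 (append_marking I) -> K) q0 :
  poly_dominant K r I -> vpolyfun phi -> phi q0 != 0 ->
  exists tau, exists2 psi : local_vectors K r I -> K, vpolyfun psi &
    (exists q, psi q != 0) /\ forall q, psi q != 0 ->
      [/\ goodP q tau, general_blocks (lift_local q tau) &
          exists2 q', equiv_blocks (lift_local q tau) q' & phi q' != 0].
Proof.
move=> dom pphi q0P.
have [G [pG nG GP]] := good_locus charK r2 nk hI base marking_bij dom.
have [H [pH nH HP]] := pullback charK r2 hI pphi q0P.
have [u uP] := nonzero_funM charK pG pH nG nH.
pose tau (x : labelled) := u (inr x).
pose emb (s : labelled * 'I_r -> K) := join_functions s tau.
have pemb F : polyfun F -> polyfun (fun s => F (emb s)).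
  move=> pF; apply: (polyfun_comp pF) => -[x|x]; first exact: polyfun_coord.
  exact: polyfun_const.
have vK (y : labelled * 'I_r -> K) : coords (vectors y) = y.
  by apply/funext => -[t a]; rewrite /coords mxE.
exists tau, (fun q => G (emb (coords q)) * H (emb (coords q))).
  by apply: polyfunM; [apply: polyfun_ext (pemb _ pG) | apply: polyfun_ext (pemb _ pH)] => s; rewrite vK.
split.
  exists (vectors (fun x => u (inl x))); rewrite vK.
  have -> : emb (fun x => u (inl x)) = u by apply/funext => -[].
  exact: uP.
move=> q; rewrite mulf_eq0 negb_or => /andP[/GP gq /HP [gb ex]].
by split.
Qed.

Lemma poly_dominant_lift : poly_dominant K r I -> poly_dominant K r.+1 (append_marking I).
Proof.
move=> dom phi pphi [q0 q0P].
have [tau [psi ppsi [expsi psiP]]] := good_pullback dom pphi q0P.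
have [v [q [gv vq psiq]]] := dom psi ppsi expsi.
have [gq gb [q' qq' phiq]] := psiP q psiq.
have [s [vs sq ug l0]] := family_surjective r2 nk base gv vq.
have [t [gt lt]] := lift_exists r2 nk marking_bij gq gb (general_equiv vs gv) sq ug l0.
by exists (lift_config (param_vectors (@parameter_default K r n k I) s) t), q'; split=> //; apply: lies_over_equiv lt.
Qed.

(** Both directions compare fibres by [fibre_lift]: downwards at the fixed [tau] of [good_pullback],
    upwards on the families that [pushforward] relates to a good pair (q, tau). *)
Lemma general_fibre_card_lift d : poly_dominant K r I ->
  general_fibre_card K r.+1 (append_marking I) d <-> general_fibre_card K r I d.
Proof.
move=> dom; split.
  move=> /(general_fibre_cardP charK r2' rI') [phi [pphi [q0 q0P] phiP]].
  apply/(general_fibre_cardP charK r2 rI).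
  have [tau [psi ppsi [expsi psiP]]] := good_pullback dom pphi q0P.
  exists psi; split=> // q /psiP [gq gb [q' qq' /phiP [gq' cq']]].
  split; first exact: lies_over_general_blocks gb.
  apply: card_eq_trans (fibre_lift r2 nk hI marking_bij gq gb) _.
  by rewrite (fibre_equiv gb qq').
move=> /(general_fibre_cardP charK r2 rI) [phi [pphi [q0 q0P] phiP]].
apply/(general_fibre_cardP charK r2' rI').
have [G [pG nG GP]] := good_locus charK r2 nk hI base marking_bij dom.
(* With the constant 1 for [phi], this only asks that the lifted blocks be general. *)
have [H [pH nH HP]] := pullback charK r2 hI (phi := fun=> 1) (q0 := fun=> 0)
  (polyfun_const _ _) (oner_neq0 _).
have pphi' : polyfun (fun u : labelled * 'I_r + labelled -> K => phi (vectors (fun x => u (inl x)))).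
  apply: (vpolyfun_comp (F := fun u => vectors (fun x => u (inl x))) pphi) => x a.
  by apply: (polyfun_ext (phi := fun u => u (inl (x, a)))) (polyfun_coord _ _) => u; rewrite mxE.
have nphi : nonzero_fun (fun u : labelled * 'I_r + labelled -> K => phi (vectors (fun x => u (inl x)))).
  by exists (join_functions (coords q0) (fun=> 0)); rewrite /= -/(coords q0) coordsK.
have [psi [ppsi expsi psiP]] := pushforward (polyfunM (polyfunM pG pH) pphi')
  (nonzero_funM charK (polyfunM pG pH) pphi' (nonzero_funM charK pG pH nG nH) nphi).
exists psi; split=> // q' /psiP [q [tau [qq' ]]].
rewrite !mulf_eq0 !negb_or /= coordsK => /andP[/andP[/GP gq /HP [gb _]] /phiP [_ cq]].
have qq'' := equiv_blocks_sym qq'.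
have [gq' _] := equiv_orbits r2 hI gb qq''.
split=> //; rewrite -(fibre_equiv gb qq'').
by apply: card_eq_trans cq; rewrite card_eq_sym; apply: (fibre_lift r2 nk hI marking_bij gq gb).
Qed.

End Final.

Theorem theoremB (K : closedFieldType) (charK : [pchar K]%R =i pred0)
    (r n k : nat) (hr : 2 <= r) (hn : r + 1 <= n) (hk : k = n - r - 1)
    (I : 'I_k -> {set 'I_n}) (hI : forall j, #|I j| = r + 2) :
  config_count K r.+1 n.+1 k (append_marking I) = config_count K r n k I.
Proof.
have nk : n = k + r + 1 by lia.
have rn : r <= n by lia.
have rI j : r <= #|I j| by rewrite hI leq_addr.
have rI' j : r.+1 <= #|append_marking I j| by rewrite card_append ltnS.
have domE : fgts_dominant K r.+1 (append_marking I) <-> fgts_dominant K r I.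
  rewrite (fgts_dominantP charK (leqW hr) (rn : r.+1 <= n.+1) rI').
  rewrite (fgts_dominantP charK hr rn rI).
  by split=> [|dom]; [apply: poly_dominant_drop | apply: poly_dominant_lift].
rewrite /config_count (propext domE); case: asboolP => // /(fgts_dominantP charK hr rn rI) dom.
(* The two sets of possible cardinalities are equal, so [xget] chooses the same number from both. *)
congr xget; apply/seteqP; split=> d /=.
  exact: (general_fibre_card_lift charK hr nk hI d dom).1.
exact: (general_fibre_card_lift charK hr nk hI d dom).2.
Qed.
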